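(* Let $(\mathcal T_h)_{h\in\mathcal H}$ be an admissible mesh sequence of $\Omega$ with parameter $\varrho$ and let $k\ge0$ be an integer. Let $1\le q\le p^*$ if $1\le p<d$, and $1\le q<+\infty$ if $d\le p<+\infty$, where $p^*=\frac{dp}{d-p}$ for $p<d$. Then there exists $C$ depending only on $\Omega$, $\varrho$, $k$, $q$ and $p$ such that, for all $h\in\mathcal H$, $$\|v_h\|_{L^q(\Omega)}\le C\,\|\underline v_h\|_{1,p,h}\qquad\text{for all }\underline v_h\in\underline U_{h,0}^k.$$
   Context: **Mesh.** Let $d\ge 1$ and let $\Omega\subset\mathbb R^d$ be a bounded connected polytopal domain with boundary $\partial\Omega$. A polyhedral set is an open, connected, bounded set whose boundary is a finite union of parts of hyperplanes and which lies locally on only one side of its boundary. Let $\mathcal H\subset(0,+\infty)$ be countable with $0$ as its unique accumulation point. For $h\in\mathcal H$, $\mathcal T_h$ is a finite collection of nonempty pairwise disjoint polyhedral elements $T$ with $\overline\Omega=\bigcup_{T\in\mathcal T_h}\overline T$ and $h=\max_{T\in\mathcal T_h}h_T$, $h_T$ being the diameter of $T$. A face $F$ is a hyperplanar closed connected subset of $\overline\Omega$ with positive $(d-1)$-dimensional Hausdorff measure such that either $F\subset\partial T_1\cap\partial T_2$ for two distinct $T_1,T_2\in\mathcal T_h$ (interface), or $F\subset\partial T\cap\partial\Omega$ for some $T\in\mathcal T_h$ (boundary face). Interfaces are collected in $\mathcal F_h^{\rm i}$, boundary faces in $\mathcal F_h^{\rm b}$, and $\mathcal F_h=\mathcal F_h^{\rm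 i}\cup\mathcal F_h^{\rm b}$; the faces in $\mathcal F_h$ have pairwise disjoint relative interiors and the boundary of each element is the union of the faces it contains. $h_F$ is the diameter of $F$ (if $d=1$, $h_F$ is a positive number satisfying $\varrho^2h_T\le h_F\le h_T$ for every element $T$ having $F$ as a face, with $\varrho$ as below). For $T\in\mathcal T_h$, $\mathcal F_T=\{F\in\mathcal F_h: F\subset\partial T\}$. The mesh sequence $(\mathcal T_h)_{h\in\mathcal H}$ is admissible (with parameter $\varrho>0$) if for all $h\in\mathcal H$ there is a matching simplicial submesh $\mathfrak T_h$ of $\mathcal T_h$ (a conforming simplicial mesh of $\Omega$, each simplex being contained in one element of $\mathcal T_h$, each simplicial face being contained in at most one $F\in\mathcal F_h$, and each $F\in\mathcal F_h$ being a union of simplicial faces) such that (i) every $S\in\mathfrak T_h$ with diameter $h_S$ and inradius $r_S$ satisfies $\varrho h_S\le r_S$, and (ii) for all $T\in\mathcal T_h$ and $S\in\mathfrak T_h$ with $S\subset T$, $\varrho h_T\le h_S$ (with $\varrho$ independent of $h$). **Discrete spaces and norm.** For $X$ an element or a face, $\mathbb P^k(X)$ is the space of polynomials on $X$ of total degree $\le k$ (in $d$ variables for elements; in $d-1$ variables, on the hyperplane containing $X$, for faces). $\underline U_h^k=\prod_{T\in\mathcal T_h}\mathbb P^k(T)\times\prod_{F\in\mathcal F_h}\mathbb P^k(F)$, with elements $\underline v_h=((v_T)_{T},(v_F)_{F})$; $v_h$ is the piecewise polynomial function on $\Omega$ with $v_h|_T=v_T$ for all $T\in\mathcal T_h$.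 $\underline U_{h,0}^k=\{\underline v_h\in\underline U_h^k: v_F=0\ \forall F\in\mathcal F_h^{\rm b}\}$. The discrete $W^{1,p}$-norm is $$\|\underline v_h\|_{1,p,h}=\Big(\sum_{T\in\mathcal T_h}\Big[\|\nabla v_T\|_{L^p(T)^d}^p+\sum_{F\in\mathcal F_T}h_F^{1-p}\|v_F-v_T\|_{L^p(F)}^p\Big]\Big)^{\frac1p}.$$ *)

(* Defs.v *)
From HB Require Import structures.
From mathcomp Require Import all_boot all_order all_algebra.
From mathcomp Require Import all_classical all_reals all_analysis.
(* The notations of mpoly clash with those of all_analysis. *)
From mathcomp.multinomials Require mpoly.
Import (canonicals, coercions) mpoly.
Set Implicit Arguments.
Unset Strict Implicit.
Unset Printing Implicit Defensive.
Import Order.TTheory GRing.Theory Num.Theory.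
Import numFieldNormedType.Exports.
Local Open Scope classical_set_scope.
Local Open Scope ring_scope.

(* R^n, realised as 'rV[R]_n, carries the sigma-algebra generated by the
   coordinate functions; it is the Borel sigma-algebra. *)
Definition rV_coord (R : realType) (n : nat) (i : 'I_n) (x : 'rV[R]_n) : R :=
  x ord0 i.

Definition rV_display : measure_display.
Proof. exact: default_measure_display. Qed.

Section rV_measurable.
Context (R : realType) (n : nat).

Let rV_set0 : g_sigma_preimage (@rV_coord R n) set0.
Proof. exact: sigma_algebra0. Qed.

Let rV_setC A :
  g_sigma_preimage (@rV_coord R n) A -> g_sigma_preimage (@rV_coord R n) (~` A).
Proof. exact: sigma_algebraC. Qed.

Let rV_bigcup (F : (set 'rV[R]_n)^nat) :
  (forall i, g_sigma_preimage (@rV_coord R n) (F i)) ->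
  g_sigma_preimage (@rV_coord R n) (\bigcup_i F i).
Proof. exact: sigma_algebra_bigcup. Qed.

HB.instance Definition _ := @isMeasurable.Build rV_display 'rV[R]_n
  (g_sigma_preimage (@rV_coord R n)) rV_set0 rV_setC rV_bigcup.

End rV_measurable.

Definition rV_cons (R : realType) (n : nat) (u : R * 'rV[R]_n) : 'rV[R]_n.+1 :=
  row_mx (u.1)%:M u.2.

Lemma rV_cons0 (R : realType) (n : nat) (u : R * 'rV[R]_n) :
  rV_cons u ord0 ord0 = u.1.
Proof.
have -> : ord0 = lshift n (ord0 : 'I_1) by exact: val_inj.
by rewrite /rV_cons (row_mxEl u.1%:M) mxE eqxx.
Qed.

Lemma rV_consS (R : realType) (n : nat) (u : R * 'rV[R]_n) (i : 'I_n) :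
  rV_cons u ord0 (lift ord0 i) = u.2 ord0 i.
Proof.
have -> : lift ord0 i = rshift 1 i by exact: val_inj.
by rewrite /rV_cons (row_mxEr u.1%:M).
Qed.

Lemma measurable_rVP (R : realType) (n : nat) d (T : measurableType d)
    (f : T -> 'rV[R]_n) :
  (forall i, measurable_fun setT (fun x => f x ord0 i)) ->
  measurable_fun setT f.
Proof.
move=> mf _ A mA; rewrite setTI.
have : preimage_set_system setT f (g_sigma_preimage (@rV_coord R n)) (f @^-1` A).
  by exists A => //; rewrite setTI.
rewrite -g_sigma_preimage_comp; apply: smallest_sub.
  exact: sigma_algebra_measurable.
case: n => [|n] in f mf A mA *; first by rewrite big_ord0.
rewrite -bigcup_mkord_ord; apply: bigcup_sub => i Ii.
by move=> B [C mC <-]; exact: mf.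
Qed.

Lemma measurable_rV_coord (R : realType) (n : nat) (i : 'I_n) :
  measurable_fun setT (fun x : 'rV[R]_n => x ord0 i).
Proof.
move=> _ Y mY; rewrite setTI; apply: sub_sigma_algebra => /=.
rewrite -bigcup_seq/=; exists i => /=; first by rewrite mem_index_enum.
by exists Y => //; rewrite setTI.
Qed.

Lemma measurable_rV_cons (R : realType) (n : nat) :
  measurable_fun setT (@rV_cons R n).
Proof.
apply: measurable_rVP => i; have [j ->|->] := unliftP ord0 i.
  under eq_fun do rewrite rV_consS.
  exact: (measurableT_comp (measurable_rV_coord j) measurable_snd).
under eq_fun do rewrite rV_cons0.
exact: measurable_fst.
Qed.

Section lebesgue_rV_succ.
Context (R : realType) (n : nat).
Variable m : {sigma_finite_measure set 'rV[R]_n -> \bar R}.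

Definition lebesgue_rV_succ : set 'rV[R]_n.+1 -> \bar R :=
  pushforward (@lebesgue_measure R \x m)%E (@rV_cons R n).

Let mu0 : lebesgue_rV_succ set0 = 0%E.
Proof. by rewrite /lebesgue_rV_succ /pushforward preimage_set0 measure0. Qed.

Let mu_ge0 A : (0 <= lebesgue_rV_succ A)%E.
Proof. by rewrite /lebesgue_rV_succ /pushforward; exact: measure_ge0. Qed.

Let mu_sigma_additive : semi_sigma_additive lebesgue_rV_succ.
Proof.
move=> F mF tF mUF; rewrite /lebesgue_rV_succ /pushforward preimage_bigcup.
apply: measure_semi_sigma_additive.
- by move=> i; rewrite -[X in measurable X]setTI; exact: measurable_rV_cons.
- apply/trivIsetP => /= i j _ _ ij; rewrite -preimage_setI.
  by move/trivIsetP : tF => /(_ _ _ _ _ ij) ->//; rewrite preimage_set0.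
- by rewrite -preimage_bigcup -[X in measurable X]setTI; exact: measurable_rV_cons.
Qed.

HB.instance Definition _ := isMeasure.Build _ _ _ lebesgue_rV_succ
  mu0 mu_ge0 mu_sigma_additive.

Let mu_sigma_finite : sigma_finite setT lebesgue_rV_succ.
Proof.
pose uncons (x : 'rV[R]_n.+1) : R * 'rV[R]_n :=
  (x ord0 ord0, \row_j x ord0 (lift ord0 j)).
have consK : cancel (@rV_cons R n) uncons.
  move=> u; rewrite /uncons rV_cons0 [RHS]surjective_pairing; congr (_, _).
  by apply/rowP => j; rewrite mxE rV_consS.
have munc : measurable_fun setT uncons.
  apply/measurable_fun_pairP; split; first exact: measurable_rV_coord.
  apply: measurable_rVP => j /=.
  under eq_fun do rewrite mxE.
  exact: measurable_rV_coord.
have /sigma_finiteP[F [TF ndF Foo]] := sigma_finiteT (@lebesgue_measure R).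
have /sigma_finiteP[G [TG ndG Goo]] := sigma_finiteT m.
pose FG k := F k `*` G k.
have FGT : setT = \bigcup_k FG k.
  apply/esym/seteqP; split=> // -[x y] _.
  have : setT x by []. have : setT y by [].
  rewrite TF TG => -[k _ Gky] [l _ Flx].
  exists (maxn l k) => //; split.
  - by move: x Flx; exact/subsetPset/ndF/leq_maxl.
  - by move: y Gky; exact/subsetPset/ndG/leq_maxr.
exists (fun k => uncons @^-1` FG k).
  by rewrite -preimage_bigcup -FGT preimage_setT.
move=> k; have [? ?] := Foo k; have [? ?] := Goo k; split.
  by rewrite -[X in measurable X]setTI; apply: munc => //; exact: measurableX.
rewrite /lebesgue_rV_succ /pushforward.
rewrite (_ : _ @^-1` _ = FG k); last first.
  by apply/seteqP; split => z /=; rewrite consK.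
by rewrite product_measure1E// lte_mul_pinfty// ge0_fin_numE.
Qed.

HB.instance Definition _ := @Measure_isSigmaFinite.Build _ _ _
  lebesgue_rV_succ mu_sigma_finite.

End lebesgue_rV_succ.

Fixpoint lebesgue_rV (R : realType) (n : nat) :
    {sigma_finite_measure set 'rV[R]_n -> \bar R} :=
  match n with
  | 0%N => [the {sigma_finite_measure set 'rV[R]_0 -> \bar R} of
             @dirac _ 'rV[R]_0 0 R]
  | k.+1 => [the {sigma_finite_measure set 'rV[R]_k.+1 -> \bar R} of
               lebesgue_rV_succ (lebesgue_rV R k)]
  end.

Lemma lebesgue_rV_box (R : realType) (n : nat) (A : 'I_n -> set R) :
  (forall i, measurable (A i)) ->
  lebesgue_rV R n [set x | forall i, A i (x ord0 i)] =
  (\prod_(i < n) lebesgue_measure (A i))%E.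
Proof.
elim: n A => [|n IHn] A mA.
  by rewrite big_ord0 /= diracE mem_set// => -[].
have consA : @rV_cons R n @^-1` [set x | forall i, A i (x ord0 i)] =
    A ord0 `*` [set y : 'rV[R]_n | forall i, A (lift ord0 i) (y ord0 i)].
  apply/seteqP; split=> z /=.
    move=> Az; split; first by have := Az ord0; rewrite rV_cons0.
    by move=> i; have := Az (lift ord0 i); rewrite rV_consS.
  move=> [A0 AS] i; have [j ->|->] := unliftP ord0 i.
    by rewrite rV_consS; exact: AS.
  by rewrite rV_cons0.
rewrite big_ord_recl -IHn//= /lebesgue_rV_succ /pushforward consA.
apply: product_measure1E; first exact: mA.
rewrite [X in measurable X](_ : _ = \bigcap_(i in [set: 'I_n])
  ((fun y : 'rV[R]_n => y ord0 i) @^-1` A (lift ord0 i))); last first.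
  by apply/seteqP; split=> y /= Ay i; [move=> _|]; exact: Ay.
apply: fin_bigcap_measurable => // i _.
by rewrite -[X in measurable X]setTI; exact: measurable_rV_coord.
Qed.

Section geometry.
Context {R : realType}.

Definition dot (n : nat) (x y : 'rV[R]_n) : R := \sum_i x ord0 i * y ord0 i.

(* The library norm on 'rV[R]_n is the sup norm (same topology). *)
Definition enorm (n : nat) (x : 'rV[R]_n) : R := Num.sqrt (dot x x).

(* Only meaningful for bounded sets, for which the supremum is finite. *)
Definition diam (n : nat) (A : set 'rV[R]_n) : R :=
  sup [set enorm (x.1 - x.2) | x in A `*` A].

Definition inradius (n : nat) (A : set 'rV[R]_n) : R :=
  sup [set r : R | 0 <= r /\
    exists x, [set y | enorm (y - x) < r] `<=` A].

Definition bdry (n : nat) (A : set 'rV[R]_n) : set 'rV[R]_n :=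
  closure A `\` interior A.

Definition hyperplane (n : nat) (H : set 'rV[R]_n) : Prop :=
  exists (nu : 'rV[R]_n) (c : R), nu != 0 /\ H = [set x | dot nu x = c].

(* An open set A lies locally on only one side of its boundary when no boundary
   point is interior to the closure of A (no cracks). *)
Definition one_sided (n : nat) (A : set 'rV[R]_n) : Prop :=
  forall x, bdry A x -> ~ nbhs x (closure A).

Definition polyhedral (n : nat) (A : set 'rV[R]_n) : Prop :=
  [/\ open A, connected A, bounded_set A,
      (exists Hs : set (set 'rV[R]_n),
         [/\ finite_set Hs, forall H, Hs H -> hyperplane H &
             bdry A `<=` \bigcup_(H in Hs) H])
    & one_sided A].

(* [s]-dimensional Hausdorff outer measure for integer [s], without the
   normalising constant. The empty set contributes 0 also when s = 0, so that
   s = 0 is the counting measure. *)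
Definition hausdorff_gauge (n s : nat) (U : set 'rV[R]_n) : \bar R :=
  if U == set0 then 0%E else (diam U ^+ s)%:E.

Definition hausdorff_pre (n s : nat) (delta : R) (A : set 'rV[R]_n) : \bar R :=
  ereal_inf [set (\sum_(0 <= i <oo) hausdorff_gauge s (U i))%E |
    U in [set U : nat -> set 'rV[R]_n |
      A `<=` \bigcup_i U i /\
      forall i x y, U i x -> U i y -> enorm (x - y) <= delta]].

Definition hausdorff (n s : nat) (A : set 'rV[R]_n) : \bar R :=
  ereal_sup [set hausdorff_pre s delta A | delta in [set delta | 0 < delta]].

End geometry.

Section simplices.
Context {R : realType} {d : nat}.
Implicit Types (a : 'I_d.+1 -> 'rV[R]_d) (S : set 'rV[R]_d).

(* Convex hull of the points [a j], [j] in [J]; empty if [J] is. *)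
Definition hull a (J : {set 'I_d.+1}) : set 'rV[R]_d :=
  [set x | exists w : 'I_d.+1 -> R,
    [/\ forall j, 0 <= w j, \sum_(j in J) w j = 1
       & x = \sum_(j in J) w j *: a j]].

(* Nondegenerate open simplex with vertices [a]. *)
Definition is_simplex a S : Prop :=
  row_free (\matrix_(i < d) (a (lift ord0 i) - a ord0)) /\
  S = interior (hull a [set: 'I_d.+1]).

Definition simplex_face S (sigma : set 'rV[R]_d) : Prop :=
  exists a i, is_simplex a S /\ sigma = hull a [set~ i].

(* Two distinct closed simplices of a conforming mesh meet along a common
   (possibly empty) subsimplex. *)
Definition conforming (Ss : set (set 'rV[R]_d)) : Prop :=
  forall S1 S2 a1 a2, Ss S1 -> Ss S2 -> S1 <> S2 ->
    is_simplex a1 S1 -> is_simplex a2 S2 ->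
    exists J1 J2, closure S1 `&` closure S2 = hull a1 J1 /\
                  hull a1 J1 = hull a2 J2.

Definition simplicial_mesh (Omega : set 'rV[R]_d) (Ss : set (set 'rV[R]_d)) :
    Prop :=
  [/\ finite_set Ss, forall S, Ss S -> exists a, is_simplex a S,
      trivIset Ss id, closure Omega = \bigcup_(S in Ss) closure S
    & conforming Ss].

End simplices.

(* [chart_origin F] and the orthonormal rows of [chart_frame F] define
   Cartesian coordinates on the hyperplane containing the face [F]. The field
   [face_size] is h_F; [face_size_ok] below ties it to the geometry. *)
Record mesh (R : realType) (d : nat) := Mesh {
  elements : set (set 'rV[R]_d);
  faces : set (set 'rV[R]_d);
  chart_origin : set 'rV[R]_d -> 'rV[R]_d;
  chart_frame : set 'rV[R]_d -> 'M[R]_(d.-1, d);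
  face_size : set 'rV[R]_d -> R }.

Section meshes.
Context {R : realType} {d : nat}.
Implicit Types (Omega F T : set 'rV[R]_d) (M : mesh R d) (rho h : R).

Definition chart M F (y : 'rV[R]_d.-1) : 'rV[R]_d :=
  chart_origin M F + y *m chart_frame M F.

Definition relint M F : set 'rV[R]_d :=
  chart M F @` interior (chart M F @^-1` F).

Definition interface M F : Prop :=
  exists T1 T2, [/\ elements M T1, elements M T2, T1 <> T2 &
    F `<=` bdry T1 `&` bdry T2].

Definition boundary_face Omega M F : Prop :=
  exists2 T, elements M T & F `<=` bdry T `&` bdry Omega.

Definition faces_of M T : set (set 'rV[R]_d) :=
  [set F | faces M F /\ F `<=` bdry T].

Definition is_face Omega M F : Prop :=
  [/\ hyperplane (range (chart M F)) /\ F `<=` range (chart M F),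
      closed F /\ connected F, F `<=` closure Omega, (0 < hausdorff d.-1 F)%E
    & interface M F \/ boundary_face Omega M F].

Definition is_mesh Omega h M : Prop :=
  [/\ [/\ finite_set (elements M),
          forall T, elements M T -> T !=set0 /\ polyhedral T
        & trivIset (elements M) id],
      closure Omega = \bigcup_(T in elements M) closure T,
      (exists2 T, elements M T & diam T = h) /\
        (forall T, elements M T -> diam T <= h),
      [/\ finite_set (faces M), forall F, faces M F -> is_face Omega M F,
          forall F, faces M F ->
            chart_frame M F *m (chart_frame M F)^T = 1%:M
        & trivIset (faces M) (relint M)]
    & forall T, elements M T -> bdry T = \bigcup_(F in faces_of M T) F].

Definition face_size_ok rho M : Prop :=
  forall F, faces M F ->
    if d == 1%N then
      0 < face_size M F /\
      forall T, elements M T -> faces_of M T F ->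
        rho ^+ 2 * diam T <= face_size M F <= diam T
    else face_size M F = diam F.

Definition simplicial_submesh Omega M (Ss : set (set 'rV[R]_d)) : Prop :=
  let Sfaces := \bigcup_(S in Ss) simplex_face S in
  [/\ simplicial_mesh Omega Ss,
      forall S, Ss S -> exists T, [/\ elements M T, S `<=` T &
        forall T', elements M T' -> S `<=` T' -> T' = T],
      forall sigma, Sfaces sigma -> forall F1 F2, faces M F1 -> faces M F2 ->
        sigma `<=` F1 -> sigma `<=` F2 -> F1 = F2
    & forall F, faces M F ->
        exists2 E, E `<=` Sfaces & F = \bigcup_(sigma in E) sigma].

Definition regular_submesh rho M (Ss : set (set 'rV[R]_d)) : Prop :=
  (forall S, Ss S -> rho * diam S <= inradius S) /\
  (forall T S, elements M T -> Ss S -> S `<=` T -> rho * diam T <= diam S).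

(* The mesh sequence is [Ms h], [h] in [Hs]. *)
Definition admissible Omega rho (Hs : set R) (Ms : R -> mesh R d) : Prop :=
  forall h, Hs h ->
    [/\ is_mesh Omega h (Ms h), face_size_ok rho (Ms h)
      & exists2 Ss, simplicial_submesh Omega (Ms h) Ss &
                    regular_submesh rho (Ms h) Ss].

End meshes.

Definition mesh_sizes (R : realType) (Hs : set R) : Prop :=
  [/\ forall h, Hs h -> 0 < h, countable Hs & limit_point Hs = [set 0]].

Definition degree_le (R : realType) (n k : nat) (v : mpoly.mpoly n R) : Prop :=
  (mpoly.mmeasure mpoly.mdeg v <= k.+1)%N.

Definition peval (R : realType) (n : nat) (v : mpoly.mpoly n R)
  (x : 'rV[R]_n) : R := mpoly.meval (x ord0) v.

Definition grad_norm (R : realType) (n : nat) (v : mpoly.mpoly n R)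
  (x : 'rV[R]_n) : R := enorm (\row_i peval (mpoly.mderiv i v) x).

Definition Lpnorm (R : realType) (n : nat) (p : R) (A : set 'rV[R]_n)
    (f : 'rV[R]_n -> R) : \bar R :=
  'N[lebesgue_rV R n]_p%:E [EFin \o (f \_ A)].

(* Face unknowns are polynomials in the d - 1 coordinates of the chart of the
   face. Unknowns indexed by sets outside the mesh are irrelevant. *)
Record dofs (R : realType) (d : nat) := Dofs {
  vT : set 'rV[R]_d -> mpoly.mpoly d R;
  vF : set 'rV[R]_d -> mpoly.mpoly d.-1 R }.

Section discrete.
Context {R : realType} {d : nat}.
Implicit Types (Omega : set 'rV[R]_d) (M : mesh R d) (p : R) (v : dofs R d).

Definition Uh M (k : nat) : set (dofs R d) :=
  [set v | (forall T, elements M T -> degree_le k (vT v T)) /\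
           (forall F, faces M F -> degree_le k (vF v F))].

Definition Uh0 Omega M (k : nat) : set (dofs R d) :=
  [set v | Uh M k v /\
    forall F, faces M F -> boundary_face Omega M F -> vF v F = 0].

(* Set to 0 on the mesh skeleton, which is Lebesgue-negligible. *)
Definition vh M v (x : 'rV[R]_d) : R :=
  \sum_(T \in elements M) (peval (vT v T) \_ T) x.

(* L^p(F) refers to the (d-1)-dimensional Lebesgue measure of the hyperplane
   containing F, computed in the isometric coordinates of the chart. *)
Definition face_Lpnorm M p F (f : 'rV[R]_d.-1 -> R) : \bar R :=
  Lpnorm p (chart M F @^-1` F) f.

Definition jump M v T F (y : 'rV[R]_d.-1) : R :=
  peval (vF v F) y - peval (vT v T) (chart M F y).

Definition norm_1ph M p v : \bar R :=
  ((\sum_(T \in elements M)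
     (Lpnorm p T (grad_norm (vT v T)) `^ p +
      \sum_(F \in faces_of M T)
        ((face_size M F `^ (1 - p))%R)%:E *
          face_Lpnorm M p F (jump M v T F) `^ p)) `^ p^-1)%E.

End discrete.

Definition sobolev_exponent (R : realType) (d : nat) (p : R) : R :=
  d%:R * p / (d%:R - p).

(* Main.v *)
(* Let u = v_h and a >= 1. Along almost every line parallel to a coordinate axis,
   no two distinct hyperplanes spanned by simplicial facets or faces are met at
   the same point, so the line crosses the skeleton at relative interior points
   of faces; following |u|^(a-1) u along it bounds |u|^a by the integral of
   a |u|^(a-1) |grad u| plus the jumps at the crossings. Loomis-Whitney turns
   these bounds into an estimate of the L^(as) norm of u, s = d/(d-1), by the
   total variation (for d = 1 any s will do).

   With m = as >= q, Young's inequality bounds the variation by an energy term,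
   C ||v_h||_{1,p,h}^p, plus eps times the integrals of Psi(u) = 1 + |u|^m over
   the elements and of h_F Psi(v_T) over the faces. The latter are controlled by
   the former: on the cone joining a piece of a face to the opposite vertex of a
   simplex, the value of a polynomial on the face is extrapolated from
   equispaced points of the ray through it. Scaling v_h so that |u|^m has
   integral 1 and taking eps small, the energy is bounded below. *)

(* The obstacle is that elements are arbitrary polytopes, with no reference element from which
   inequalities could be transported. All geometry is reduced to signs of finitely many affine forms
   (barycentric forms of the simplices, equations of the faces): off their zero sets the signs
   decide which element contains a point, and at a point on only one of these hyperplanes they
   decide which face is crossed. Since boundary unknowns vanish, [v_h] is extended by zero and
   leaving the domain counts as a jump to zero.

   Young's inequality dictates [a]: it turns [|u|^(a-1)] into [|u|^((a-1)p/(p-1))], which [Psi]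
   controls as long as [(a-1)p/(p-1) <= as]; for [1 < p < d] equality means [as = p*]. The summand 1
   of [Psi] covers smaller exponents at the price of the measure [V] of a box. On a face the weight
   [h_F] produces both the factor [h_F^(1-p)] of the norm and the factor [h_F] of the trace
   inequality. The resulting bound [I <= (1 + V)(eps C3 (V + I) + C4 energy)^s] for the integral [I]
   of [|u|^m] may have [s > 1], so the [eps] term cannot simply be moved to the left: hence the
   normalisation. *)
Require Import Defs.
From HB Require Import structures.
From mathcomp Require Import all_boot all_order all_algebra perm.
From mathcomp Require Import all_classical all_reals all_analysis measurable_realfun.
From mathcomp.multinomials Require mpoly.
Import (canonicals, coercions) mpoly.
From mathcomp Require Import ring lra.
Set Implicit Arguments.
Unset Strict Implicit.
Unset Printing Implicit Defensive.
Import Order.TTheory GRing.Theory Num.Theory.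
Import numFieldNormedType.Exports.
Local Open Scope classical_set_scope.
Local Open Scope ring_scope.
Local Open Scope ereal_scope.

(** * Integration on row vectors *)

Section rV_integral.
Context {R : realType}.

Lemma measurable_rV_consP (n : nat) d (T : measurableType d)
    (f : T -> R) (g : T -> 'rV[R]_n) :
  measurable_fun setT f -> measurable_fun setT g ->
  measurable_fun setT (fun x => rV_cons (f x, g x)).
Proof.
move=> mf mg; apply: (measurableT_comp (@measurable_rV_cons R n)).
exact: measurable_fun_pair.
Qed.

Let RT := measurableTypeR R.

Let measurable_rV_consR (n : nat) :
  measurable_fun [set: (RT * 'rV[R]_n)%type] (@rV_cons R n).
Proof. exact: (@measurable_rV_cons R n). Qed.

Let measurable_rV_cons_comp (n : nat) (f : 'rV[R]_n.+1 -> \bar R) :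
  measurable_fun setT f ->
  measurable_fun [set: (RT * 'rV[R]_n)%type] (f \o @rV_cons R n).
Proof. by move=> mf; apply: measurableT_comp => //; exact: measurable_rV_consR. Qed.

Let integral_rV_prod (n : nat) (f : 'rV[R]_n.+1 -> \bar R) :
  measurable_fun setT f -> (forall x, 0 <= f x) ->
  \int[lebesgue_rV R n.+1]_x f x =
  \int[(@lebesgue_measure R \x lebesgue_rV R n)]_z (f \o @rV_cons R n) z.
Proof.
move=> mf f0; rewrite /= /lebesgue_rV_succ.
by rewrite (ge0_integral_pushforward (@measurable_rV_consR n)).
Qed.

(** Both orders of integration are needed: a map moving the last coordinates by an amount depending
    on the first is treated with the first coordinate outermost, as here, and the opposite shear
    with it innermost, as in [integral_rV2]. *)
Lemma integral_rV1 (n : nat) (f : 'rV[R]_n.+1 -> \bar R) :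
  measurable_fun setT f -> (forall x, 0 <= f x) ->
  \int[lebesgue_rV R n.+1]_x f x =
  \int[@lebesgue_measure R]_t \int[lebesgue_rV R n]_y f (rV_cons (t, y)).
Proof.
move=> mf f0; rewrite integral_rV_prod// fubini_tonelli1//.
- exact: measurable_rV_cons_comp.
- by move=> z; exact: f0.
Qed.

Lemma integral_rV2 (n : nat) (f : 'rV[R]_n.+1 -> \bar R) :
  measurable_fun setT f -> (forall x, 0 <= f x) ->
  \int[lebesgue_rV R n.+1]_x f x =
  \int[lebesgue_rV R n]_y \int[@lebesgue_measure R]_t f (rV_cons (t, y)).
Proof.
move=> mf f0; rewrite integral_rV_prod// fubini_tonelli2//.
- exact: measurable_rV_cons_comp.
- by move=> z; exact: f0.
Qed.

Lemma measurable_integral_rV1 (n : nat) (f : 'rV[R]_n.+1 -> \bar R) :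
  measurable_fun setT f -> (forall x, 0 <= f x) ->
  measurable_fun [set: R] (fun t => \int[lebesgue_rV R n]_y f (rV_cons (t, y))).
Proof.
move=> mf f0; apply: (measurable_fun_fubini_tonelli_F (f \o @rV_cons R n)).
- exact: measurable_rV_cons_comp.
- by move=> z; exact: f0.
Qed.

Lemma measurable_integral_rV2 (n : nat) (f : 'rV[R]_n.+1 -> \bar R) :
  measurable_fun setT f -> (forall x, 0 <= f x) ->
  measurable_fun setT (fun y => \int[@lebesgue_measure R]_t f (rV_cons (t, y))).
Proof.
move=> mf f0; apply: (measurable_fun_fubini_tonelli_G (m1 := @lebesgue_measure R) (f \o @rV_cons R n)).
- exact: measurable_rV_cons_comp.
- by move=> z; exact: f0.
Qed.

Lemma rV_consE (n : nat) (t : R) (y : 'rV[R]_n) :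
  rV_cons (t, y) = row_mx t%:M y :> 'rV[R]_(1 + n).
Proof. by []. Qed.

Lemma mul_rV_cons_block (n : nat) (t : R) (y : 'rV[R]_n) (a : 'M[R]_1)
    (r : 'rV[R]_n) (c : 'cV[R]_n) (A : 'M[R]_n) :
  rV_cons (t, y) *m (block_mx a r c A : 'M[R]_(1 + n)) =
  row_mx (t%:M *m a + y *m c)%R (t%:M *m r + y *m A)%R.
Proof. by rewrite rV_consE (mul_row_block t%:M y a r c A). Qed.

Lemma measurable_mulmx (m n : nat) (A : 'M[R]_(m, n)) (b : 'rV[R]_n) :
  measurable_fun setT (fun x : 'rV[R]_m => x *m A + b)%R.
Proof.
apply: measurable_rVP => i.
under eq_fun do rewrite !mxE.
apply: measurable_funD => //; apply: measurable_sum => j.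
apply: measurable_funM => //; exact: measurable_rV_coord.
Qed.

End rV_integral.

(** * Affine change of variables for Lebesgue measure *)

Section change_of_variables.
Context {R : realType}.

Definition affine_pushforward (h : R -> measurableTypeR R)
    (mh : measurable_fun [set: measurableTypeR R] h) :
  {measure set (measurableTypeR R) -> \bar R} :=
  measure_function_pushforward__canonical__measure_function_Measure
    (@lebesgue_measure R) mh.

(** [|a|] times the image measure is a measure, so by uniqueness of Lebesgue measure only intervals
    []x, y]] need checking. For [a < 0] the preimage is reversed, hence closed on the left instead
    of the right. *)
Lemma lebesgue_measure_affine (a b : R) (A : set R) : (a != 0)%R ->
  measurable A ->
  lebesgue_measure A = (`|a|%:E * lebesgue_measure ((fun x => a * x + b)%R @^-1` A)).
Proof.
move=> a0 mA.
have mh : measurable_fun [set: measurableTypeR R]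
    ((fun x : R => a * x + b)%R : R -> measurableTypeR R).
  rewrite -[measurable_fun _ _]/(measurable_fun [set: R] (fun x : R => a * x + b)%R).
  by apply: measurable_funD => //; exact: measurable_funM.
have -> : `|a|%:E * lebesgue_measure ((fun x => (a * x + b)%R) @^-1` A) =
    (mscale (NngNum (normr_ge0 a)) (affine_pushforward mh)) A.
  by rewrite /mscale /= /pushforward.
apply: (@lebesgue_measure_unique R (mscale (NngNum (normr_ge0 a)) (affine_pushforward mh))) => //.
move=> X [[x y]] /= xy <-; rewrite /mscale /= /pushforward /=.
have [ap|an] : (0 < a \/ a < 0)%R.
  by case: (ltgtP a 0%R) a0 => //; [right|left].
- have -> : (fun x => a * x + b)%R @^-1` `]x, y] = [set` `](x - b) / a, (y - b) / a]%R].
    apply/seteqP; split => t /=; rewrite !in_itv/= ltr_pdivrMr// ler_pdivlMr//;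
    by rewrite ltrBlDr lerBrDr mulrC.
  rewrite !lebesgue_measure_itv/= !lte_fin ltr_pM2r ?invr_gt0// ltrBlDr subrK.
  case: ifP => // xy'; last by rewrite mule0.
  rewrite gtr0_norm// -!EFinB -EFinM; congr EFin; field; exact: lt0r_neq0.
- have -> : (fun x => a * x + b)%R @^-1` `]x, y] = [set` `[(y - b) / a, (x - b) / a[%R].
    apply/seteqP; split => t /=; rewrite !in_itv/= ler_ndivrMr// ltr_ndivlMr//;
    by rewrite ltrBlDr lerBrDr mulrC andbC.
  rewrite !lebesgue_measure_itv/= !lte_fin ltr_nM2r ?invr_lt0// ltrBlDr subrK.
  case: ifP => // xy'; last by rewrite mule0.
  rewrite ltr0_norm// -!EFinB -EFinM; congr EFin; field; exact: ltr0_neq0.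
Qed.

Lemma integral_affine (a b : R) (f : R -> \bar R) : (a != 0)%R ->
  measurable_fun setT f -> (forall x, 0 <= f x) ->
  `|a|%:E * \int[@lebesgue_measure R]_t f (a * t + b)%R =
  \int[@lebesgue_measure R]_t f t.
Proof.
move=> a0 mf f0.
have mh : measurable_fun [set: measurableTypeR R]
    ((fun x : R => a * x + b)%R : R -> measurableTypeR R).
  rewrite -[measurable_fun _ _]/(measurable_fun [set: R] (fun x : R => a * x + b)%R).
  by apply: measurable_funD => //; exact: measurable_funM.
rewrite [RHS](@eq_measure_integral _ _ _ _
   (mscale (NngNum (normr_ge0 a)) (affine_pushforward mh)) (@lebesgue_measure R)); last first.
  move=> A mA _; rewrite /mscale /= /pushforward /=.
  exact: lebesgue_measure_affine.
rewrite ge0_integral_mscale//=.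
by rewrite (ge0_integral_pushforward mh).
Qed.

(** The change of variables formula as a property of [A], so that it can be passed through products
    of matrices. The translation [b] is quantified inside because the block steps use translations
    depending on an outer variable. *)
Definition scales_by_det (n : nat) (A : 'M[R]_n) := forall (b : 'rV[R]_n) (f : 'rV[R]_n -> \bar R),
  measurable_fun setT f -> (forall x, 0 <= f x) ->
  `|\det A|%:E * \int[lebesgue_rV R n]_x f (x *m A + b)%R =
  \int[lebesgue_rV R n]_x f x.

Lemma measurable_aff (n m : nat) (A : 'M[R]_(n, m)) (b : 'rV[R]_m) (f : 'rV[R]_m -> \bar R) :
  measurable_fun setT f -> measurable_fun setT (fun x : 'rV[R]_n => f (x *m A + b)%R).
Proof. by move=> mf; apply: (measurableT_comp mf); exact: measurable_mulmx. Qed.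

Lemma scales_by_det_mul (n : nat) (A B : 'M[R]_n) : scales_by_det A -> scales_by_det B -> scales_by_det (A *m B).
Proof.
move=> rA rB b f mf f0; rewrite det_mulmx normrM mulrC EFinM -muleA.
under eq_integral do rewrite mulmxA.
have := rA 0%R (fun y => f (y *m B + b)%R) (measurable_aff B b mf) (fun y => f0 _).
rewrite -(rB b f mf f0) => <-; congr (_ * (_ * _))%E.
by apply: eq_integral => x _; rewrite addr0.
Qed.

(** For a fixed first coordinate [t] the other coordinates undergo [y -> y A + t r + b'], which the
    property of [A] handles under the outer integral; what remains is a one-dimensional affine
    substitution in [t]. *)
Lemma scales_by_det_ublock (n : nat) (a : R) (r : 'rV[R]_n) (A : 'M[R]_n) : (a != 0)%R ->
  scales_by_det A -> scales_by_det (block_mx a%:M r 0%R A : 'M[R]_(1 + n)).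
Proof.
move=> a0 rA b f mf f0.
rewrite integral_rV1; [|exact: measurable_aff|by move=> x; exact: f0].
rewrite det_ublock det_scalar1 normrM EFinM -muleA.
rewrite -ge0_integralZl_EFin//=; last 2 first.
  by move=> t _; apply: integral_ge0 => y _; exact: f0.
  apply: (measurable_integral_rV1 (f := fun x => f (x *m _ + b)%R)) => //.
  exact: measurable_aff.
have E (t : R) : `|\det A|%:E * \int[lebesgue_rV R n]_y
      f (rV_cons (t, y) *m block_mx a%:M r 0%R A + b)%R =
    \int[lebesgue_rV R n]_y f (rV_cons (a * t + b ord0 ord0, y)%R).
  pose g y := f (rV_cons (a * t + b ord0 ord0, y)%R).
  have mg : measurable_fun setT g.
    by apply: (measurableT_comp mf); apply: measurable_rV_consP.
  rewrite -(rA (t *: r + (rsubmx (b : 'rV_(1 + n))))%R g mg (fun y => f0 _)).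
  congr (_ * _); apply: eq_integral => y _; rewrite /g; congr f.
  rewrite mul_rV_cons_block !rV_consE mulmx0 addr0.
  rewrite -[b in LHS]hsubmxK add_row_mx; congr row_mx.
    rewrite -scalar_mxM (mx11_scalar (lsubmx _)) -raddfD/= mulrC !mxE.
    by congr ((_ + b _ _)%:M)%R; exact: val_inj.
  by rewrite mul_scalar_mx addrA [(y *m A + _)%R]addrC.
under eq_integral do rewrite E.
pose g t := \int[lebesgue_rV R n]_y f (rV_cons (t, y)).
have mg : measurable_fun [set: R] g by exact: measurable_integral_rV1.
rewrite (integral_affine _ a0 mg) ?integral_rV1//.
by move=> t; exact: integral_ge0.
Qed.

(** For the identity this is translation invariance, obtained one coordinate at a time. *)
Lemma scales_by_det1 (n : nat) : scales_by_det (1%:M : 'M[R]_n).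
Proof.
elim: n => [|n IHn].
  move=> b f mf f0; rewrite det1 normr1 mul1e; apply: eq_integral => x _.
  by congr f; apply/rowP => -[].
have := @scales_by_det_ublock n 1%R 0%R 1%:M (oner_neq0 _) IHn.
by rewrite -scalar_mx_block.
Qed.

(** The shear translates the first coordinate by an amount depending on the others only, which the
    innermost integral does not see; the other coordinates are merely translated. *)
Lemma scales_by_det_lshear (n : nat) (c : 'cV[R]_n) : scales_by_det (block_mx 1%:M 0%R c 1%:M : 'M[R]_(1 + n)).
Proof.
move=> b f mf f0.
rewrite det_lblock !det1 mulr1 normr1 mul1e.
rewrite integral_rV2; [|exact: measurable_aff|by move=> x; exact: f0].
have E (y : 'rV[R]_n) : \int[lebesgue_measure]_t
      f (rV_cons (t, y) *m block_mx 1%:M 0%R c 1%:M + b)%R =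
    \int[lebesgue_measure]_t f (rV_cons (t, y + rsubmx (b : 'rV_(1 + n))))%R.
  pose g t := f (rV_cons (t, y + rsubmx (b : 'rV_(1 + n)))%R).
  have mg : measurable_fun setT g.
    by apply: (measurableT_comp mf); apply: measurable_rV_consP.
  have := @integral_affine 1%R ((y *m c) ord0 ord0 + b ord0 ord0)%R g
    (oner_neq0 _) mg (fun t => f0 _).
  rewrite normr1 mul1e => <-.
  apply: eq_integral => t _; rewrite /g; congr f.
  rewrite mul_rV_cons_block !rV_consE mulmx0 add0r !mulmx1.
  rewrite -[b in LHS]hsubmxK add_row_mx mul1r; congr row_mx.
  rewrite (mx11_scalar (y *m c)) (mx11_scalar (lsubmx _)) -!raddfD/= !mxE addrA.
  by congr ((_ + b _ _)%:M)%R; exact: val_inj.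
under eq_integral do rewrite E.
pose g y := \int[lebesgue_measure]_t f (rV_cons (t, y)).
have mg : measurable_fun setT g by exact: measurable_integral_rV2.
have := scales_by_det1 (rsubmx (b : 'rV_(1 + n))) mg.
rewrite det1 normr1 mul1e => rg.
under eq_integral => y _ do rewrite -[y in (y + _)%R]mulmx1.
rewrite rg ?integral_rV2// => t; exact: integral_ge0.
Qed.

(** Gauss elimination: a nonzero corner entry [a] splits [A] into a lower shear and an upper block
    matrix with the Schur complement [B], which is invertible because [det A = a det B]. *)
Lemma scales_by_det_pivot (n : nat) (A : 'M[R]_(1 + n)) :
  (forall B : 'M[R]_n, B \in unitmx -> scales_by_det B) ->
  A \in unitmx -> (A (lshift n ord0) (lshift n ord0) != 0)%R -> scales_by_det A.
Proof.
move=> IHn uA a0; set a := A _ _ in a0.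
pose c := (a^-1 *: dlsubmx A)%R; pose r := ursubmx A.
pose B := (drsubmx A - c *m r)%R.
have AE : A = (block_mx 1%:M 0%R c 1%:M : 'M[R]_(1 + n)) *m block_mx a%:M r 0%R B.
  rewrite mulmx_block !mul1mx !mul0mx !addr0 /B -[LHS]submxK.
  congr block_mx.
  - by rewrite [LHS]mx11_scalar !mxE.
  - by rewrite mul_mx_scalar /c scalerA divff// scale1r.
  - by rewrite addrC subrK.
rewrite AE; apply: scales_by_det_mul; first exact: scales_by_det_lshear.
apply: scales_by_det_ublock => //; apply: IHn.
move: uA; rewrite AE unitmx_mul !unitmxE det_lblock det_ublock det_scalar1.
by rewrite !unitfE !mulf_eq0 !negb_or => /andP[_ /andP[]].
Qed.

(* The block elimination avoids row permutations: a zero pivot is first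
   repaired by a shear. *)
Lemma scales_by_det_block (n : nat) (A : 'M[R]_(1 + n)) :
  (forall B : 'M[R]_n, B \in unitmx -> scales_by_det B) -> A \in unitmx -> scales_by_det A.
Proof.
move=> IHn uA.
have [a0|a0] := eqVneq (A (lshift n ord0) (lshift n ord0)) 0%R; last first.
  exact: scales_by_det_pivot.
have [j rj|r0] := pickP (fun j : 'I_n => A (lshift n ord0) (rshift 1 j) != 0)%R; last first.
  (* A first row equal to zero would make the corner entry of [A B = 1] vanish. *)
  move: uA; rewrite -row_free_unit => /row_freeP[B AB].
  have := congr1 (fun M : 'M[R]_(1 + n) => M (lshift n ord0) (lshift n ord0)) AB.
  rewrite !mxE big1 => [|i _].
    by rewrite eqxx => /eqP; rewrite eq_sym oner_eq0.
  rewrite (_ : A _ i = 0%R) ?mul0r//; have := splitP i.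
  case=> k ik; first by rewrite -a0; congr (A _ _); apply: val_inj; rewrite /= ik; case: k {ik} => -[].
  have /negbFE/eqP <- := r0 k; congr (A _ _); exact: val_inj.
(* Multiplying by [E c] adds the column of the nonzero entry to the first column, which puts that
   entry into the corner. *)
pose c : 'cV[R]_n := delta_mx j ord0.
pose E d : 'M[R]_(1 + n) := block_mx 1%:M 0%R d 1%:M.
have EE : E c *m E (- c)%R = 1%:M.
  rewrite /E mulmx_block !mul1mx !mul0mx !mulmx1 !mulmx0 addr0 add0r subrr.
  by rewrite add0r -scalar_mx_block.
rewrite (_ : A = (A *m E c) *m E (- c)%R); last by rewrite -mulmxA EE mulmx1.
apply: scales_by_det_mul; last exact: scales_by_det_lshear.
apply: scales_by_det_pivot => //.
  by rewrite unitmx_mul uA unitmxE /E det_lblock !det1 mulr1 unitr1.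
rewrite -[A]submxK /E.
rewrite mulmx_block block_mxEul.
rewrite mulmx1 !mxE -[X in (X + _)%R]/(A _ _) a0 add0r.
rewrite (bigD1 j)//= big1 ?addr0 => [|k kj].
  by rewrite !mxE !eqxx mulr1.
by rewrite !mxE (negbTE kj) mulr0.
Qed.

Theorem integral_mulmx (n : nat) (A : 'M[R]_n) (b : 'rV[R]_n)
    (f : 'rV[R]_n -> \bar R) : A \in unitmx ->
  measurable_fun setT f -> (forall x, 0 <= f x) ->
  `|\det A|%:E * \int[lebesgue_rV R n]_x f (x *m A + b)%R =
  \int[lebesgue_rV R n]_x f x.
Proof.
move=> uA; move: b f; rewrite -/(scales_by_det A).
elim: n => [|n IHn] in A uA *.
  suff -> : A = 1%:M by exact: scales_by_det1.
  by apply/matrixP => -[].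
exact: (@scales_by_det_block n A IHn uA).
Qed.

End change_of_variables.

(** * The Loomis-Whitney inequality *)

Section loomis_whitney.
Context {R : realType}.

Section hoelder_ereal.
Context d (T : measurableType d) (mu : {measure set T -> \bar R}).
Implicit Types f g : T -> \bar R.

Lemma measurable_fun_poweR f (a : R) : measurable_fun setT f ->
  measurable_fun setT (fun x => f x `^ a).
Proof. by move=> mf; exact: (measurableT_comp (measurable_poweR a)). Qed.

(** A vanishing integral makes [f] vanish almost everywhere and with it the product, even where [g]
    is infinite, since [0 * +oo = 0] here. *)
Lemma integral0_ae0 f g (a b : R) : (0 < a)%R -> measurable_fun setT f ->
  (forall x, 0 <= f x) -> measurable_fun setT g -> (forall x, 0 <= g x) ->
  \int[mu]_x f x = 0 -> \int[mu]_x (f x `^ a * g x `^ b) = 0.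
Proof.
move=> a0 mf f0 mg g0 If.
have : \int[mu]_x `|f x| = 0.
  by rewrite -If; apply: eq_integral => x _; rewrite gee0_abs.
move=> /(ae_eq_integral_abs mu measurableT mf) h.
rewrite (ge0_ae_eq_integral (g := cst 0)) ?integral0//.
- by apply: emeasurable_funM; exact: measurable_fun_poweR.
- by move=> x _; rewrite mule_ge0// poweR_ge0.
apply: filterS h => x /(_ Logic.I) /= -> _.
by rewrite poweR0r ?gt_eqF// mul0e.
Qed.

Lemma le_poweR (x y : \bar R) (a : R) : (0 <= a)%R -> 0 <= x -> x <= y ->
  x `^ a <= y `^ a.
Proof.
move=> a0 x0 xy; apply: gt0_ler_poweR => //;
by rewrite in_itv/= leey ?x0 ?(le_trans x0 xy).
Qed.

(** Scaled so that, when [A] and [B] are the integrals of [f] and [g], the bracket integrates to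
    [a + b = 1] and Hoelder's inequality comes out at once. *)
Lemma young_ereal (x y : \bar R) (a b A B : R) :
  (0 < a)%R -> (0 < b)%R -> (a + b = 1)%R -> (0 < A)%R -> (0 < B)%R ->
  0 <= x -> 0 <= y ->
  x `^ a * y `^ b <=
  (A `^ a * B `^ b)%:E * ((a / A)%:E * x + (b / B)%:E * y).
Proof.
move=> a0 b0 ab A0 B0.
have AB : (0 < A `^ a * B `^ b)%R by rewrite mulr_gt0// powR_gt0.
have aA : (0 < a / A)%R by rewrite divr_gt0.
have bB : (0 < b / B)%R by rewrite divr_gt0.
case: x => [x| |]//; case: y => [y| |]// x0 y0.
- rewrite lee_fin in x0; rewrite lee_fin in y0.
  have [u u0 xE] : exists2 u : R, (0 <= u)%R & x = (u * A)%R.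
    by exists (x / A)%R; rewrite ?divr_ge0 ?divfK ?gt_eqF// ltW.
  have [v v0 yE] : exists2 v : R, (0 <= v)%R & y = (v * B)%R.
    by exists (y / B)%R; rewrite ?divr_ge0 ?divfK ?gt_eqF// ltW.
  rewrite [leRHS](_ : _ =
    (A `^ a * B `^ b * (a / A * x + b / B * y))%R%:E)//.
  rewrite !poweR_EFin -EFinM lee_fin xE yE.
  rewrite !powRM//; [|exact: ltW|exact: ltW].
  rewrite mulrACA [leLHS]mulrC ler_pM2l//.
  have := @conjugate_powR R (u `^ a)%R (v `^ b)%R a^-1%R b^-1%R
    (powR_ge0 _ _) (powR_ge0 _ _).
  rewrite !invr_gt0 !invrK => /(_ a0 b0 ab).
  rewrite -!powRrM !mulfV ?gt_eqF// !powRr1// => /le_trans; apply.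
  by rewrite le_eqVlt; apply/orP; left; apply/eqP; field; rewrite !gt_eqF.
- by rewrite gt0_muley// addey// gt0_muley// leey.
- by rewrite gt0_muley// addye// gt0_muley// leey.
- rewrite (@gt0_muley _ (a / A)%:E)// (@gt0_muley _ (b / B)%:E)// addye//.
  by rewrite (@gt0_muley _ (_ * _)%:E)// leey.
Qed.

(** Stated with exponents summing to 1, and not through norms, as it is iterated in this form.
    Integrals equal to 0 or [+oo] are disposed of first, because [young_ereal] divides by them. *)
Lemma ehoelder f g (a b : R) : (0 < a)%R -> (0 < b)%R -> (a + b = 1)%R ->
  measurable_fun setT f -> (forall x, 0 <= f x) ->
  measurable_fun setT g -> (forall x, 0 <= g x) ->
  \int[mu]_x (f x `^ a * g x `^ b) <=
  (\int[mu]_x f x) `^ a * (\int[mu]_x g x) `^ b.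
Proof.
move=> a0 b0 ab mf f0 mg g0.
have If0 : 0 <= \int[mu]_x f x by exact: integral_ge0.
have Ig0 : 0 <= \int[mu]_x g x by exact: integral_ge0.
have [f00|fn0] := eqVneq (\int[mu]_x f x) 0.
  by rewrite integral0_ae0// mule_ge0// poweR_ge0.
have [g00|gn0] := eqVneq (\int[mu]_x g x) 0.
  under eq_integral do rewrite muleC.
  by rewrite integral0_ae0// mule_ge0// poweR_ge0.
have fp : 0 < \int[mu]_x f x by rewrite lt0e fn0.
have gp : 0 < \int[mu]_x g x by rewrite lt0e gn0.
have [fy|fy] := eqVneq (\int[mu]_x f x) +oo.
  by rewrite fy poweRyr ?gt_eqF// gt0_mulye ?leey// poweR_gt0.
have [gy|gy] := eqVneq (\int[mu]_x g x) +oo.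
  by rewrite gy poweRyr ?gt_eqF// gt0_muley ?leey// poweR_gt0.
have fA : (\int[mu]_x f x) \is a fin_num by rewrite ge0_fin_numE// ltey.
have gB : (\int[mu]_x g x) \is a fin_num by rewrite ge0_fin_numE// ltey.
move: fp gp; rewrite -(fineK fA) -(fineK gB) !lte_fin.
set A := fine _; set B := fine _ => A0 B0.
apply: (@le_trans _ _ (\int[mu]_x ((A `^ a * B `^ b)%:E *
    ((a / A)%:E * f x + (b / B)%:E * g x)))).
  apply: ge0_le_integral => //.
  - by move=> x _; rewrite mule_ge0// poweR_ge0.
  - by apply: emeasurable_funM; exact: measurable_fun_poweR.
  - apply: emeasurable_funM => //; apply: emeasurable_funD;
    exact: emeasurable_funM.
  - by move=> x _; exact: young_ereal.
have mZ (c : R) (h : T -> \bar R) : measurable_fun setT h ->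
    measurable_fun setT (fun x => c%:E * h x).
  by move=> mh; exact: emeasurable_funM.
rewrite ge0_integralZl_EFin//; last 3 first.
- by move=> x _; rewrite adde_ge0// mule_ge0// lee_fin divr_ge0// ltW.
- by apply: emeasurable_funD; exact: mZ.
- by rewrite mulr_ge0// powR_ge0.
rewrite ge0_integralD//; last 4 first.
- by move=> x _; rewrite mule_ge0// lee_fin divr_ge0// ltW.
- exact: mZ.
- by move=> x _; rewrite mule_ge0// lee_fin divr_ge0// ltW.
- exact: mZ.
rewrite !ge0_integralZl_EFin ?divr_ge0 ?(ltW a0) ?(ltW b0) ?(ltW A0) ?(ltW B0)//.
rewrite -(fineK fA) -(fineK gB) -/A -/B.
rewrite [leLHS](_ : _ = (A `^ a * B `^ b * (a / A * A + b / B * B))%R%:E)//.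
rewrite !poweR_EFin -EFinM lee_fin.
by rewrite !divfK ?gt_eqF// ab mulr1.
Qed.

End hoelder_ereal.

Lemma poweR_prod (I : Type) (s : seq I) (F : I -> \bar R) (a : R) :
  (forall i, 0 <= F i) ->
  (\prod_(i <- s) F i) `^ a = \prod_(i <- s) (F i `^ a).
Proof.
move=> F0; elim: s => [|i s IHs]; first by rewrite !big_nil poweR1r.
by rewrite !big_cons poweRM// ?IHs// prode_ge0.
Qed.

Lemma measurable_prode (I : Type) (s : seq I) d (T : measurableType d)
    (F : I -> T -> \bar R) : (forall i, measurable_fun setT (F i)) ->
  measurable_fun setT (fun x => \prod_(i <- s) F i x).
Proof.
move=> mF; elim: s => [|i s IHs].
  by under eq_fun do rewrite big_nil; exact: measurable_cst.
by under eq_fun do rewrite big_cons; exact: emeasurable_funM.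
Qed.

(** Induction by splitting off one function: it gets the weight [1/(n+2)] and the product of the
    others the weight [b = (n+1)/(n+2)], under which their exponents [1/(n+2)] become the [1/(n+1)]
    of the induction hypothesis. *)
Lemma ehoelder_prod d (T : measurableType d) (mu : {measure set T -> \bar R})
    (n : nat) (F : 'I_n.+1 -> T -> \bar R) :
  (forall i, measurable_fun setT (F i)) -> (forall i x, 0 <= F i x) ->
  \int[mu]_x \prod_(i < n.+1) (F i x `^ (n.+1%:R^-1)) <=
  \prod_(i < n.+1) (\int[mu]_x F i x) `^ (n.+1%:R^-1).
Proof.
elim: n => [|n IHn] in F *; move=> mF F0.
  rewrite big_ord_recl big_ord0 mule1 invr1 poweRe1 ?integral_ge0//.
  rewrite le_eqVlt; apply/orP; left; apply/eqP; apply: eq_integral => x _.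
  by rewrite big_ord_recl big_ord0 mule1 poweRe1.
set a : R := (n.+2%:R^-1)%R; pose b : R := (n.+1%:R / n.+2%:R)%R.
have cE (x : \bar R) : x `^ a = (x `^ (n.+1%:R^-1)) `^ b.
  by rewrite -poweRrM /b mulrA mulVf ?mul1r// pnatr_eq0.
rewrite big_ord_recl.
under eq_integral => x _.
  rewrite big_ord_recl; under eq_bigr do rewrite cE.
  rewrite -poweR_prod; last by move=> i; exact: poweR_ge0.
  over.
apply: le_trans (ehoelder _ _ _ _ _ _ _ _) _ => //.
- by rewrite invr_gt0 ltr0n.
- by rewrite divr_gt0 ?ltr0n.
- by rewrite /a /b -[X in (X + _)%R]mul1r -mulrDl -[n.+2%:R]natr1 addrC divff// natr1 pnatr_eq0.
- by apply: measurable_prode => i; exact: measurable_fun_poweR.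
- by move=> x; rewrite prode_ge0// => i _; exact: poweR_ge0.
apply: lee_wpmul2l; first exact: poweR_ge0.
under [leRHS]eq_bigr do rewrite cE.
rewrite -poweR_prod; last by move=> i; exact: poweR_ge0.
apply: le_poweR.
- by rewrite divr_ge0// ?ler0n.
- by apply: integral_ge0 => x _; rewrite prode_ge0// => i _; exact: poweR_ge0.
- exact: IHn.
Qed.

Lemma col'_cons0 (n : nat) (t : R) (y : 'rV[R]_n.+1) :
  col' ord0 (rV_cons (t, y)) = y.
Proof. by apply/rowP => i; rewrite mxE rV_consS. Qed.

Lemma col'_consS (n : nat) (t : R) (y : 'rV[R]_n.+1) (i : 'I_n.+1) :
  col' (lift ord0 i) (rV_cons (t, y)) = rV_cons (t, col' i y).
Proof.
apply/rowP => j; rewrite [LHS]mxE; have [k ->|->] := unliftP ord0 j.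
  rewrite rV_consS [RHS]mxE.
  have -> : lift (lift ord0 i) (lift ord0 k) = lift ord0 (lift i k).
    by apply: val_inj; rewrite /= /bump !add1n ltnS addnS.
  by rewrite rV_consS.
have -> : lift (lift ord0 i) ord0 = ord0 by apply: val_inj.
by rewrite !rV_cons0.
Qed.

Lemma measurable_col' (n : nat) (i : 'I_n.+1) :
  measurable_fun setT (fun x : 'rV[R]_n.+1 => col' i x).
Proof.
apply: measurable_rVP => j; under eq_fun do rewrite mxE.
exact: measurable_rV_coord.
Qed.

(** Induction on the dimension. On the slice where the first coordinate is [t], the factor [G ord0]
    does not depend on [t] and is separated by Hoelder's inequality; the others are functions with
    one coordinate less, to which the induction hypothesis applies. The integration in [t] is then
    [ehoelder_prod]. *)
Theorem loomis_whitney (n : nat) (G : 'I_n.+2 -> 'rV[R]_n.+1 -> \bar R) :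
  (forall i, measurable_fun setT (G i)) -> (forall i x, 0 <= G i x) ->
  \int[lebesgue_rV R n.+2]_x \prod_(i < n.+2) (G i (col' i x) `^ n.+1%:R^-1) <=
  \prod_(i < n.+2) (\int[lebesgue_rV R n.+1]_x G i x) `^ n.+1%:R^-1.
Proof.
have mGc m k (H : 'rV[R]_m.+1 -> \bar R) i : measurable_fun setT H ->
    measurable_fun setT (fun x : 'rV[R]_m.+2 => H (col' i x) `^ k).
  move=> mH; apply: measurable_fun_poweR.
  exact: (measurableT_comp mH (@measurable_col' _ i)).
elim: n => [|n IHn] in G *; move=> mG G0.
  (* In dimension two the integrand is a product of functions of separate variables, and equality
     holds. *)
  rewrite integral_rV1; last 2 first.
    by apply: measurable_prode => i; exact: mGc.
    by move=> x; rewrite prode_ge0// => i _; exact: poweR_ge0.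
  have E (t : R) (y : 'rV[R]_1) :
      \prod_(i < 2) G i (col' i (rV_cons (t, y))) `^ 1^-1 =
      G (lift ord0 ord0) (rV_cons (t, 0%R)) * G ord0 y.
    rewrite !big_ord_recl big_ord0 mule1 invr1 !poweRe1// col'_cons0 col'_consS.
    by rewrite muleC (_ : col' ord0 y = 0%R)//; apply/rowP => -[].
  under eq_integral => t _ do under eq_integral => y _ do rewrite E.
  have mG1 : measurable_fun [set: R] (fun t => G (lift ord0 ord0) (rV_cons (t, 0%R))).
    by apply: (measurableT_comp (mG _)); exact: measurable_rV_consP.
  under eq_integral => t _ do rewrite ge0_integralZl//.
  rewrite ge0_integralZr//; last exact: integral_ge0.
  rewrite !big_ord_recl big_ord0 mule1 invr1 !poweRe1 ?integral_ge0// muleC.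
  rewrite le_eqVlt; apply/orP; left; apply/eqP; congr (_ * _)%E.
  rewrite [RHS]integral_rV1//; apply: eq_integral => t _.
  rewrite /= integral_dirac// ?diracT ?mul1e//.
  by apply: (measurableT_comp (mG _)); exact: measurable_rV_consP.
set c : R := (n.+2%:R^-1)%R; pose b : R := (n.+1%:R / n.+2%:R)%R.
have cE (x : \bar R) : x `^ c = (x `^ (n.+1%:R^-1)) `^ b.
  by rewrite -poweRrM /b mulrA mulVf ?mul1r// pnatr_eq0.
have c0 : (0 < c)%R by rewrite invr_gt0 ltr0n.
have b0 : (0 < b)%R by rewrite divr_gt0 ?ltr0n.
have cb : (c + b = 1)%R.
  by rewrite /c /b -[X in (X + _)%R]mul1r -mulrDl -[n.+2%:R]natr1 addrC divff// natr1 pnatr_eq0.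
rewrite integral_rV1; last 2 first.
  by apply: measurable_prode => i; exact: mGc.
  by move=> x; rewrite prode_ge0// => i _; exact: poweR_ge0.
(* [phi i t] integrates the factor that omits the coordinate [lift ord0 i] over its slice at height
   [t]; integrated in [t] it gives back the whole integral. *)
pose phi i t := \int[lebesgue_rV R n.+1]_z G (lift ord0 i) (rV_cons (t, z)).
have phi0 i t : 0 <= phi i t by exact: integral_ge0.
have mphi i : measurable_fun [set: R] (phi i) by exact: measurable_integral_rV1.
have mP : measurable_fun [set: R] (fun t => \prod_(i < n.+2) phi i t `^ c).
  by apply: measurable_prode => i; exact: measurable_fun_poweR.
have mGl i t : measurable_fun setT (fun z => G (lift ord0 i) (rV_cons (t, z))).
  by apply: (measurableT_comp (mG _)); exact: measurable_rV_consP.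
apply: (@le_trans _ _ (\int[lebesgue_measure]_t
    ((\int[lebesgue_rV R n.+2]_x G ord0 x) `^ c * \prod_(i < n.+2) phi i t `^ c))).
  apply: ge0_le_integral => //.
  - move=> t _; apply: integral_ge0 => y _.
    by rewrite prode_ge0// => i _; exact: poweR_ge0.
  - apply: (measurable_integral_rV1 (f := fun x => \prod_(i < n.+3) G i (col' i x) `^ c)).
      by apply: measurable_prode => i; exact: mGc.
    by move=> x; rewrite prode_ge0// => i _; exact: poweR_ge0.
  - exact: emeasurable_funM.
  move=> t _.
  under eq_integral => y _.
    rewrite big_ord_recl col'_cons0.
    under eq_bigr do rewrite col'_consS cE.
    rewrite -poweR_prod; last by move=> i; exact: poweR_ge0.
    over.
  have mGn : measurable_fun setT (fun x => \prod_(i < n.+2)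
      G (lift ord0 i) (rV_cons (t, col' i x)) `^ n.+1%:R^-1).
    apply: measurable_prode => i.
    exact: (mGc _ _ (fun z => G (lift ord0 i) (rV_cons (t, z)))).
  apply: le_trans (ehoelder _ _ _ _ _ _ _ _) _ => //.
    by move=> x; rewrite prode_ge0// => i _; exact: poweR_ge0.
  apply: lee_wpmul2l; first exact: poweR_ge0.
  under [leRHS]eq_bigr do rewrite cE.
  rewrite -poweR_prod; last by move=> i; exact: poweR_ge0.
  apply: le_poweR; first exact: ltW.
    by apply: integral_ge0 => x _; rewrite prode_ge0// => i _; exact: poweR_ge0.
  by apply: (IHn (fun i z => G (lift ord0 i) (rV_cons (t, z)))).
rewrite ge0_integralZl//; last 2 first.
  by move=> t _; rewrite prode_ge0// => i _; exact: poweR_ge0.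
  exact: poweR_ge0.
rewrite [leRHS]big_ord_recl; apply: lee_wpmul2l; first exact: poweR_ge0.
apply: le_trans (ehoelder_prod _ _ _) _ => //.
rewrite le_eqVlt; apply/orP; left; apply/eqP; apply: eq_bigr => i _.
by rewrite /phi -integral_rV1.
Qed.

End loomis_whitney.

Local Close Scope ereal_scope.

(** * Coordinate lines, null hyperplanes and Borel sets *)

Section insertion.
Context {R : realType}.

Definition ins (n : nat) (i : 'I_n.+1) (t : R) (y : 'rV[R]_n) : 'rV[R]_n.+1 :=
  \row_j if unlift i j is Some k then y ord0 k else t.

Lemma ins_i (n : nat) (i : 'I_n.+1) (t : R) (y : 'rV[R]_n) :
  ins i t y ord0 i = t.
Proof. by rewrite mxE unlift_none. Qed.

Lemma ins_lift (n : nat) (i : 'I_n.+1) (t : R) (y : 'rV[R]_n) (k : 'I_n) :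
  ins i t y ord0 (lift i k) = y ord0 k.
Proof. by rewrite mxE liftK. Qed.

Lemma col'_ins (n : nat) (i : 'I_n.+1) (t : R) (y : 'rV[R]_n) :
  col' i (ins i t y) = y.
Proof. by apply/rowP => k; rewrite mxE ins_lift. Qed.

Lemma ins_col' (n : nat) (i : 'I_n.+1) (x : 'rV[R]_n.+1) :
  ins i (x ord0 i) (col' i x) = x.
Proof.
apply/rowP => j; have [k ->|->] := unliftP i j.
  by rewrite ins_lift mxE.
by rewrite ins_i.
Qed.

Lemma insE (n : nat) (i : 'I_n.+1) (s t : R) (y : 'rV[R]_n) :
  ins i (s + t) y = ins i s y + t *: delta_mx ord0 i.
Proof.
apply/rowP => j.
have -> : (ins i s y + t *: delta_mx ord0 i) ord0 j =
    ins i s y ord0 j + t * (j == i)%:R by rewrite !mxE.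
have [k ->|->] := unliftP i j.
  by rewrite !ins_lift eq_sym (negbTE (neq_lift _ _)) mulr0 addr0.
by rewrite !ins_i eqxx mulr1.
Qed.

(** Up to a permutation of coordinates, whose determinant is a sign, inserting at [i] is inserting
    in front; this gives Tonelli's theorem in any coordinate direction. *)
Lemma ins_cons (n : nat) (i : 'I_n.+1) (t : R) (y : 'rV[R]_n) :
  ins i t y = rV_cons (t, y) *m perm_mx (lift_perm i ord0 1)^-1%g.
Proof.
rewrite -col_permE; apply/rowP => j; rewrite [RHS]mxE.
have [k ->|->] := unliftP i j.
  by rewrite ins_lift lift_perm_lift perm1 rV_consS.
by rewrite ins_i lift_perm_id rV_cons0.
Qed.

Lemma measurable_ins (n : nat) (i : 'I_n.+1) d (T : measurableType d)
    (f : T -> R) (g : T -> 'rV[R]_n) :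
  measurable_fun setT f -> measurable_fun setT g ->
  measurable_fun setT (fun x => ins i (f x) (g x)).
Proof.
move=> mf mg; apply: measurable_rVP => j; have [k ->|->] := unliftP i j.
  under eq_fun do rewrite ins_lift.
  exact: (measurableT_comp (@measurable_rV_coord _ _ k) mg).
by under eq_fun do rewrite ins_i.
Qed.

Lemma integral_ins (n : nat) (i : 'I_n.+1) (f : 'rV[R]_n.+1 -> \bar R) :
  measurable_fun setT f -> (forall x, 0 <= f x)%E ->
  (\int[lebesgue_rV R n.+1]_x f x =
   \int[lebesgue_rV R n]_y \int[@lebesgue_measure R]_t f (ins i t y))%E.
Proof.
move=> mf f0; pose A : 'M[R]_n.+1 := perm_mx (lift_perm i ord0 1)^-1%g.
have uA : A \in unitmx by exact: unitmx_perm.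
rewrite -(integral_mulmx 0 uA mf f0).
rewrite det_perm normr_sign mul1e integral_rV2; last by move=> x; exact: f0.
  2: by apply: (measurableT_comp mf); exact: measurable_mulmx.
apply: eq_integral => y _; apply: eq_integral => t _.
by rewrite addr0 -ins_cons.
Qed.

Lemma measurable_integral_ins (n : nat) (i : 'I_n.+1) (f : 'rV[R]_n.+1 -> \bar R) :
  measurable_fun setT f -> (forall x, 0 <= f x)%E ->
  measurable_fun setT (fun y => \int[@lebesgue_measure R]_t f (ins i t y))%E.
Proof.
move=> mf f0; under eq_fun do under eq_integral do rewrite ins_cons.
apply: (measurable_integral_rV2 (f := fun x => f (x *m _))) => //.
under eq_fun do rewrite -[_ *m _]addr0.
by apply: (measurableT_comp mf); exact: measurable_mulmx.
Qed.

Lemma dot_ins (n : nat) (i : 'I_n.+1) (nu : 'rV[R]_n.+1) (t : R) (y : 'rV[R]_n) :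
  dot nu (ins i t y) = nu ord0 i * t + dot (col' i nu) y.
Proof.
rewrite /dot (bigD1_ord i)//= ins_i; congr (_ + _).
by apply: eq_bigr => k _; rewrite ins_lift mxE.
Qed.

Lemma dotDr (n : nat) (x y z : 'rV[R]_n) : dot x (y + z) = dot x y + dot x z.
Proof. by rewrite /dot -big_split; apply: eq_bigr => j _; rewrite mxE mulrDr. Qed.

Lemma dotZr (n : nat) (c : R) (x y : 'rV[R]_n) : dot x (c *: y) = c * dot x y.
Proof. by rewrite /dot mulr_sumr; apply: eq_bigr => j _; rewrite mxE mulrCA. Qed.

Lemma dot0r (n : nat) (x : 'rV[R]_n) : dot x 0 = 0.
Proof. by rewrite -[0 in LHS](scale0r 0) dotZr mul0r. Qed.

Lemma dotNr (n : nat) (x y : 'rV[R]_n) : dot x (- y) = - dot x y.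
Proof. by rewrite -scaleN1r dotZr mulN1r. Qed.

Lemma dotC (n : nat) (x y : 'rV[R]_n) : dot x y = dot y x.
Proof. by apply: eq_bigr => j _; rewrite mulrC. Qed.

Lemma measurable_dot (n : nat) (nu : 'rV[R]_n) :
  measurable_fun setT (fun x : 'rV[R]_n => dot nu x).
Proof.
apply: measurable_sum => j; apply: measurable_funM => //.
exact: measurable_rV_coord.
Qed.

Lemma measurable_hyperplane (n : nat) (nu : 'rV[R]_n) (c : R) :
  measurable [set x : 'rV[R]_n | dot nu x = c].
Proof.
rewrite (_ : [set _ | _] = setT `&` (dot nu) @^-1` [set c]); last first.
  by rewrite setTI.
exact: measurable_dot.
Qed.

(** Integrate along an axis [i] with [nu_i != 0]: each line in that direction meets the hyperplane
    in the single point [t0]. *)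
Lemma hyperplane_null (n : nat) (nu : 'rV[R]_n) (c : R) : nu != 0 ->
  lebesgue_rV R n [set x : 'rV[R]_n | dot nu x = c] = 0%E.
Proof.
case: n nu => [|n] nu nu0.
  by case/eqP: nu0; apply/rowP => -[].
have [i nui] : exists i, nu ord0 i != 0 by exact/rV0Pn.
have mH := measurable_hyperplane nu c.
transitivity (\int[lebesgue_rV R n.+1]_x (\1_[set x | dot nu x = c] x : R)%:E)%E.
  by rewrite integral_indic// setIT.
rewrite (integral_ins i)//; last first.
  by apply/measurable_EFinP; exact: measurable_indic.
apply: integral0_eq => y _.
pose t0 := (c - dot (col' i nu) y) / nu ord0 i.
rewrite (_ : (fun _ => _) = EFin \o \1_[set t0]); last first.
  apply/funext => t /=; congr EFin; rewrite !indicE; congr (_%:R); congr nat_of_bool.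
  apply/idP/idP; rewrite !inE/= dot_ins /t0.
    by move=> <-; rewrite addrK mulrC mulrA mulVf ?mul1r.
  by move=> ->; rewrite mulrCA divff// mulr1 subrK.
by rewrite integral_indic// ?setIT; exact: lebesgue_measure_set1.
Qed.

Lemma lee_prod_ord (n : nat) (f g : 'I_n -> \bar R) :
  (forall i, 0 <= f i <= g i)%E -> (\prod_(i < n) f i <= \prod_(i < n) g i)%E.
Proof.
elim: n => [|n IHn] in f g *; first by rewrite !big_ord0.
move=> fg; rewrite !big_ord_recl; apply: lee_pmul.
- by have /andP[] := fg ord0.
- by rewrite prode_ge0// => i _; have /andP[] := fg (lift ord0 i).
- by have /andP[] := fg ord0.
- exact: IHn.
Qed.

(** The bounds for the [n + 1] directions multiply to [w^((n+1)/n) <= prod_i G_i^(1/n)], whose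
    right-hand side is the integrand of the Loomis-Whitney inequality; each factor then contributes
    at most [K^(1/n)]. The measure of [D] matters in dimension one, where [w] is merely bounded. *)
Lemma sobolev_line_bounds (n : nat) (s : R) (D : set 'rV[R]_n.+1)
    (w : 'rV[R]_n.+1 -> \bar R) (G : 'I_n.+1 -> 'rV[R]_n -> \bar R) (K : \bar R) :
  1 <= s -> ((n > 0)%N -> s = n.+1%:R / n%:R) -> measurable D ->
  measurable_fun setT w -> (forall x, 0 <= w x)%E ->
  (forall i, measurable_fun setT (G i)) -> (forall i x, 0 <= G i x)%E ->
  (forall i x, w x <= G i (col' i x))%E ->
  (forall i, \int[lebesgue_rV R n]_y G i y <= K)%E ->
  (\int[lebesgue_rV R n.+1]_(x in D) (w x `^ s) <=
   (1 + lebesgue_rV R n.+1 D) * K `^ s)%E.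
Proof.
move=> s1 sn mD mw w0 mG G0 wG GK.
have s0 : 0 <= s by rewrite (le_trans _ s1).
have K0 : (0 <= K)%E by apply: le_trans (GK ord0); exact: integral_ge0.
have mws : measurable_fun setT (fun x => w x `^ s)%E by exact: measurable_fun_poweR.
case: n => [|n] in sn D mD w mw w0 G mG G0 wG GK mws *.
  (* In dimension one [col' ord0 x] is the only point of the space of empty rows, so [G ord0] is a
     single number. *)
  have wK x : (w x <= K)%E.
    apply: le_trans (wG ord0 x) _; apply: le_trans (GK ord0).
    rewrite /= integral_dirac// diracT mul1e.
    by rewrite (_ : col' ord0 x = 0)//; apply/rowP => -[].
  apply: (@le_trans _ _ (\int[lebesgue_rV R 1]_(x in D) (cst (K `^ s) x))%E).
    apply: ge0_le_integral => //.
    - by move=> x _; exact: poweR_ge0.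
    - exact: measurable_funTS.
    - by move=> x _ /=; exact: le_poweR.
  rewrite integral_cst// muleC lee_wpmul2r ?poweR_ge0// leeDr//.
apply: (@le_trans _ _ (\int[lebesgue_rV R n.+2]_x (w x `^ s))%E).
  by apply: ge0_subset_integral => // x _; exact: poweR_ge0.
have GsK : (\prod_(i < n.+2) (\int[lebesgue_rV R n.+1]_x G i x) `^ n.+1%:R^-1 <=
    K `^ s)%E.
  case: K K0 GK => [K| |]// K0 GK; last first.
    by rewrite poweRyr ?leey// sn// mulf_neq0 ?invr_eq0 ?pnatr_eq0.
  apply: (@le_trans _ _ (\prod_(i < n.+2) (K `^ n.+1%:R^-1)%:E)%E).
    apply: lee_prod_ord => i; rewrite poweR_ge0 -poweR_EFin le_poweR//.
    exact: integral_ge0.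
  rewrite prodEFin prodr_const card_ord poweR_EFin lee_fin sn//.
  by rewrite mulrC powRrM powR_mulrn ?powR_ge0.
have ler : (K `^ s <= (1 + lebesgue_rV R n.+2 D) * K `^ s)%E.
  by rewrite -[leLHS]mul1e lee_wpmul2r ?poweR_ge0// leeDl.
apply: le_trans (le_trans GsK ler); apply: le_trans (loomis_whitney mG G0).
apply: ge0_le_integral => //.
- by move=> x _; exact: poweR_ge0.
- apply: measurable_prode => i; apply: measurable_fun_poweR.
  exact: (measurableT_comp (mG i) (@measurable_col' _ _ i)).
move=> x _; apply: (@le_trans _ _ (\prod_(i < n.+2) (w x `^ n.+1%:R^-1))%E); last first.
  apply: lee_prod_ord => i; rewrite poweR_ge0 le_poweR//.
move: (w x) (w0 x) => [y| |]// y0; last first.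
  rewrite [leRHS](_ : _ = +oo%E) ?leey// (poweRyr (r := n.+1%:R^-1)); last first.
    by rewrite invr_eq0 pnatr_eq0.
  elim: n.+1 => [|m IHm]; first by rewrite big_ord_recl big_ord0 mule1.
  by rewrite big_ord_recl IHm.
under eq_bigr do rewrite poweR_EFin.
rewrite prodEFin prodr_const card_ord poweR_EFin lee_fin sn//.
by rewrite mulrC powRrM powR_mulrn ?powR_ge0.
Qed.

(** The measurable sets are generated by the coordinates, so openness has to be traced back to
    boxes: an open set is the countable union of the boxes with rational centre and radius [1/(k+1)]
    that it contains. *)
Lemma open_measurable_rV (n : nat) (A : set 'rV[R]_n) : open A -> measurable A.
Proof.
move=> oA.
have aux1 (a b c : R) : c - b < a -> a < c + b -> a - b < c < a + b.
  by move=> ? ?; apply/andP; split; lra.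
have aux2 (a b c d f : R) : d < f / 2 -> b - d < c -> c < b + d ->
    a - d < b -> b < a + d -> `|a - c| < f.
  by move=> ? ? ? ? ?; rewrite ltr_norml; apply/andP; split; lra.
pose box (q : 'rV[rat]_n) (k : nat) : set 'rV[R]_n :=
  [set y | forall i, `]ratr (q ord0 i) - k.+1%:R^-1, ratr (q ord0 i) + k.+1%:R^-1[%classic (y ord0 i)].
have mbox q k : measurable (box q k).
  rewrite (_ : box q k = \bigcap_(i in [set: 'I_n]) ((fun y : 'rV[R]_n => y ord0 i) @^-1`
      `]ratr (q ord0 i) - k.+1%:R^-1, ratr (q ord0 i) + k.+1%:R^-1[%classic)).
    apply: fin_bigcap_measurable => // i _.
    rewrite -[X in measurable X]setTI; apply: measurable_rV_coord => //.
  by apply/seteqP; split => y /= h i; [move=> _|]; exact: h.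
pose B m := if @unpickle ('rV[rat]_n * nat)%type m is Some (q, k) then
  if `[< box q k `<=` A >] then box q k else set0 else set0.
rewrite (_ : A = \bigcup_m B m).
  apply: bigcupT_measurable => m; rewrite /B.
  case: unpickle => [[q k]|//]; case: ifP => // _.
apply/seteqP; split; last first.
  move=> x [m _]; rewrite /B; case: unpickle => [[q k]|//].
  by case: ifPn => // /asboolP + bx; apply.
move=> x Ax; have /nbhs_ballP[e /= e0 xeA] : nbhs x A by exact: open_nbhs_nbhs.
have [k ke] : exists k : nat, k.+1%:R^-1 < e / 2.
  by exists (Num.truncn (e / 2)^-1); rewrite invf_plt ?posrE ?divr_gt0// truncnS_gt.
have kp : 0 < k.+1%:R^-1 :> R by rewrite invr_gt0.
have /choice[q qP] (i : 'I_n) : exists q : rat,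
    ratr q \in `]x ord0 i - k.+1%:R^-1, x ord0 i + k.+1%:R^-1[.
  have /rat_in_itvoo[q ?] : x ord0 i - k.+1%:R^-1 < x ord0 i + k.+1%:R^-1.
    by rewrite ltrD2l gtrN.
  by exists q.
exists (pickle (\row_i q i, k)) => //; rewrite /B pickleK.
case: ifPn => [_ i|/asboolP].
  rewrite /= in_itv/= mxE; have := qP i; rewrite in_itv/= => /andP[h1 h2].
  exact: aux1.
case=> y yb; apply: xeA; split=> // i j; rewrite !ord1.
have := qP j; have := yb j; rewrite /= !in_itv/= mxE => /andP[h1 h2] /andP[h3 h4].
exact: (aux2 _ _ _ _ _ ke h1 h2 h3 h4).
Qed.

Lemma closed_measurable_rV (n : nat) (A : set 'rV[R]_n) : closed A -> measurable A.
Proof.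
move=> cA; rewrite -[A]setCK; apply: measurableC.
apply: open_measurable_rV; exact: closed_openC.
Qed.

Lemma bounded_coord (n : nat) (A : set 'rV[R]_n) : bounded_set A ->
  exists2 M : R, 0 < M & forall x i, A x -> `|x ord0 i| <= M.
Proof.
move=> [M [Mr MA]]; exists (`|M| + 1); first by rewrite ltr_wpDl.
move=> x i Ax; apply: (@le_trans _ _ `|x|).
  rewrite [leRHS]mx_normrE.
  exact: (le_bigmax _ (fun i => `|x i.1 i.2|) (ord0, i)).
by apply: MA => //; rewrite ltr_pwDr// ler_norm.
Qed.

End insertion.

(** * Polynomials along lines *)

Section polynomials.
Context {R : realType}.

Definition line_poly (n : nat) (v : mpoly.mpoly n R) (x z : 'rV[R]_n) : {poly R} :=
  mpoly.mmap polyC (fun i => (x ord0 i)%:P + z ord0 i *: 'X) v.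

Lemma line_polyE (n : nat) (v : mpoly.mpoly n R) (x z : 'rV[R]_n) (t : R) :
  (line_poly v x z).[t] = peval v (x + t *: z).
Proof.
rewrite /peval mpoly.mevalE /line_poly /mpoly.mmap horner_sum.
apply: eq_bigr => m _; rewrite hornerM hornerC; congr (_ * _).
rewrite /mpoly.mmap1 horner_prod; apply: eq_bigr => i _.
by rewrite horner_exp !hornerE !mxE mulrC.
Qed.

Lemma size_line_poly (n k : nat) (v : mpoly.mpoly n R) (x z : 'rV[R]_n) :
  degree_le k v -> (size (line_poly v x z) <= k.+1)%N.
Proof.
move=> vk; rewrite /line_poly /mpoly.mmap.
apply: leq_trans (size_sum _ _ _) _; apply/bigmax_leqP_seq => m mv _.
apply: (@leq_trans (mpoly.mdeg m).+1); last first.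
  by apply: leq_trans vk; exact: mpoly.msize_mdeg_lt.
have aux (p q : {poly R}) a b : (size p <= a.+1)%N -> (size q <= b.+1)%N ->
    (size (p * q)%R <= (a + b).+1)%N.
  move=> pa qb; apply: leq_trans (size_polyMleq _ _) _.
  by rewrite -ltnS; case: (size p + size q)%N (leq_add pa qb) => //= s; rewrite addSn addnS.
rewrite -[mpoly.mdeg m]add0n; apply: (aux); first exact: size_polyC_leq1.
rewrite mpoly.mdegE /mpoly.mmap1.
elim/big_rec2: _ => [|i a b _ ba]; first by rewrite size_poly1.
apply: (aux) => //; elim: (m i) => [|c IHc]; first by rewrite expr0 size_poly1.
rewrite exprS; apply: (aux _ _ 1%N c) => //.
apply: leq_trans (size_polyD _ _) _; rewrite geq_max.
rewrite (leq_trans (size_polyC_leq1 _))//=.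
by apply: leq_trans (size_scale_leq _ _) _; rewrite size_polyX.
Qed.

(** By linearity this concerns monomials, where only the factor of the variable [i] depends on [t],
    the direction being a unit vector. *)
Lemma deriv_line_poly (n : nat) (v : mpoly.mpoly n R) (x : 'rV[R]_n) (i : 'I_n) (t : R) :
  (line_poly v x (delta_mx ord0 i))^`().[t] =
  peval (mpoly.mderiv i v) (x + t *: delta_mx ord0 i).
Proof.
rewrite -line_polyE /line_poly.
elim/mpoly.mpolyind: v => [|c m p _ _ IHp].
  by rewrite mpoly.mderiv0 !mpoly.mmap0 deriv0.
rewrite mpoly.mderivD !mpoly.mmapD derivD !hornerD IHp; congr (_ + _).
rewrite linearZ/= mpoly.mderivX !mpoly.mmapZ !mpoly.mmapX.
rewrite derivM derivC mul0r add0r !hornerM !hornerC; congr (_ * _).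
rewrite /mpoly.mmap1 (bigD1 i)//= [in RHS](bigD1 i)//=.
set P := \prod_(j < n | j != i) _; set Q := \prod_(j < n | j != i) _.
have PE : P = (\prod_(j < n | j != i) (x ord0 j) ^+ (m j))%:P.
  rewrite rmorph_prod; apply: eq_bigr => j ji.
  by rewrite !mxE (negbTE ji) andbF scale0r addr0 rmorphXn.
have QE : Q = P.
  apply: eq_bigr => j ji; congr (_ ^+ _).
  by rewrite mpoly.mnmBE mpoly.mnm1E eq_sym (negbTE ji) subn0.
rewrite QE PE derivM derivC mulr0 addr0 !hornerM !hornerC mulrA; congr (_ * _).
rewrite mpoly.mnmBE mpoly.mnm1E eqxx subn1.
rewrite !mxE !eqxx scale1r deriv_exp derivD derivC derivX add0r mul1r.
by rewrite hornerMn mulr_natl.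
Qed.

Lemma measurable_peval (n : nat) (v : mpoly.mpoly n R) :
  measurable_fun setT (fun x : 'rV[R]_n => peval v x).
Proof.
rewrite /peval; under eq_fun do rewrite mpoly.mevalE.
apply: measurable_sum => m; apply: measurable_funM => //.
apply: measurable_prod => i _; apply: measurable_funX.
exact: measurable_rV_coord.
Qed.

Lemma peval_bounded (n : nat) (v : mpoly.mpoly n R) (M : R) : 0 <= M ->
  exists2 B : R, 0 <= B & forall x : 'rV[R]_n, (forall i, `|x ord0 i| <= M) ->
    `|peval v x| <= B.
Proof.
move=> M0; exists (\sum_(m <- mpoly.msupp v) `|mpoly.mcoeff m v| * \prod_(i < n) M ^+ (m i)).
  apply: sumr_ge0 => m _; rewrite mulr_ge0// prodr_ge0// => i _.
  exact: exprn_ge0.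
move=> x xM; rewrite /peval mpoly.mevalE; apply: le_trans (ler_norm_sum _ _ _) _.
apply: ler_sum => m _; rewrite normrM ler_wpM2l// normr_prod.
apply: ler_prod => i _; rewrite normr_ge0/= normrX.
by rewrite lerXn2r ?nnegrE// (le_trans _ (xM i)).
Qed.

End polynomials.

(** * Finite differences and extrapolation of polynomials *)

Section finite_differences.
Context {R : realType}.

(** The difference [q] of [p] and its translate has lower degree; Pascal's rule turns the
    alternating sum of order [k + 1] of [p] into the one of order [k] of [q]. *)
Lemma finite_difference (k : nat) (p : {poly R}) (a u : R) : (size p <= k)%N ->
  \sum_(0 <= j < k.+1) (-1) ^+ j * 'C(k, j)%:R * p.[a + j%:R * u] = 0.
Proof.
elim: k => [|k IHk] in p a *.
  rewrite leqn0 size_poly_eq0 => /eqP ->.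
  by rewrite big1// => j _; rewrite horner0 mulr0.
move=> pk; pose q := p - (p \Po ('X + u%:P)).
have qE x : q.[x] = p.[x] - p.[x + u] by rewrite !hornerE horner_comp !hornerE.
have qk : (size q <= k)%N.
  apply/leq_sizeP => j; rewrite leq_eqVlt => /orP[/eqP <-|kj]; last first.
    rewrite coefB !nth_default ?subrr//.
      by rewrite size_comp_poly2 ?size_XaddC// (leq_trans pk).
    exact: leq_trans pk kj.
  have [pk1|] := eqVneq (size p) k.+1; last first.
    rewrite neq_ltn => /orP[|]; last by rewrite ltnNge pk.
    rewrite ltnS => pk'; rewrite coefB !nth_default ?subrr//.
    by rewrite size_comp_poly2 ?size_XaddC.
  rewrite coefB.
  have := lead_coef_comp p (q := 'X + u%:P); rewrite size_XaddC => /(_ isT).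
  rewrite lead_coefXaddC expr1n mulr1 !lead_coefE size_comp_poly2 ?size_XaddC// pk1/=.
  by move=> ->; rewrite subrr.
pose c (j : nat) (x : R) := (-1) ^+ j * 'C(k, j)%:R * x.
have h : \sum_(0 <= j < k.+1) c j p.[a + j%:R * u] =
    \sum_(0 <= j < k.+1) c j p.[a + j.+1%:R * u].
  apply/eqP; rewrite -subr_eq0 -sumrB; apply/eqP.
  rewrite -[RHS](IHk q a qk); apply: eq_bigr => j _.
  by rewrite -mulrBr qE -natr1 mulrDl mul1r addrA.
rewrite big_nat_recl// bin0 expr0 mul1r mul1r mul0r addr0.
under eq_bigr => j _ do rewrite binS natrD mulrDr mulrDl.
rewrite big_split/= addrA.
have -> : p.[a] + \sum_(0 <= i < k.+1)
    (-1) ^+ i.+1 * 'C(k, i.+1)%:R * p.[a + i.+1%:R * u] =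
    \sum_(0 <= j < k.+2) c j p.[a + j%:R * u].
  by rewrite [RHS]big_nat_recl// /c bin0 expr0 mul1r mul1r mul0r addr0.
rewrite big_nat_recr//= {2}/c bin_small// mulr0 mul0r addr0 h -big_split/=.
by apply: big1 => j _; rewrite /c exprS mulN1r mulNr mulNr subrr.
Qed.

(* The value at one end of k + 2 equispaced points is a signed sum of the other
   values with weights adding up to less than 2^(k+1). *)
Lemma extrapolation (k : nat) (p : {poly R}) (u : R) : (size p <= k.+1)%N ->
  exists2 j : nat, (0 < j <= k.+1)%N & `|p.[0]| <= 2 ^+ k.+1 * `|p.[j%:R * u]|.
Proof.
move=> pk; have [p0|p0] := eqVneq p.[0] 0.
  by exists 1%N => //; rewrite p0 normr0 mulr_ge0// exprn_ge0.
apply: contrapT => h.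
have {}h j : (j < k.+1)%N -> `|p.[j.+1%:R * u]| < `|p.[0]| / 2 ^+ k.+1.
  move=> jk; rewrite ltNge; apply/negP => hj; apply: h; exists j.+1 => //.
  by rewrite -ler_pdivrMl ?exprn_gt0// mulrC.
have := finite_difference 0 u pk; rewrite big_nat_recl// bin0 expr0 mul1r mul1r mul0r addr0.
move/eqP; rewrite addr_eq0 => /eqP E.
have : `|p.[0]| < `|p.[0]|.
  rewrite {1}E normrN.
  apply: (@le_lt_trans _ _ (\sum_(0 <= j < k.+1) 'C(k.+1, j.+1)%:R * `|p.[j.+1%:R * u]|)).
    apply: le_trans (ler_norm_sum _ _ _) _; apply: ler_sum => j _.
    by rewrite add0r !normrM normrX normrN1 expr1n mul1r normr_nat.
  apply: (@lt_le_trans _ _ (\sum_(0 <= j < k.+1) 'C(k.+1, j.+1)%:R * (`|p.[0]| / 2 ^+ k.+1))).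
    rewrite !big_mkord; apply: ltr_sum; last first.
      by move=> j _; rewrite ltr_pM2l ?h// ltr0n bin_gt0.
    by apply/hasP; exists ord0 => //; rewrite mem_index_enum.
  rewrite -mulr_suml mulrA ler_pdivrMr ?exprn_gt0// mulrC ler_wpM2l//.
  rewrite -natr_sum -natrX ler_nat.
  have := expnDn 1 1 k.+1; rewrite addn1 => ->.
  rewrite big_ord_recl big_mkord -[leqLHS]add0n leq_add//.
  by apply: leq_sum => j _; rewrite !exp1n !muln1.
by rewrite ltxx.
Qed.

End finite_differences.

(** * The signed power of a polynomial and its variation on an interval *)

Section signed_power.
Context {R : realType}.

(** The odd primitive of [a |u|^(a-1)]: continuously differentiable for all [1 <= a], with absolute
    value [|u|^a]. The function [|u|^a] itself fails to be differentiable at 0 when [a = 1]. *)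
Definition spow (a u : R) : R := u * `|u| `^ (a - 1).

Lemma continuous_norm_powR (b : R) : 0 <= b ->
  continuous (fun u : R => `|u| `^ b).
Proof.
rewrite le_eqVlt => /orP[/eqP <-|b0] u.
  rewrite (_ : (fun _ => _) = cst 1); first exact: cvg_cst.
  by apply/funext => x; rewrite powRr0.
have [->|u0] := eqVneq u 0.
  rewrite /continuous_at normr0 powR0 ?gt_eqF//; apply/cvgrPdist_lt => e e0; near=> x.
  rewrite sub0r normrN ger0_norm ?powR_ge0//.
  have -> : e = (e `^ b^-1) `^ b by rewrite -powRrM mulVf ?gt_eqF// powRr1// ltW.
  apply: gt0_ltr_powR => //; rewrite ?nnegrE ?powR_ge0//.
  near: x; apply/nbhs_ballP; exists (e `^ b^-1) => /=; first exact: powR_gt0.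
  by move=> y; rewrite /ball/= sub0r normrN.
rewrite -[continuous_at _ _]/({for u, continuous ((fun x : R => x `^ b) \o (fun v : R => `|v|))}).
apply: continuous_comp.
  exact: norm_continuous.
apply/differentiable_continuous/derivable1_diffP.
by apply: derivable_powR; rewrite in_itv/= andbT normr_gt0.
Unshelve. all: by end_near. Qed.

Lemma is_derive_spow (a u : R) : 1 <= a ->
  is_derive u 1 (spow a) (a * `|u| `^ (a - 1)).
Proof.
move=> a1; have b0 : 0 <= a - 1 by rewrite subr_ge0.
have a0 : 0 < a by exact: lt_le_trans a1.
have [u0|u0|->] := ltgtP u 0.
- apply: (near_eq_is_derive (f := (fun y : R => - ((- y) `^ a)))).
    near=> y; rewrite /spow.
    have y0 : y < 0 by near: y; exact: lt_nbhsl.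
    rewrite ltr0_norm//.
    rewrite -mulr_powRB1// ?mulNr ?opprK//.
    by rewrite oppr_ge0 ltW.
  have Nu : 0 < - u by rewrite oppr_gt0.
  have D : is_derive u 1 (-%R : R -> R) (-1 : R) by exact: is_deriveN (is_derive_id u 1).
  have := is_deriveN (is_derive1_comp (is_derive1_powR a Nu) D).
  by rewrite mulrN1 opprK ltr0_norm.
- apply: (near_eq_is_derive (f := (fun y : R => y `^ a))).
    near=> y; rewrite /spow.
    have y0 : 0 < y by near: y; exact: lt_nbhsr.
    by rewrite gtr0_norm// mulr_powRB1// ltW.
  by rewrite gtr0_norm//; exact: is_derive1_powR.
(* At 0 the difference quotient is [|h|^(a-1)]. Its limit agrees with [a * 0^(a-1)], both being 1
   for [a = 1], where [0^0 = 1], and 0 otherwise. *)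
have H : (fun h : R => h^-1 *: (spow a (h *: 1 + 0) - spow a 0)) @ 0^' --> a * `|0 : R| `^ (a - 1).
  have -> : a * `|0 : R| `^ (a - 1) = `|0 : R| `^ (a - 1).
    rewrite normr0; have [->|aN1] := eqVneq a 1; first by rewrite mul1r.
    by rewrite powR0 ?subr_eq0// mulr0.
  have := @continuous_norm_powR (a - 1) b0 0.
  move=> /(@continuous_withinNx _ _ _ _).
  apply: cvg_trans; apply: near_eq_cvg; near=> h.
  have h0 : h != 0 by near: h; exact: nbhs_dnbhs_neq.
  rewrite /spow mul0r subr0 addr0 /= -[h *: 1]/(h * 1) mulr1 -[RHS]/(h^-1 * _).
  by rewrite mulrA mulVf// mul1r.
apply: DeriveDef; first by apply/cvg_ex; eexists; exact: H.
by rewrite /derive; apply: cvg_lim => //; exact: H.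
Unshelve. all: by end_near. Qed.

Lemma continuous_spow (a : R) : 1 <= a -> continuous (spow a).
Proof.
move=> a1 u; apply/differentiable_continuous/derivable1_diffP.
by apply: ex_derive; exact: is_derive_spow.
Qed.

(** Mean value theorem: the intermediate point lies between [x] and [y], so its absolute value is at
    most the larger of theirs. *)
Lemma spow_dist (a x y : R) : 1 <= a ->
  `|spow a x - spow a y| <= a * (`|x| `^ (a - 1) + `|y| `^ (a - 1)) * `|x - y|.
Proof.
move=> a1; have b0 : 0 <= a - 1 by rewrite subr_ge0.
have a0 : 0 < a by exact: lt_le_trans a1.
wlog xy : x y / x <= y => [H|].
  have [|/ltW yx] := leP x y; first exact: H.
  by rewrite distrC [`|x - y|]distrC [X in _ * X * _]addrC; exact: H.
rewrite distrC [`|x - y|]distrC.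
have cs : {within `[x, y], continuous (spow a)}.
  by apply: continuous_subspaceT; exact: continuous_spow.
have [c] := MVT_segment xy (fun z _ => is_derive_spow z a1) cs.
rewrite in_itv/= => /andP[xc cy] ->.
rewrite normrM ler_wpM2r// ger0_norm; last by rewrite mulr_ge0 ?powR_ge0// ltW.
apply: ler_wpM2l; first exact: ltW.
have [c0|c0] := leP 0 c.
  apply: (@le_trans _ _ (`|y| `^ (a - 1))); last by rewrite lerDr powR_ge0.
  apply: ge0_ler_powR; rewrite ?nnegrE//.
  by rewrite !ger0_norm// (le_trans c0).
apply: (@le_trans _ _ (`|x| `^ (a - 1))); last by rewrite lerDl powR_ge0.
apply: ge0_ler_powR; rewrite ?nnegrE//.
by rewrite !ltr0_norm ?lerN2// (le_lt_trans xc).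
Qed.

(** The integrand is the absolute value of the derivative of [spow a] composed with [p], which is
    continuous even at the zeros of [p]. *)
Lemma ftc_spow (a : R) (p : {poly R}) (x y : R) : 1 <= a -> x <= y ->
  (`|spow a p.[y] - spow a p.[x]|%:E <=
   \int[lebesgue_measure]_(t in `[x, y])
     (a * `|p.[t]| `^ (a - 1) * `|p^`().[t]|)%:E)%E.
Proof.
move=> a1; rewrite le_eqVlt => /orP[/eqP ->|xy].
  rewrite subrr normr0; apply: integral_ge0 => t _.
  by rewrite lee_fin !mulr_ge0// ?powR_ge0// (le_trans _ a1).
have cp (q : {poly R}) : continuous (horner q).
  move=> t; apply/differentiable_continuous/derivable1_diffP.
  exact: derivable_horner.
have b0 : 0 <= a - 1 by rewrite subr_ge0.
pose f t := a * `|p.[t]| `^ (a - 1) * p^`().[t].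
have cf : continuous f.
  move=> t; apply: cvgM; last exact: cp.
  apply: cvgM; first exact: cvg_cst.
  apply: (@continuous_comp _ _ _ (horner p) (fun u : R => `|u| `^ (a - 1))).
    exact: cp.
  exact: continuous_norm_powR.
have D (t : R) : is_derive t 1 (spow a \o horner p) (f t).
  apply: is_derive1_comp; first exact: is_derive_spow.
have cF (t : R) : {for t, continuous (spow a \o horner p)}.
  apply/differentiable_continuous/derivable1_diffP.
  by apply: ex_derive; exact: D.
have := @continuous_FTC2 R f (spow a \o horner p) x y xy.
have wf : {within `[x, y], continuous f} by exact: continuous_subspaceT.
move=> /(_ wf); have dF : derivable_oo_LRcontinuous (spow a \o horner p) x y.
  split; first by move=> t _; apply: ex_derive; exact: D.
    by apply: cvg_at_right_filter; exact: cF.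
  by apply: cvg_at_left_filter; exact: cF.
move=> /(_ dF) /=; have dFE : {in `]x, y[, (spow a \o horner p)^`()%classic =1 f}.
  by move=> t _; rewrite derive1E; apply: derive_val.
move=> /(_ dFE) E; rewrite -abse_EFin EFinB -E.
apply: le_trans (le_abse_integral _ _ _) _ => //.
  apply/measurable_EFinP; apply: measurable_funTS.
  exact: continuous_measurable_fun.
rewrite le_eqVlt; apply/orP; left; apply/eqP; apply: eq_integral => t _.
by rewrite /= /f normrM ger0_norm// mulr_ge0 ?powR_ge0// (le_trans _ a1).
Qed.

End signed_power.

(** * Affine forms and simplices *)

Section affine_forms.
Context {R : realType}.

Definition aev (n : nat) (l : 'rV[R]_n * R) (x : 'rV[R]_n) : R := dot l.1 x + l.2.

Lemma aevD (n : nat) (l : 'rV[R]_n * R) (x z : 'rV[R]_n) (t : R) :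
  aev l (x + t *: z) = aev l x + t * dot l.1 z.
Proof. by rewrite /aev dotDr dotZr addrAC. Qed.

Lemma aev_conv (n : nat) (l : 'rV[R]_n * R) (x y : 'rV[R]_n) (t : R) :
  aev l (x + t *: (y - x)) = (1 - t) * aev l x + t * aev l y.
Proof. by rewrite aevD /aev dotDr dotNr; ring. Qed.

Lemma dot_sumr (n : nat) (nu : 'rV[R]_n) (I : Type) (r : seq I) (P : pred I)
    (F : I -> 'rV[R]_n) :
  dot nu (\sum_(i <- r | P i) F i) = \sum_(i <- r | P i) dot nu (F i).
Proof.
elim/big_rec2: _ => [|i y1 y2 _ <-]; first exact: dot0r.
by rewrite dotDr.
Qed.

Lemma aev_sum (n : nat) (l : 'rV[R]_n * R) (I : finType) (P : pred I)
    (w : I -> R) (F : I -> 'rV[R]_n) : \sum_(i | P i) w i = 1 ->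
  aev l (\sum_(i | P i) w i *: F i) = \sum_(i | P i) w i * aev l (F i).
Proof.
move=> w1; rewrite /aev dot_sumr.
under [RHS]eq_bigr do rewrite mulrDr.
rewrite big_split/= -mulr_suml w1 mul1r; congr (_ + _).
by apply: eq_bigr => i _; rewrite dotZr.
Qed.

Lemma nbhs_line (n : nat) (x z : 'rV[R]_n) (A : set 'rV[R]_n) : nbhs x A ->
  exists2 e : R, 0 < e & forall t, `|t| < e -> A (x + t *: z).
Proof.
move=> /nbhs_ballP[e /= e0 xA].
exists (e / (`|z| + 1)).
  by rewrite divr_gt0// ltr_wpDl.
move=> t te; apply: xA; split => // i j; rewrite /ball/= !mxE opprD addrA subrr sub0r normrN.
rewrite normrM; apply: (@le_lt_trans _ _ (`|t| * (`|z| + 1))).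
  apply: ler_wpM2l => //; apply: (@le_trans _ _ `|z|); last by rewrite lerDl.
  rewrite [leRHS]mx_normrE ord1.
  exact: (le_bigmax _ (fun i => `|z i.1 i.2|) (ord0, j)).
by rewrite -ltr_pdivlMr// ltr_wpDl.
Qed.

Lemma continuous_aev (n : nat) (l : 'rV[R]_n * R) : continuous (aev l).
Proof.
move=> x; apply: (@cvgD R R _ (nbhs x) _ (fun y => dot l.1 y) (fun=> l.2)).
  rewrite /dot; elim: (index_enum _) => [|i s IHs].
    rewrite big_nil (_ : (fun _ => _) = cst 0); first exact: cvg_cst.
    by apply/funext => y; rewrite big_nil.
  rewrite big_cons (_ : (fun _ => _) = (fun y : 'rV[R]_n =>
    l.1 ord0 i * y ord0 i) \+ (fun y => \sum_(i <- s) l.1 ord0 i * y ord0 i)).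
    apply: (@cvgD R R _ (nbhs x)) => //.
    by apply: (@cvgM _ _ (nbhs x)); [exact: cvg_cst|exact: coord_continuous].
  by apply/funext => y; rewrite big_cons.
exact: cvg_cst.
Qed.

Lemma open_aev_gt0 (n : nat) (l : 'rV[R]_n * R) : open [set x | 0 < aev l x].
Proof.
rewrite (_ : [set _ | _] = aev l @^-1` [set y | 0 < y])//.
by apply: open_comp; [move=> x _; exact: continuous_aev|exact: open_gt].
Qed.

Lemma closed_aev_ge0 (n : nat) (l : 'rV[R]_n * R) : closed [set x | 0 <= aev l x].
Proof.
rewrite (_ : [set _ | _] = aev l @^-1` [set y | 0 <= y])//.
by apply: preimage_closed; [move=> x _; exact: continuous_aev|exact: closed_ge].
Qed.

Lemma open_forall (T : topologicalType) (I : finType) (A : I -> set T) :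
  (forall i, open (A i)) -> open [set x | forall i, A i x].
Proof.
move=> oA; rewrite openE => x Ax; apply: filter_forall => i.
by apply: open_nbhs_nbhs; split => //; exact: Ax.
Qed.

Lemma closed_forall (T : topologicalType) (I : finType) (A : I -> set T) :
  (forall i, closed (A i)) -> closed [set x | forall i, A i x].
Proof.
move=> oA; rewrite (_ : [set _ | _] = \bigcap_(i in setT) A i).
  by apply: closed_bigI => i _; exact: oA.
by apply/seteqP; split => x /= h i; [move=> _|]; exact: h.
Qed.

End affine_forms.

Section barycentric.
Context {R : realType} {d : nat}.
Implicit Types (a : 'I_d.+1 -> 'rV[R]_d) (b : 'I_d.+1 -> 'rV[R]_d * R).

Definition is_bary a b : Prop :=
  [/\ forall x, \sum_j aev (b j) x = 1,
      forall x, \sum_j aev (b j) x *: a j = x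
    & forall j l, aev (b j) (a l) = (j == l)%:R].

(** The forms of the vertices other than the first are the coordinates of [x - a ord0] in the basis
    of edges, read off from [invmx M]; the first form is what they lack to 1. *)
Lemma bary_exists a :
  row_free (\matrix_(i < d) (a (lift ord0 i) - a ord0)) -> exists b, is_bary a b.
Proof.
set M := \matrix_i _; rewrite row_free_unit => uM.
pose N := invmx M.
pose bs (i : 'I_d) : 'rV[R]_d * R := ((col i N)^T, - (a ord0 *m N) ord0 i).
pose b0 : 'rV[R]_d * R := (- \sum_i (bs i).1, 1 - \sum_i (bs i).2).
pose b j := if unlift ord0 j is Some i then bs i else b0.
have bS i : b (lift ord0 i) = bs i by rewrite /b liftK.
have bb0 : b ord0 = b0 by rewrite /b unlift_none.
have bsE i x : aev (bs i) x = ((x - a ord0) *m N) ord0 i.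
  rewrite /aev /bs/= mulmxBl !mxE; congr (_ - _); rewrite /dot.
  by apply: eq_bigr => j _; rewrite !mxE mulrC.
have b0E x : aev b0 x = 1 - \sum_i aev (bs i) x.
  rewrite /aev /b0/= dotC dotNr dot_sumr [X in _ = _ - X]big_split/=.
  under eq_bigr do rewrite dotC.
  by rewrite addrCA opprD.
have b1 x : \sum_j aev (b j) x = 1.
  rewrite big_ord_recl bb0 b0E; under [X in _ + X]eq_bigr do rewrite bS.
  by rewrite subrK.
exists b; split => //.
- move=> x; rewrite big_ord_recl bb0 b0E.
  under [X in _ + X]eq_bigr do rewrite bS.
  rewrite scalerBl scale1r scaler_suml -addrA [- _ + _]addrC -sumrB.
  under eq_bigr do rewrite -scalerBr bsE.
  transitivity (a ord0 + (x - a ord0) *m N *m M); last first.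
    by rewrite -mulmxA mulVmx// mulmx1 addrC subrK.
  congr (_ + _); rewrite [RHS]mulmx_sum_row; apply: eq_bigr => i _.
  by rewrite rowK.
- have bsa i l : aev (bs i) (a l) = (lift ord0 i == l)%:R.
    rewrite bsE; have [k ->|->] := unliftP ord0 l; last first.
      by rewrite subrr mul0mx mxE eq_sym (negbTE (neq_lift _ _)).
    have -> : a (lift ord0 k) - a ord0 = row k M by rewrite rowK.
    by rewrite -row_mul mulmxV// !mxE (inj_eq lift_inj) eq_sym.
  move=> j l; have [i ->|->] := unliftP ord0 j; first by rewrite bS bsa.
  rewrite bb0 b0E; under eq_bigr do rewrite bsa.
  have [k ->|->] := unliftP ord0 l.
    rewrite (bigD1 k)//= eqxx big1 ?addr0 ?subrr// => i ik.
    by rewrite (inj_eq lift_inj) (negbTE ik).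
  by rewrite big1 ?subr0// => i _; rewrite eq_sym (negbTE (neq_lift _ _)).
Qed.

(** The weights of a convex combination of the vertices are its barycentric coordinates, so that
    membership becomes a set of sign conditions. *)
Lemma hullE a b (J : {set 'I_d.+1}) : is_bary a b ->
  hull a J = [set x | (forall j, 0 <= aev (b j) x) /\
                      (forall j, j \notin J -> aev (b j) x = 0)].
Proof.
move=> [b1 ba bd]; apply/seteqP; split => x /=.
  move=> [w [w0 w1 ->]].
  have E l : aev (b l) (\sum_(j in J) w j *: a j) = if l \in J then w l else 0.
    rewrite aev_sum//; case: ifPn => lJ.
      rewrite (bigD1 l)//= bd eqxx mulr1 big1 ?addr0// => j /andP[_ jl].
      by rewrite bd eq_sym (negbTE jl) mulr0.
    rewrite big1// => j jJ; rewrite bd; case: eqP => [lj|]; last by rewrite mulr0.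
    by rewrite lj jJ in lJ.
  split => j; first by rewrite E; case: ifP.
  by rewrite E => /negbTE ->.
move=> [x0 xJ]; exists (fun j => aev (b j) x); split => //.
  rewrite -[RHS](b1 x) [RHS](bigID [in J])/= [X in _ + X]big1 ?addr0// => j.
rewrite -[LHS](ba x) [LHS](bigID [in J])/= [X in _ + X]big1 ?addr0// => j jJ.
by rewrite xJ// scale0r.
Qed.

Lemma simplexE a b S : is_bary a b -> is_simplex a S ->
  S = [set x | forall j, 0 < aev (b j) x].
Proof.
move=> ab [_ ->]; apply/seteqP; split => [x xh j|]; last first.
  rewrite -open_subsetE; last by apply: open_forall => i; exact: open_aev_gt0.
  move=> x /= xp; rewrite (hullE _ ab); split => j; first exact: ltW.
  by rewrite inE.
have /= hx := interior_subset xh; rewrite (hullE _ ab) in hx.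
have [hx0 _] := hx; rewrite lt_def hx0 andbT; apply/eqP => bj0.
(* A point where the form of [a j] vanishes is not interior: stepping away from the vertex [a j]
   makes the form negative. *)
have [e e0 he] := nbhs_line (a j - x) xh.
have {he} := he (- (e / 2)); rewrite normrN gtr0_norm ?divr_gt0//.
have e2 : e / 2 < e by lra.
move=> /(_ e2); rewrite (hullE _ ab) => -[/(_ j) + _].
rewrite aev_conv bj0 mulr0 add0r; case: ab => _ _ ->.
by rewrite eqxx mulr1 oppr_ge0 leNgt divr_gt0.
Qed.

Lemma closure_simplexE a b S : is_bary a b -> is_simplex a S ->
  closure S = [set x | forall j, 0 <= aev (b j) x].
Proof.
move=> ab aS; rewrite (simplexE ab aS); apply/seteqP; split => x.
  have cl : closed [set x : 'rV[R]_d | forall j, 0 <= aev (b j) x].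
    by apply: closed_forall => j; exact: closed_aev_ge0.
  rewrite [X in _ -> X](_ : _ = closure [set x : 'rV[R]_d | forall j, 0 <= aev (b j) x] x).
    by apply: closureS => y /= yp j; exact: ltW.
  by rewrite -((closure_id _).1 cl).
move=> /= x0 B xB.
(* At the barycentre [g] every form equals [w]; the points of the segment from [x] to [g] other than
   [x] therefore lie in the open simplex. *)
pose w : R := d.+1%:R^-1; have w0 : 0 < w by rewrite invr_gt0 ltr0n.
pose g : 'rV[R]_d := \sum_j w *: a j.
have gE j : aev (b j) g = w.
  rewrite aev_sum; last by rewrite sumr_const card_ord -mulr_natr mulVf// pnatr_eq0.
  rewrite (bigD1 j)//= big1 ?addr0; case: ab => _ _ bd; first by rewrite bd eqxx mulr1.
  by move=> i ij; rewrite bd eq_sym (negbTE ij) mulr0.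
have [e e0 he] := nbhs_line (g - x) xB.
pose t := Num.min (e / 2) (1 / 2).
have t0 : 0 < t by rewrite lt_min !divr_gt0.
have te : t < e by rewrite gt_min; apply/orP; left; lra.
have t1 : t < 1 by rewrite gt_min; apply/orP; right; lra.
exists (x + t *: (g - x)); split; last by apply: he; rewrite gtr0_norm.
move=> j; rewrite aev_conv gE ltr_wpDl ?mulr_gt0// mulr_ge0//.
by rewrite subr_ge0 ltW.
Qed.

(* The facets of a simplex do not depend on the choice of its vertices: a
   barycentric form of one system of vertices vanishing at the barycentre of a
   facet of another one is a multiple of the form of that facet. *)
Lemma simplex_faceE a b S sigma : (0 < d)%N -> is_bary a b -> is_simplex a S ->
  simplex_face S sigma ->
  exists j, sigma = [set x | (forall i, 0 <= aev (b i) x) /\ aev (b j) x = 0].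
Proof.
move=> d0 ab aS [a' [i [aS' ->]]].
have [b' ab'] := bary_exists aS'.1.
have clS := closure_simplexE ab aS; have clS' := closure_simplexE ab' aS'.
have SE := simplexE ab aS; have SE' := simplexE ab' aS'.
have [b1' ba' bd'] := ab'.
pose w : R := d%:R^-1; have w0 : 0 < w by rewrite invr_gt0 ltr0n.
pose g : 'rV[R]_d := \sum_(j | j != i) w *: a' j.
have w1 : \sum_(j < d.+1 | j != i) w = 1.
  rewrite sumr_const cardC1 card_ord /= -mulr_natr mulVf// pnatr_eq0.
  by rewrite -lt0n.
have gi : aev (b' i) g = 0.
  rewrite aev_sum// big1// => j ji; rewrite bd' eq_sym (negbTE ji) mulr0//.
have gcl : closure S g.
  rewrite clS' => j /=; rewrite aev_sum// sumr_ge0// => l _.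
  by rewrite mulr_ge0 ?(ltW w0)// bd' ler0n.
have gS : ~ S g by rewrite SE' => /(_ i); rewrite gi ltxx.
have [j gj] : exists j, aev (b j) g = 0.
  apply: contrapT => h; apply: gS; rewrite SE => j /=.
  move: gcl; rewrite clS => /(_ j) /=; rewrite le_eqVlt => /orP[/eqP|//].
  by move=> E; case: h; exists j.
(* The value at [g] is an average, with positive weights, of nonnegative vertex values; being zero,
   it forces all of them to vanish. *)
have aj l : l != i -> aev (b j) (a' l) = 0.
  move=> li; have h0 m : 0 <= aev (b j) (a' m).
    have : closure S (a' m) by rewrite clS' => n /=; rewrite bd' ler0n.
    by rewrite clS => /(_ j).
  move: gj; rewrite aev_sum// => /eqP; rewrite psumr_eq0; last first.
    by move=> m _; rewrite mulr_ge0// ltW.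
  move=> /allP /(_ l); rewrite mem_index_enum li => /(_ isT).
  by rewrite mulf_eq0 gt_eqF//= => /eqP.
have bjE y : aev (b j) y = aev (b' i) y * aev (b j) (a' i).
  rewrite -{1}(ba' y) aev_sum// (bigD1 i)//= big1 ?addr0// => l li.
  by rewrite aj// mulr0.
have bji : aev (b j) (a' i) != 0.
  apply/eqP => h; case: ab => _ _ /(_ j j); rewrite bjE h mulr0 eqxx => /eqP.
  by rewrite eq_sym oner_eq0.
exists j; rewrite (hullE _ ab'); apply/seteqP; split => x /= [x0 xj].
  have : closure S x by rewrite clS'.
  rewrite clS => h; split => //.
  by rewrite bjE xj ?mul0r// !inE eqxx.
have : closure S x by rewrite clS.
rewrite clS' => h; split => // l; rewrite !inE negbK => /eqP ->.
by move/eqP: xj; rewrite bjE mulf_eq0 (negbTE bji) orbF => /eqP.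
Qed.

End barycentric.

(** * Points lying on one hyperplane at most, and the mesh near them *)

Section generic_points.
Context {R : realType} {d : nat}.
Variable Ls : seq ('rV[R]_d * R).
Implicit Types x y : 'rV[R]_d.

(** At most one hyperplane of the list passes through the point. Zero sets are compared and not
    forms, because one hyperplane may occur several times, as facet of two adjacent simplices and as
    equation of a face. *)
Definition generic x : Prop := forall l1 l2, l1 \in Ls -> l2 \in Ls ->
  aev l1 x = 0 -> aev l2 x = 0 -> forall y, aev l1 y = 0 -> aev l2 y = 0.

Definition close_to x y : Prop :=
  forall l, l \in Ls -> aev l x != 0 -> 0 < aev l y * aev l x.

Definition same_side y1 y2 : Prop :=
  forall l, l \in Ls -> 0 < aev l y1 * aev l y2.

Definition off_all y : Prop := forall l, l \in Ls -> aev l y != 0.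

Lemma same_side_sym y1 y2 : same_side y1 y2 -> same_side y2 y1.
Proof. by move=> h l lL; rewrite mulrC; exact: h. Qed.

Lemma same_side_off y1 y2 : same_side y1 y2 -> off_all y1.
Proof.
by move=> h l /h; apply: contraTneq => ->; rewrite mul0r ltxx.
Qed.

Lemma nbhs_close_to x : nbhs x (close_to x).
Proof.
rewrite /close_to; elim: Ls => [|l s IHs].
  by apply: filterS filterT => y _ l; rewrite in_nil.
have h : nbhs x [set y | aev l x != 0 -> 0 < aev l y * aev l x].
  have [lx0|lx0] := eqVneq (aev l x) 0.
    by apply: filterS filterT => y _.
  pose l' := (aev l x *: l.1, aev l x * l.2).
  have E y : aev l' y = aev l y * aev l x.
    by rewrite {1}/aev /l'/= dotC dotZr [dot y _]dotC -mulrDr mulrC.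
  have : nbhs x [set y | 0 < aev l' y].
    apply: open_nbhs_nbhs; split; first exact: open_aev_gt0.
    by rewrite /= E -expr2 lt_def sqrf_eq0 lx0 sqr_ge0.
  by apply: filterS => y /=; rewrite E.
apply: filterS2 IHs h => y h1 h2 l' ; rewrite inE => /orP[/eqP -> //|].
exact: h1.
Qed.

Lemma close_to_conv x y (t : R) : close_to x y -> 0 <= t <= 1 ->
  close_to x (x + t *: (y - x)).
Proof.
move=> xy /andP[t0 t1] l lL lx; rewrite aev_conv mulrDl -!mulrA.
have h1 : 0 < aev l x * aev l x by rewrite -expr2 lt_def sqrf_eq0 lx sqr_ge0.
have h2 := xy l lL lx.
have [->|tn0] := eqVneq t 0; first by rewrite subr0 mul1r mul0r addr0.
apply: ltr_wpDl; first by rewrite mulr_ge0 ?subr_ge0// ltW.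
by rewrite mulr_gt0// lt_def tn0.
Qed.

(** Near a generic point only the hyperplane of [l0] separates. Forms not vanishing at [x] keep
    their sign; a form vanishing at [x] with opposite signs at [y1] and [y2] would have a zero on
    the segment between them, and so would [l0], which has the same zeros but a constant sign
    there. *)
Lemma close_to_same_side x y1 y2 l0 : generic x ->
  close_to x y1 -> close_to x y2 -> l0 \in Ls -> aev l0 x = 0 ->
  0 < aev l0 y1 * aev l0 y2 -> same_side y1 y2.
Proof.
move=> gx xy1 xy2 l0L l0x h0 l lL.
have [lx|lx] := eqVneq (aev l x) 0; last first.
  have h1 := xy1 l lL lx; have h2 := xy2 l lL lx.
  have : 0 < (aev l y1 * aev l x) * (aev l y2 * aev l x) by rewrite mulr_gt0.
  by rewrite mulrACA pmulr_lgt0// -expr2 lt_def sqrf_eq0 lx sqr_ge0.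
rewrite ltNge; apply/negP => h.
have [t [t0 t1 tE]] : exists t : R, [/\ 0 <= t, t <= 1 &
    (1 - t) * aev l y1 + t * aev l y2 = 0].
  move: (aev l y1) (aev l y2) h => a b ab.
  have [a0|a0|a0] := ltgtP a 0.
  - have b0 : 0 <= b by rewrite -(nmulr_rle0 _ a0).
    have ba : 0 < b - a by rewrite subr_gt0 (lt_le_trans a0).
    exists (- a / (b - a)); split.
    + by rewrite divr_ge0 ?oppr_ge0 ?(ltW a0) ?(ltW ba).
    + by rewrite ler_pdivrMr// mul1r lerDr.
    + by field; rewrite gt_eqF.
  - have b0 : b <= 0 by rewrite -(pmulr_rle0 _ a0).
    have ba : 0 < a - b by rewrite subr_gt0 (le_lt_trans b0).
    exists (a / (a - b)); split.
    + by rewrite divr_ge0 ?(ltW a0) ?(ltW ba).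
    + by rewrite ler_pdivrMr// mul1r lerDl oppr_ge0.
    + by field; rewrite gt_eqF.
  - by exists 0; split => //; rewrite a0 mulr0 mul0r addr0.
have : aev l0 (y1 + t *: (y2 - y1)) = 0.
  by apply: (gx l l0) => //; rewrite aev_conv.
rewrite aev_conv => h1.
have h2 : aev l0 y1 * ((1 - t) * aev l0 y1 + t * aev l0 y2) = 0 by rewrite h1 mulr0.
have n1 : aev l0 y1 != 0 by apply: contraTneq h0 => ->; rewrite mul0r ltxx.
move: h2; rewrite mulrDr mulrCA [X in _ + X]mulrCA; apply/eqP; rewrite gt_eqF//.
have h3 : 0 < aev l0 y1 * aev l0 y1 by rewrite -expr2 lt_def sqrf_eq0 n1 sqr_ge0.
have [->|tn0] := eqVneq t 0; first by rewrite subr0 mul1r mul0r addr0.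
apply: ltr_wpDl; first by rewrite mulr_ge0 ?subr_ge0// ltW.
by rewrite mulr_gt0// lt_def tn0.
Qed.

(** Finitely many hyperplanes cannot cover an open set; they are avoided one after the other, by a
    small step along the normal. *)
Lemma off_point (O : set 'rV[R]_d) : (forall l, l \in Ls -> l.1 != 0) ->
  open O -> O !=set0 -> exists2 y, O y & off_all y.
Proof.
rewrite /off_all; elim: Ls O => [|l s IHs] O sn0 oO [y Oy].
  by exists y.
have [z Oz lz] : exists2 z, O z & aev l z != 0.
  have [ly|ly] := eqVneq (aev l y) 0; last by exists y.
  have [e e0 he] := nbhs_line l.1 (open_nbhs_nbhs (conj oO Oy)).
  exists (y + (e / 2) *: l.1).
    by apply: he; rewrite gtr0_norm ?divr_gt0//; lra.
  rewrite aevD ly add0r mulf_neq0 ?gt_eqF ?divr_gt0//.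
  have /rV0Pn[i li] : l.1 != 0 by apply: sn0; rewrite mem_head.
  rewrite /dot (bigD1 i)//= ltr_wpDr//; last by rewrite -expr2 lt_def sqrf_eq0 li sqr_ge0.
  by apply: sumr_ge0 => j _; rewrite -expr2 sqr_ge0.
have oO' : open (O `&` [set z | aev l z != 0]).
  apply: openI => //.
  rewrite (_ : [set _ | _] = aev l @^-1` [set t | t != 0])//.
  by apply: open_comp; [move=> x _; exact: continuous_aev|exact: open_neq].
have [||w [Ow lw] ws] := IHs _ _ oO'.
- by move=> l' l's; apply: sn0; rewrite inE l's orbT.
- by exists z.
exists w => // l'; rewrite inE => /orP[/eqP -> //|]; exact: ws.
Qed.

End generic_points.

(* [av S] and [bf S] are vertices and barycentric forms of the simplex [S],
   [ff F] is an equation of the hyperplane containing the face [F], and [Ls]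
   lists all these forms. *)
Section local_structure.
Context {R : realType} {n : nat}.
Variables (Omega : set 'rV[R]_n.+1) (M : mesh R n.+1) (Ss : set (set 'rV[R]_n.+1)).
Variables (av : set 'rV[R]_n.+1 -> 'I_n.+2 -> 'rV[R]_n.+1).
Variables (bf : set 'rV[R]_n.+1 -> 'I_n.+2 -> 'rV[R]_n.+1 * R).
Variables (ff : set 'rV[R]_n.+1 -> 'rV[R]_n.+1 * R).
Variable Ls : seq ('rV[R]_n.+1 * R).
Implicit Types (x y : 'rV[R]_n.+1) (S T F : set 'rV[R]_n.+1).

Record submesh_forms : Prop := SubmeshForms {
  sf_simplex : forall S, Ss S -> is_simplex (av S) S;
  sf_bary : forall S, Ss S -> is_bary (av S) (bf S);
  sf_face : forall F, faces M F -> range (chart M F) = [set x | aev (ff F) x = 0];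
  sf_bfL : forall S j, Ss S -> bf S j \in Ls;
  sf_ffL : forall F, faces M F -> ff F \in Ls;
  sf_neq0 : forall l, l \in Ls -> l.1 != 0 }.

Variable h : R.
Hypothesis hM : is_mesh Omega h M.
Hypothesis hS : simplicial_submesh Omega M Ss.
Hypothesis sf : submesh_forms.

Lemma element_open T : elements M T -> open T.
Proof. by move=> MT; case: hM => -[_ /(_ T MT)[_ []]]. Qed.

Lemma element_inj T1 T2 x : elements M T1 -> elements M T2 -> T1 x -> T2 x -> T1 = T2.
Proof.
move=> MT1 MT2 T1x T2x; case: hM => -[_ _ tT] _ _ _ _.
by apply: tT => //; exists x.
Qed.

Lemma simplex_def S : Ss S -> S = [set x | forall j, 0 < aev (bf S j) x].
Proof. by move=> SS; apply: simplexE (sf_bary sf SS) (sf_simplex sf SS). Qed.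

Lemma closure_simplex_def S : Ss S -> closure S = [set x | forall j, 0 <= aev (bf S j) x].
Proof. by move=> SS; apply: closure_simplexE (sf_bary sf SS) (sf_simplex sf SS). Qed.

Lemma simplex_off S y : Ss S -> off_all Ls y -> closure S y -> S y.
Proof.
move=> SS oy; rewrite (closure_simplex_def SS) [X in _ -> X y](simplex_def SS) /= => h0 j.
by rewrite lt_def h0 andbT; apply: oy; exact: (sf_bfL sf).
Qed.

Lemma same_side_simplex S y1 y2 : Ss S -> same_side Ls y1 y2 -> S y1 -> S y2.
Proof.
move=> SS y12; rewrite (simplex_def SS) /= => h0 j.
by rewrite -(pmulr_rgt0 _ (h0 j)); apply: y12; exact: (sf_bfL sf).
Qed.

Lemma closure_Omega_element T x : elements M T -> T x -> closure Omega x.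
Proof.
move=> MT Tx; case: hM => _ -> _ _ _; exists T => //; exact: subset_closure.
Qed.

Lemma closure_Omega_simplex x : closure Omega x -> exists2 S, Ss S & closure S x.
Proof. by case: hS => -[_ _ _ -> _] _ _ _ [S SS ?]; exists S. Qed.

Lemma simplex_element S : Ss S -> exists2 T, elements M T & S `<=` T.
Proof. by case: hS => _ h0 _ _ /h0[T [? ? _]]; exists T. Qed.

Lemma element_off T y : elements M T -> off_all Ls y -> T y ->
  exists S, [/\ Ss S, S `<=` T & S y].
Proof.
move=> MT oy Ty; have [S SS Sy] := closure_Omega_simplex (closure_Omega_element MT Ty).
have {}Sy := simplex_off SS oy Sy.
have [T' MT' ST'] := simplex_element SS.
exists S; split => //; rewrite (element_inj MT MT' Ty)//; exact: ST'.
Qed.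

(** The simplices tile the domain and each lies in one element, so away from the hyperplanes the
    signs of the forms determine the element, although elements are not themselves defined by
    forms. *)
Lemma same_side_element T y1 y2 : elements M T -> same_side Ls y1 y2 ->
  T y1 -> T y2.
Proof.
move=> MT y12 Ty1; have [S [SS ST Sy1]] := element_off MT (same_side_off y12) Ty1.
by apply: ST; apply: same_side_simplex Sy1.
Qed.

Lemma simplex_in_element S T x : Ss S -> elements M T -> S x -> T x -> S `<=` T.
Proof.
move=> SS MT Sx Tx; have [T' MT' ST'] := simplex_element SS.
by rewrite (element_inj MT MT' Tx)//; exact: ST'.
Qed.

(** The union of the closed simplices whose interiors lie in [T] is closed, these being finitely
    many, and it contains [T], hence its closure. *)
Lemma closure_element T x : elements M T -> closure T x ->
  exists S, [/\ Ss S, S `<=` T & closure S x].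
Proof.
move=> MT; have cl : closed [set y | exists S, [/\ Ss S, S `<=` T & closure S y]].
  rewrite (_ : [set _ | _] = \bigcup_(S in [set S | Ss S /\ S `<=` T]) closure S).
    apply: closed_bigcup => [|S _]; last exact: closed_closure.
    by apply: sub_finite_set (_ : _ `<=` Ss) _ => [S []//|]; case: hS => -[].
  by apply/seteqP; split => y [S]; [move=> [? ? ?]; exists S|move=> [? ?] ?; exists S].
suff /closureS sub : T `<=` [set y | exists S, [/\ Ss S, S `<=` T & closure S y]].
  by move=> /sub; rewrite -((closure_id _).1 cl).
move=> y Ty.
have [S SS Sy] := closure_Omega_simplex (closure_Omega_element MT Ty).
exists S; split => //.
have [z [Sz Tz]] : S `&` T !=set0.
  by apply: Sy; apply: open_nbhs_nbhs; split => //; exact: element_open.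
exact: simplex_in_element Tz.
Qed.

Lemma face_form F x : faces M F -> F x -> aev (ff F) x = 0.
Proof.
move=> MF Fx; case: hM => _ _ _ [_ /(_ F MF)[[_ FH] _ _ _ _] _ _] _.
by have := FH _ Fx; rewrite (sf_face sf MF).
Qed.

Lemma bdry_element_facet T x : elements M T -> bdry T x ->
  exists S j, [/\ Ss S, S `<=` T, closure S x & aev (bf S j) x = 0].
Proof.
move=> MT [Tcx Tix]; have [S [SS ST Sx]] := closure_element MT Tcx.
have Tx : ~ T x.
  by move=> Tx; apply: Tix; apply: open_nbhs_nbhs; split => //; exact: element_open.
suff [j j0] : exists j, aev (bf S j) x = 0 by exists S, j.
apply: contrapT => h0; apply: Tx; apply: ST; rewrite (simplex_def SS) => j.
move: Sx; rewrite (closure_simplex_def SS) => /(_ j) /=.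
by rewrite le_eqVlt => /orP[/eqP E|//]; case: h0; exists j.
Qed.

Lemma face_facet F x : faces M F -> F x -> exists S j,
  [/\ Ss S, [set y | (forall i, 0 <= aev (bf S i) y) /\ aev (bf S j) y = 0] `<=` F,
     (forall i, 0 <= aev (bf S i) x) & aev (bf S j) x = 0].
Proof.
move=> MF; case: hS => _ _ _ /(_ F MF)[E ES FE]; rewrite {1}FE => -[sigma Es sx].
have [S SS Ssigma] := ES _ Es.
have [//|j sE] := simplex_faceE _ (sf_bary sf SS) (sf_simplex sf SS) Ssigma.
exists S, j; move: sx; rewrite sE => -[h1 h2]; split => //.
by rewrite -sE FE; exact: bigcup_sup.
Qed.

(** Two forms of a simplex never have the same zero set: the vertex [av S i] is a zero of [bf S j]
    but not of [bf S i]. *)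
Lemma generic_facet S i j x : Ss S -> generic Ls x -> aev (bf S j) x = 0 ->
  i != j -> aev (bf S i) x != 0.
Proof.
move=> SS gx jx ij; apply/eqP => ix.
have := gx _ _ (sf_bfL sf j SS) (sf_bfL sf i SS) jx ix (av S i).
have [_ _ bd] := sf_bary sf SS; rewrite !bd eq_sym (negbTE ij) eqxx => /(_ erefl)/eqP.
by rewrite oner_eq0.
Qed.

(** Some facet contained in [F] passes through [x]; its other barycentric forms are positive at [x]
    and remain so nearby, so this facet alone fills a neighbourhood of [x] in the hyperplane. *)
Lemma face_relint F x : faces M F -> F x -> generic Ls x ->
  nbhs x [set y | aev (ff F) y = 0 -> F y].
Proof.
move=> MF Fx gx; have [S [j [SS SF x0 xj]]] := face_facet MF Fx.
apply: filterS (nbhs_close_to Ls x) => y xy yF.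
have yj : aev (bf S j) y = 0.
  by apply: (gx (ff F)) => //; [exact: (sf_ffL sf)|exact: (sf_bfL sf)|exact: face_form].
apply: SF; split => // i; have [->|ij] := eqVneq i j; first by rewrite yj.
have xi := generic_facet SS gx xj ij.
have xp : 0 < aev (bf S i) x by rewrite lt_def xi x0.
by have := xy _ (sf_bfL sf i SS) xi; rewrite pmulr_lgt0// => /ltW.
Qed.

Lemma nbhs_chart F (y : 'rV[R]_n) (B : set 'rV[R]_n.+1) :
  nbhs (chart M F y) B -> nbhs y (chart M F @^-1` B).
Proof.
move=> /nbhs_ballP[e /= e0 hB].
pose l i : 'rV[R]_n * R := ((col i (chart_frame M F))^T, chart_origin M F ord0 i).
have lE i z : aev (l i) z = chart M F z ord0 i.
  rewrite /aev /chart !mxE addrC /dot; congr (_ + _).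
  by apply: eq_bigr => j _; rewrite !mxE mulrC.
have : nbhs y [set z | forall i, `|aev (l i) y - aev (l i) z| < e].
  apply: (@filter_forall _ _ (fun i z => `|aev (l i) y - aev (l i) z| < e) (nbhs y)) => i.
  by have /cvgrPdist_lt := @continuous_aev _ _ (l i) y; exact.
apply: filterS => z /= hz; apply: hB; split => // i j.
by rewrite ord1 /ball/= -!lE; exact: hz.
Qed.

(** Generic points of a face are relative interior points, and relative interiors of distinct faces
    are disjoint. *)
Lemma generic_face_inj F1 F2 x : faces M F1 -> faces M F2 -> F1 x -> F2 x ->
  generic Ls x -> F1 = F2.
Proof.
move=> MF1 MF2 F1x F2x gx.
have ri F : faces M F -> F x -> relint M F x.
  move=> MF Fx; have := face_form MF Fx.
  rewrite -[aev _ x = 0]/([set z | aev (ff F) z = 0] x) -(sf_face sf MF) => -[y _ yx].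
  exists y => //; have := face_relint MF Fx gx; rewrite -yx => /nbhs_chart.
  apply: filterS => z; apply.
  by rewrite -[aev _ _ = 0]/([set z | aev (ff F) z = 0] (chart M F z)) -(sf_face sf MF); exists z.
case: hM => _ _ _ [_ _ _ tF] _; apply: tF => //.
by exists x; split; exact: ri.
Qed.

Section crossing.
Variables (x ym yp : 'rV[R]_n.+1) (l0 : 'rV[R]_n.+1 * R).
Hypotheses (gx : generic Ls x) (l0L : l0 \in Ls) (l0x : aev l0 x = 0).
Hypotheses (xym : close_to Ls x ym) (xyp : close_to Ls x yp).
Hypothesis mp : aev l0 ym * aev l0 yp < 0.

(** Between [x], excluded, and [y] no hyperplane is met, so [T] contains the segment entirely or not
    at all. *)
Lemma close_segment y T (t : R) : elements M T -> close_to Ls x y -> aev l0 y != 0 ->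
  0 < t -> t <= 1 -> T y <-> T (x + t *: (y - x)).
Proof.
move=> MT xy ly t0 t1.
have ss : same_side Ls y (x + t *: (y - x)).
  apply: (close_to_same_side gx xy _ l0L l0x).
    by apply: close_to_conv => //; rewrite (ltW t0).
  by rewrite aev_conv l0x mulr0 add0r mulrCA mulr_gt0// -expr2 lt_def sqrf_eq0 ly sqr_ge0.
by split; apply: same_side_element => //; exact: same_side_sym.
Qed.

Lemma close_closure y T : elements M T -> close_to Ls x y -> aev l0 y != 0 ->
  T y -> closure T x.
Proof.
move=> MT xy ly Ty B xB; have [e e0 he] := nbhs_line (y - x) xB.
pose t := Num.min (e / 2) 1.
have t0 : 0 < t by rewrite lt_min divr_gt0//=.
have te : t < e by rewrite gt_min; apply/orP; left; lra.
have t1 : t <= 1 by rewrite ge_min lexx orbT.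
exists (x + t *: (y - x)); split; last by apply: he; rewrite gtr0_norm.
exact/(close_segment MT xy ly t0 t1).
Qed.

Lemma close_mem y T : elements M T -> close_to Ls x y -> aev l0 y != 0 ->
  T x -> T y.
Proof.
move=> MT xy ly Tx.
have [e e0 he] := nbhs_line (y - x) (open_nbhs_nbhs (conj (element_open MT) Tx)).
pose t := Num.min (e / 2) 1.
have t0 : 0 < t by rewrite lt_min divr_gt0//=.
have te : t < e by rewrite gt_min; apply/orP; left; lra.
have t1 : t <= 1 by rewrite ge_min lexx orbT.
by apply/(close_segment MT xy ly t0 t1); apply: he; rewrite gtr0_norm.
Qed.

Let lm : aev l0 ym != 0.
Proof. by apply: contraTneq mp => ->; rewrite mul0r ltxx. Qed.

Let lp : aev l0 yp != 0.
Proof. by apply: contraTneq mp => ->; rewrite mulr0 ltxx. Qed.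

(** [T] reaches [x] from the side of [ym], so [x] is in its closure; and [x] in the open set [T]
    would bring points on the side of [yp] into [T], hence [yp] itself. *)
Lemma crossing_bdry T : elements M T -> T ym -> ~ T yp ->
  exists2 F, faces_of M T F & F x.
Proof.
move=> MT Tm Tp; have : bdry T x.
  split; first exact: close_closure Tm.
  by move=> /interior_subset Tx; apply: Tp; exact: close_mem Tx.
by case: hM => _ _ _ _ /(_ T MT) -> [F FT Fx]; exists F.
Qed.

(* If a face through [x] were an interface, its second element would, by
   genericity of [x], fill the side of [x] that meets no element. *)
Lemma crossing_exit T : elements M T -> T ym ->
  (forall T', elements M T' -> ~ T' yp) ->
  exists F, [/\ faces_of M T F, boundary_face Omega M F & F x].
Proof.
move=> MT Tm Np; have [F [MF FT] Fx] := crossing_bdry MT Tm (Np T MT).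
exists F; split => //.
have [_ _ _ [_ hF _ _] _] := hM; have [_ _ _ _ [|//]] := hF F MF.
move=> [T1 [T2 [MT1 MT2 T12 F12]]]; exfalso; apply: T12.
suff TE T' : elements M T' -> F `<=` bdry T' -> T' = T.
  by apply: (etrans (TE T1 MT1 _) (esym (TE T2 MT2 _))) => z /F12[].
move=> MT' /(_ _ Fx)[T'x _].
have [U [Uo Ux Uc]] : exists U, [/\ open U, U x & U `<=` close_to Ls x].
  exists (close_to Ls x)^°; split; first exact: open_interior.
    exact: nbhs_close_to.
  exact: interior_subset.
have [z [T'z Uz]] : T' `&` U !=set0.
  by apply: T'x; apply: open_nbhs_nbhs.
have [w [T'w Uw] ow] : exists2 w, (T' `&` U) w & off_all Ls w.
  apply: off_point; first exact: (sf_neq0 sf).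
    by apply: openI => //; exact: element_open.
  by exists z.
have lw := ow _ l0L; have xw := Uc _ Uw.
(* [w] lies in [T'], on one side of the only hyperplane through [x]. If this is the side of [ym],
   then [T'] contains [ym] and equals [T]; if it is that of [yp], then [T'] contains [yp], which is
   excluded. *)
have [wm|wm] := ltP 0 (aev l0 w * aev l0 ym).
  apply: (element_inj MT' MT _ Tm).
  by apply: same_side_element T'w => //; exact: (close_to_same_side gx xw xym l0L l0x).
exfalso; apply: (Np T' MT'); apply: same_side_element T'w => //.
apply: (close_to_same_side gx xw xyp l0L l0x).
have {}wm : aev l0 w * aev l0 ym < 0 by rewrite lt_neqAle wm mulf_neq0.
have : 0 < (aev l0 w * aev l0 ym) * (aev l0 ym * aev l0 yp) by rewrite nmulr_rgt0.
rewrite mulrA -[_ * aev l0 ym * aev l0 ym]mulrA mulrAC pmulr_lgt0//.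
by rewrite -expr2 lt_def sqrf_eq0 lm sqr_ge0.
Qed.

End crossing.
End local_structure.

(** * Variation along coordinate lines *)

Section piecewise_polynomials.
Context {R : realType}.

Lemma seq_max_exists (s : seq R) : s != [::] ->
  exists2 m, m \in s & forall x, x \in s -> x <= m.
Proof.
elim: s => [//|a s IHs] _; have [->|s0] := eqVneq s [::].
  by exists a; rewrite ?mem_head// => x; rewrite inE => /eqP ->.
have [m ms mP] := IHs s0; have [am|ma] := leP a m.
  exists m; first by rewrite inE ms orbT.
  by move=> x; rewrite inE => /orP[/eqP -> //|]; exact: mP.
exists a; first exact: mem_head.
move=> x; rewrite inE => /orP[/eqP -> //|/mP xm].
by rewrite (le_trans xm)// ltW.
Qed.

(** [P x] is the polynomial representing the function near [x], [D] lists the possible breakpoints,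
    [E] dominates the derivative of the signed power and [J s] its jump at [s]. Working with [P]
    gives one-sided values at a breakpoint without taking limits. *)
Variables (a : R) (D : seq R) (P : R -> {poly R}) (E : R -> \bar R) (J : R -> R).
Hypotheses (a1 : 1 <= a) (uD : uniq D).
Hypothesis P_const : forall x y, x <= y -> (forall s, s \in D -> ~~ (x <= s <= y)) ->
  P x = P y.
Hypothesis P_far : exists K, forall x, x < K -> P x = 0.
Hypotheses (mE : measurable_fun setT E) (E0 : forall x, (0 <= E x)%E).
Hypothesis PE : forall x, x \notin D ->
  ((a * `|(P x).[x]| `^ (a - 1) * `|(P x)^`().[x]|)%:E <= E x)%E.
Hypothesis J0 : forall s, 0 <= J s.
Hypothesis PJ : forall s x y, s \in D -> x < s -> s < y ->
  (forall s', s' \in D -> x <= s' <= y -> s' = s) ->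
  `|spow a (P x).[s] - spow a (P y).[s]| <= J s.

Let prev_point (t : R) : exists2 u, u < t & forall s, s \in D -> ~~ (u <= s < t).
Proof.
have [D0|D0] := eqVneq [seq s <- D | s < t] [::].
  exists (t - 1); first by rewrite ltrBlDr ltrDl.
  move=> s sD; apply/negP => /andP[_ st].
  have : s \in [seq s <- D | s < t] by rewrite mem_filter st.
  by rewrite D0 in_nil.
have [m] := seq_max_exists D0; rewrite mem_filter => /andP[mt mD] mP.
exists ((m + t) / 2); first by lra.
move=> s sD; apply/negP => /andP[us st].
have : s <= m by apply: mP; rewrite mem_filter st.
by lra.
Qed.

Let spow0 : spow a 0 = 0.
Proof. by rewrite /spow mul0r. Qed.

Lemma measurable_spow_deriv (p : {poly R}) : measurable_fun [set: R]
  (fun t => a * `|p.[t]| `^ (a - 1) * `|p^`().[t]|).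
Proof.
have cp (q : {poly R}) : continuous (horner q).
  move=> t; apply/differentiable_continuous/derivable1_diffP.
  exact: derivable_horner.
apply: continuous_measurable_fun => t; apply: cvgM.
  apply: cvgM; first exact: cvg_cst.
  apply: (@continuous_comp _ _ _ (horner p) (fun u : R => `|u| `^ (a - 1))).
    exact: cp.
  by apply: continuous_norm_powR; rewrite subr_ge0.
apply: (@continuous_comp _ _ _ (horner p^`()) (fun u : R => `|u|)).
  exact: cp.
exact: norm_continuous.
Qed.

(** [A] is [[x, y]] without the end points at which a break may occur: [E] dominates the derivative
    only off [D], while the integral over [[x, y]] ignores end points. *)
Let piece_bound (x y z : R) (A : set R) : x <= y ->
  measurable (A : set (measurableTypeR R)) -> A `<=` `[x, y] ->
  (\int[lebesgue_measure]_(t in `[x, y]) (a * `|(P z).[t]| `^ (a - 1) * `|(P z)^`().[t]|)%:E =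
   \int[lebesgue_measure]_(t in A) (a * `|(P z).[t]| `^ (a - 1) * `|(P z)^`().[t]|)%:E)%E ->
  (forall t, A t -> t \notin D /\ P t = P z) ->
  (`|spow a (P z).[y] - spow a (P z).[x]|%:E <= \int[lebesgue_measure]_(t in A) E t)%E.
Proof.
move=> xy mA Axy AE AP.
apply: le_trans (ftc_spow _ a1 xy) _; rewrite AE.
apply: ge0_le_integral => //.
- move=> t _; rewrite lee_fin !mulr_ge0 ?powR_ge0//; exact: le_trans a1.
- apply/measurable_EFinP; apply: measurable_funTS; exact: measurable_spow_deriv.
- exact: measurable_funTS.
by move=> t At; have [tD <-] := AP t At; exact: PE.
Qed.

Let four_points (b c d e j : R) : `|c - d| <= j ->
  `|b| <= `|b - c| + (j + (`|d - e| + `|e|)).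
Proof.
move=> cd; rewrite -{1}(subrK c b); apply: (le_trans (ler_normD _ _)).
rewrite lerD2l -{1}(subrK d c); apply: (le_trans (ler_normD _ _)); apply: lerD => //.
by rewrite -{1}(subrK e d) ler_normD.
Qed.

Let sum_rearrange (b c d e f : \bar R) :
  (b + (c + (d + (e + f))) = e + d + b + (c + f))%E.
Proof.
by rewrite addeCA [RHS]addeCA; congr (_ + _)%E; rewrite !addeA; congr (_ + _)%E;
  rewrite addeC -[RHS]addeA; congr (_ + _)%E; rewrite addeC.
Qed.

(** Induction on the number of breakpoints to the left of [u]. The last of them, [s0], is crossed to
    a point [u1], which costs [J s0] and the integrals of [E] over []u1, s0[] and []s0, u]]; once no
    breakpoint is left, the function is zero. *)
Lemma piecewise_bound (t : R) : t \notin D ->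
  (`|spow a (P t).[t]|%:E <=
   \int[lebesgue_measure]_x E x + (\sum_(s <- D) J s)%:E)%E.
Proof.
move=> tD; suff H m (u : R) : (count (< u) D <= m)%N -> u \notin D ->
    (`|spow a (P u).[u]|%:E <= \int[lebesgue_measure]_(x in `]-oo, u]) E x +
      (\sum_(s <- D | s < u) J s)%:E)%E.
  apply: le_trans (H _ t (leqnn _) tD) _; apply: leeD.
    exact: ge0_subset_integral.
  rewrite lee_fin [leRHS](bigID (fun s => s < t))/= lerDl.
  by apply: sumr_ge0 => s _; exact: J0.
(* To the left of all breakpoints the polynomial is the one found far away, which is zero by
   [P_far]. *)
have below0 v : v \notin D -> [seq s <- D | s < v] = [::] -> P v = 0.
  move=> vD v0; have [K PK] := P_far.
  rewrite -(P_const (x := Num.min v K - 1)); first by apply: PK; rewrite ltrBlDr gt_min ltrDl ltr01 orbT.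
    by rewrite lerBlDr ge_min lerDl ler01.
  move=> s sD; apply/negP => /andP[_]; rewrite le_eqVlt => /orP[/eqP sv|sv].
    by rewrite -sv sD in vD.
  have : s \in [seq s <- D | s < v] by rewrite mem_filter sv.
  by rewrite v0 in_nil.
have pos0 v : (0 <= \int[lebesgue_measure]_(x in `]-oo, v]) E x +
      (\sum_(s <- D | (s < v)%R) J s)%R%:E)%E.
  apply: adde_ge0; first exact: integral_ge0.
  by rewrite lee_fin sumr_ge0.
elim: m u => [|m IHm] u um uD'.
  rewrite below0//; first by rewrite horner0 spow0 normr0.
  by apply: size0nil; rewrite size_filter; apply/eqP; rewrite -leqn0.
have [D0|D0] := eqVneq [seq s <- D | s < u] [::].
  by rewrite below0// horner0 spow0 normr0.
have [s0] := seq_max_exists D0; rewrite mem_filter => /andP[s0u s0D] s0P.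
have {}s0P s : s \in D -> s < u -> s <= s0.
  by move=> sD su; apply: s0P; rewrite mem_filter su.
(* [u1] lies between [s0] and the preceding breakpoint, if any, so fewer breakpoints lie to its left
   than to the left of [u]. *)
have [u1 u1s0 u1P] := prev_point s0.
have u1D : u1 \notin D by apply/negP => /u1P; rewrite lexx u1s0.
have cu1 : (count (< u1) D <= m)%N.
  rewrite -ltnS; apply: leq_trans um.
  rewrite -[X in (X < _)%N]size_filter -[X in (_ < X)%N]size_filter.
  apply: (@leq_trans (size (s0 :: [seq s <- D | s < u1]))) => //.
  apply: uniq_leq_size.
    by rewrite /= filter_uniq// andbT mem_filter ltNge (ltW u1s0).
  move=> s; rewrite inE !mem_filter => /orP[/eqP ->|/andP[su1 ->]]; first exact/andP.
  by rewrite andbT; exact: lt_trans (lt_trans su1 u1s0) s0u.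
have IH := IHm u1 cu1 u1D.
have P1 t0 : s0 < t0 <= u -> t0 \notin D /\ P t0 = P u.
  move=> /andP[st tu]; have h s : s \in D -> ~~ (t0 <= s <= u).
    move=> sD; apply/negP => /andP[ts]; rewrite le_eqVlt => /orP[/eqP E1|su].
      by rewrite -E1 sD in uD'.
    by have := s0P s sD su; rewrite leNgt (lt_le_trans st ts).
  split; last exact: P_const.
  by apply/negP => /h; rewrite lexx tu.
have P2 t0 : u1 <= t0 < s0 -> t0 \notin D /\ P t0 = P u1.
  move=> /andP[st tu]; split.
    by apply/negP => /u1P; rewrite st tu.
  symmetry; apply: P_const => // s /u1P; apply: contra => /andP[-> st0] /=.
  exact: le_lt_trans tu.
have B1 : (`|spow a (P u).[u] - spow a (P u).[s0]|%:E <=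
    \int[lebesgue_measure]_(t in `]s0, u]) E t)%E.
  apply: piece_bound => //; first exact: ltW.
  - by move=> t0 /=; rewrite !in_itv/= => /andP[/ltW -> ->].
  - rewrite integral_itv_obnd_cbnd//; apply/measurable_EFinP; apply: measurable_funTS.
    exact: measurable_spow_deriv.
have B2 : (`|spow a (P u1).[s0] - spow a (P u1).[u1]|%:E <=
    \int[lebesgue_measure]_(t in `]u1, s0[) E t)%E.
  apply: piece_bound => //; first exact: ltW.
  - by move=> t0 /=; rewrite !in_itv/= => /andP[/ltW -> /ltW ->].
  - rewrite -(@integral_itv_bndoo _ _ _ _ true false)//; apply/measurable_EFinP; apply: measurable_funTS.
    exact: measurable_spow_deriv.
  - by move=> t0 /=; rewrite in_itv/= => /andP[/ltW h1 h2]; apply: P2; rewrite h1.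
have B3 : `|spow a (P u).[s0] - spow a (P u1).[s0]| <= J s0.
  rewrite distrC; apply: PJ => // s sD /andP[us su].
  have su' : s < u by rewrite lt_neqAle su andbT; apply: contraNneq uD' => <-.
  apply/eqP; rewrite eq_le s0P//= leNgt; apply/negP => ss.
  by have := u1P s sD; rewrite us ss.
have T1 : `|spow a (P u).[u]| <= `|spow a (P u).[u] - spow a (P u).[s0]| +
    (J s0 + (`|spow a (P u1).[s0] - spow a (P u1).[u1]| + `|spow a (P u1).[u1]|)).
  exact: four_points.
apply: (@le_trans _ _ (_ + (_ + (_ + _)))%:E); first by rewrite lee_fin; exact: T1.
rewrite !EFinD.
apply: (@le_trans _ _ (\int[lebesgue_measure]_(t in `]s0, u]) E t + ((J s0)%:E +
  (\int[lebesgue_measure]_(t in `]u1, s0[) E t + (\int[lebesgue_measure]_(x in `]-oo, u1]) E x +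
      (\sum_(s <- D | (s < u1)%R) J s)%R%:E))))%E).
  by do !apply: leeD.
have -> : (\int[lebesgue_measure]_(t in `]s0, u]) E t + ((J s0)%:E +
  (\int[lebesgue_measure]_(t in `]u1, s0[) E t + (\int[lebesgue_measure]_(x in `]-oo, u1]) E x +
      (\sum_(s <- D | (s < u1)%R) J s)%R%:E)))%E = 
  (\int[lebesgue_measure]_(x in `]-oo, u1]) E x + \int[lebesgue_measure]_(t in `]u1, s0[) E t) + \int[lebesgue_measure]_(t in `]s0, u]) E t + ((J s0)%:E + (\sum_(s <- D | (s < u1)%R) J s)%R%:E))%E.
  exact: sum_rearrange.
apply: leeD.
  rewrite -ge0_integral_setU//.
  - rewrite -ge0_integral_setU//.
    + apply: ge0_subset_integral => //.
        apply: measurableU => //; exact: measurableU.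
      by apply: measurable_funTS.
      by move=> t0; rewrite /= !in_itv/= => -[[|]|]; lra.
    + exact: measurableU.
    + by apply: measurable_funTS.
    + apply/disj_setPS => t0 []; rewrite /= !in_itv/= => -[|]; lra.
  - by apply: measurable_funTS.
  - apply/disj_setPS => t0 []; rewrite /= !in_itv/=; lra.
rewrite -EFinD lee_fin [leRHS]big_mkcond [leRHS](bigD1_seq s0)//= s0u lerD2l.
rewrite big_mkcond [leRHS]big_mkcond/=; apply: ler_sum => s _.
case: ifPn => [su1|_].
  have ss0 := lt_trans su1 u1s0.
  by rewrite lt_eqF// (lt_trans ss0 s0u).
by case: ifP => // _; case: ifP.
Qed.

End piecewise_polynomials.

Definition enum_set (T : choiceType) (A : set T) : seq T :=
  finmap.enum_fset (fset_set A).

Lemma mem_enum_set (T : choiceType) (A : set T) (x : T) : finite_set A ->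
  (x \in enum_set A) = (x \in A).
Proof. by move=> fA; rewrite /enum_set in_fset_set. Qed.

Lemma enum_set_uniq (T : choiceType) (A : set T) : uniq (enum_set A).
Proof. exact: finmap.fset_uniq. Qed.

(** * One coordinate direction: exceptional lines and the faces crossed by the others *)

Section coordinate_lines.
Context {R : realType} {n : nat}.
Variables (Omega : set 'rV[R]_n.+1) (M : mesh R n.+1) (Ss : set (set 'rV[R]_n.+1)).
Variables (av : set 'rV[R]_n.+1 -> 'I_n.+2 -> 'rV[R]_n.+1).
Variables (bf : set 'rV[R]_n.+1 -> 'I_n.+2 -> 'rV[R]_n.+1 * R).
Variables (ff : set 'rV[R]_n.+1 -> 'rV[R]_n.+1 * R).
Variable Ls : seq ('rV[R]_n.+1 * R).
Variable h : R.
Hypothesis hM : is_mesh Omega h M.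
Hypothesis hS : simplicial_submesh Omega M Ss.
Hypothesis sf : submesh_forms M Ss av bf ff Ls.
Variables (v : dofs R n.+1) (i : 'I_n.+1).
Implicit Types (x : 'rV[R]_n.+1) (y : 'rV[R]_n) (S T F : set 'rV[R]_n.+1).

(** The first clause excludes lines contained in a hyperplane parallel to them, the second those
    meeting two different hyperplanes at one point. *)
Definition good_line y : Prop :=
  (forall l, l \in Ls -> l.1 ord0 i = 0 -> aev l (ins i 0 y) != 0) /\
  forall s, generic Ls (ins i s y).

Lemma aev_ins (l : 'rV[R]_n.+1 * R) (s : R) y :
  aev l (ins i s y) = aev l (ins i 0 y) + s * l.1 ord0 i.
Proof. by rewrite /aev !dot_ins mulr0 add0r; ring. Qed.

Definition col'_form (l : 'rV[R]_n.+1 * R) : 'rV[R]_n * R := (col' i l.1, l.2).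

Lemma col'_formE (l : 'rV[R]_n.+1 * R) s y : l.1 ord0 i = 0 -> aev l (ins i s y) = aev (col'_form l) y.
Proof. by move=> l0; rewrite /aev dot_ins l0 mul0r add0r. Qed.

(* [cross_form l1 l2] is the combination of [l1] and [l2] that is constant in the
   direction [i]: if both vanish at a point of a line in this direction, it
   vanishes on the whole line. *)
Definition cross_form (l1 l2 : 'rV[R]_n.+1 * R) : 'rV[R]_n.+1 * R :=
  (l2.1 ord0 i *: l1.1 - l1.1 ord0 i *: l2.1, l2.1 ord0 i * l1.2 - l1.1 ord0 i * l2.2).

Lemma cross_formE l1 l2 x :
  aev (cross_form l1 l2) x = l2.1 ord0 i * aev l1 x - l1.1 ord0 i * aev l2 x.
Proof.
rewrite /aev/= dotC dotDr dotNr !dotZr ![dot x _]dotC; ring.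
Qed.

(** Forms in the transversal coordinates whose zero sets contain all exceptional lines. Those with
    zero linear part are dropped, since they define no hyperplane: [cross_form l1 l2] is zero when
    [l1] and [l2] are proportional. *)
Definition bad_forms : seq ('rV[R]_n * R) :=
  [seq m <- [seq col'_form l | l <- Ls] ++
            [seq col'_form (cross_form l1 l2) | l1 <- Ls, l2 <- Ls] | m.1 != 0].

Lemma col'_eq0 (m : 'rV[R]_n.+1) : m ord0 i = 0 -> col' i m = 0 -> m = 0.
Proof.
move=> mi mc; apply/rowP => j; rewrite mxE; have [k ->|->//] := unliftP i j.
by have /rowP/(_ k) := mc; rewrite !mxE.
Qed.

Lemma good_lineP y : (forall m, m \in bad_forms -> aev m y != 0) -> good_line y.
Proof.
move=> hy; split=> [l lL li|s l1 l2 l1L l2L h1 h2 z z1].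
  rewrite col'_formE//; apply: hy; rewrite mem_filter mem_cat map_f// andbT/=.
  by apply: contra (sf_neq0 sf lL) => /eqP c0; apply/eqP; exact: col'_eq0.
have tr l : l \in Ls -> aev l (ins i s y) = 0 -> l.1 ord0 i != 0.
  move=> lL ly; apply/eqP => li; have := hy (col'_form l).
  rewrite -(col'_formE s)// ly eqxx => H; suff /H : col'_form l \in bad_forms by [].
  rewrite mem_filter mem_cat map_f// andbT/=.
  by apply: contra (sf_neq0 sf lL) => /eqP c0; apply/eqP; exact: col'_eq0.
have mi : (cross_form l1 l2).1 ord0 i = 0 by rewrite !mxE mulrC subrr.
have my : aev (cross_form l1 l2) (ins i s y) = 0 by rewrite cross_formE h1 h2 !mulr0 subrr.
(* Otherwise the cross form, which vanishes at [y], would give a bad form. So it is constant, and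
   zero because it vanishes at one point: [l1] and [l2] are proportional. *)
have m0 : (cross_form l1 l2).1 = 0.
  apply: col'_eq0 => //; apply/eqP; apply: contraTT isT => m0.
  have := hy (col'_form (cross_form l1 l2)).
  rewrite -(col'_formE s)// my eqxx => H.
  suff /H : col'_form (cross_form l1 l2) \in bad_forms by [].
  by rewrite mem_filter m0 mem_cat allpairs_f// orbT.
have mz : aev (cross_form l1 l2) z = 0.
  by move: my; rewrite /aev m0 ![dot 0 _]dotC !dot0r.
move: mz; rewrite cross_formE z1 mulr0 sub0r => /eqP.
by rewrite oppr_eq0 mulf_eq0 (negbTE (tr _ l1L h1))/= => /eqP.
Qed.

Lemma bad_forms_neq0 m : m \in bad_forms -> m.1 != 0.
Proof. by rewrite mem_filter => /andP[]. Qed.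

Definition chart_minor F : 'M[R]_n := col' i (chart_frame M F).

(** Chart coordinates of the point where the line over [y] meets the hyperplane of [F]: dropping the
    coordinate [i] of the chart leaves a square linear system. *)
Definition chart_coord F y : 'rV[R]_n :=
  (y - col' i (chart_origin M F)) *m invmx (chart_minor F).

Lemma col'_chart F (z : 'rV[R]_n) :
  col' i (chart M F z) = col' i (chart_origin M F) + z *m chart_minor F.
Proof.
apply/rowP => k; rewrite !mxE; congr (_ + _).
by apply: eq_bigr => j _; rewrite mxE.
Qed.

Lemma frame_orthonormal F : faces M F ->
  chart_frame M F *m (chart_frame M F)^T = 1%:M.
Proof. by case: hM => _ _ _ [_ _ + _] _; exact. Qed.

(** A row [u] killed by the minor gives a tangent vector of the hyperplane that is a multiple of the
    unit vector [i]. As the normal has a nonzero component [i], this vector is zero, and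
    orthonormality of the frame yields [u = 0]. *)
Lemma chart_minor_unit F : faces M F -> (ff F).1 ord0 i != 0 ->
  chart_minor F \in unitmx.
Proof.
move=> MF fi; rewrite -row_free_unit -kermx_eq0; apply/rowV0P => u.
move=> /sub_kermxP uB; pose w : 'rV[R]_n.+1 := u *m chart_frame M F.
have wc : col' i w = 0.
  rewrite -uB; apply/rowP => k; rewrite !mxE; apply: eq_bigr => j _.
  by rewrite mxE.
have w_e : w = w ord0 i *: delta_mx ord0 i.
  move: (w) wc => w' wc'; apply/rowP => j; rewrite !mxE eqxx/=.
  have [k ->|->] := unliftP i j; last by rewrite eqxx mulr1.
  rewrite eq_sym (negbTE (neq_lift _ _)) mulr0.
  by have /rowP/(_ k) := wc'; rewrite !mxE.
have fE z : aev (ff F) (chart M F z) = 0.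
  have : range (chart M F) (chart M F z) by exists z.
  by rewrite (sf_face sf MF).
have w0 : dot (ff F).1 w = 0.
  have := fE u; have := fE 0; rewrite /chart mul0mx addr0 -/w.
  by rewrite -[w]scale1r aevD => ->; rewrite add0r mul1r scale1r.
have wi : w ord0 i = 0.
  apply/eqP; move: w0; rewrite {1}w_e dotZr => /eqP.
  rewrite mulf_eq0 => /orP[//|]; rewrite /dot (bigD1 i)//= big1 => [|j ji].
    by rewrite mxE !eqxx mulr1 addr0 (negbTE fi).
  by rewrite mxE (negbTE ji) andbF mulr0.
have : u *m (chart_frame M F *m (chart_frame M F)^T) = 0.
  by rewrite mulmxA -/w w_e wi scale0r mul0mx.
by rewrite frame_orthonormal// mulmx1.
Qed.

Lemma chart_coordE F s y : faces M F -> (ff F).1 ord0 i != 0 -> F (ins i s y) ->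
  chart M F (chart_coord F y) = ins i s y.
Proof.
move=> MF fi Fx; have := face_form hM sf MF Fx.
rewrite -[aev _ _ = 0]/([set x | aev (ff F) x = 0] (ins i s y)) -(sf_face sf MF).
move=> -[z _ zE]; rewrite -zE; congr (chart M F _).
rewrite /chart_coord -(col'_ins i s y) -zE col'_chart addrC addKr.
by rewrite mulmxK// chart_minor_unit.
Qed.

(** The entries of an orthonormal frame are at most 1 in absolute value, so each of the [n!] terms
    of the Leibniz formula is at most 1. *)
Lemma chart_minor_det F : faces M F -> `|\det (chart_minor F)| <= n`!%:R.
Proof.
move=> MF; have entry j k : `|chart_minor F j k| <= 1.
  rewrite mxE; set A := chart_frame M F.
  have : \sum_l A j l ^+ 2 = 1.
    have /matrixP/(_ j j) := frame_orthonormal MF; rewrite !mxE eqxx/= mulr1n => <-.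
    by apply: eq_bigr => l _; rewrite mxE expr2.
  rewrite (bigD1 (lift i k))//= => H.
  rewrite -[leRHS](@ger0_norm _ 1)// -ler_sqr ?nnegrE//.
  rewrite -[`|_| ^+ 2]normrX -[`|1| ^+2]normrX expr1n normr1 ger0_norm ?sqr_ge0//.
  by rewrite -H lerDl sumr_ge0// => l _; exact: sqr_ge0.
apply: (le_trans (ler_norm_sum _ _ _)).
apply: (@le_trans _ _ (\sum_(s : 'S_n) 1)); last first.
  by rewrite sumr_const card_Sn.
apply: ler_sum => s _; rewrite normrM normrX normrN1 expr1n mul1r normr_prod.
suff /andP[] : 0 <= \prod_j `|chart_minor F j (s j)| <= 1 by [].
elim/big_ind: _ => [|x z /andP[x0 x1] /andP[z0 z1]|j _].
- by rewrite ler01 lexx.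
- by rewrite mulr_ge0//= mulr_ile1.
- by rewrite normr_ge0 entry.
Qed.

(** A polynomial attached to the point, and not a value, so that it can be evaluated at a crossing
    approached from either side. The value 0 outside all elements realises the extension of [v_h] by
    zero. *)
Definition vpoly x : mpoly.mpoly n.+1 R :=
  if pselect (exists T, elements M T /\ T x)
  then vT v (xget set0 [set T | elements M T /\ T x]) else 0.

Lemma vpolyE T x : elements M T -> T x -> vpoly x = vT v T.
Proof.
move=> MT Tx; rewrite /vpoly; case: pselect => [E|[]]; last by exists T.
case: xgetP => [T' _ [MT' T'x]|/(_ T) []//].
by rewrite (element_inj hM MT MT' Tx T'x).
Qed.

Lemma vpoly0 x : (forall T, elements M T -> ~ T x) -> vpoly x = 0.
Proof.
by rewrite /vpoly => hx; case: pselect => // -[T [MT Tx]]; case: (hx T MT Tx).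
Qed.

Lemma vpoly_eq x1 x2 : (forall T, elements M T -> (T x1 <-> T x2)) ->
  vpoly x1 = vpoly x2.
Proof.
move=> h12; have [[T [MT Tx]]|hx] := pselect (exists T, elements M T /\ T x1).
  by rewrite (vpolyE MT Tx) (vpolyE MT ((h12 T MT).1 Tx)).
rewrite !vpoly0// => T MT Tx; apply: hx; exists T; split => //.
exact/(h12 T MT).
Qed.

Lemma finite_elements : finite_set (elements M).
Proof. by case: hM => -[]. Qed.

Lemma finite_faces_of T : finite_set (faces_of M T).
Proof.
apply: (sub_finite_set (B := faces M)); first by move=> F [].
by case: hM => _ _ _ [].
Qed.

Lemma vhE x : vh M v x = peval (vpoly x) x.
Proof.
rewrite /vh fsbig_finite; last exact: finite_elements.
rewrite -/(enum_set _).
have [[T [MT Tx]]|hx] := pselect (exists T, elements M T /\ T x).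
  rewrite (vpolyE MT Tx) (bigD1_seq T)//=.
  - rewrite patchE mem_set// big1_seq ?addr0// => T' /andP[T'T].
    rewrite mem_enum_set; last exact: finite_elements.
    rewrite inE => MT'; rewrite patchE memNset// => T'x.
    by move: T'T; rewrite (element_inj hM MT' MT T'x Tx) eqxx.
  - by rewrite mem_enum_set ?inE//; exact: finite_elements.
  - exact: enum_set_uniq.
rewrite vpoly0; last by move=> T MT Tx; apply: hx; exists T.
rewrite /peval mpoly.meval0 big1_seq// => T /andP[_].
rewrite mem_enum_set ?inE; last exact: finite_elements.
by move=> MT; rewrite patchE memNset// => Tx; apply: hx; exists T.
Qed.

Definition crossings y : seq R :=
  undup [seq - aev l (ins i 0 y) / l.1 ord0 i | l : 'rV[R]_n.+1 * R <- Ls & l.1 ord0 i != 0].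

Lemma crossingsP y s : reflect (exists l : 'rV[R]_n.+1 * R, [/\ l \in Ls, l.1 ord0 i != 0 &
  aev l (ins i s y) = 0]) (s \in crossings y).
Proof.
rewrite mem_undup; apply: (iffP mapP) => [[l]|[l [lL li ls]]].
  rewrite mem_filter => /andP[li lL] ->; exists l; split => //.
  by rewrite aev_ins divfK// subrr.
exists l; first by rewrite mem_filter li.
apply: (mulIf li); rewrite divfK//; apply/eqP; rewrite -addr_eq0 addrC.
by rewrite -aev_ins ls.
Qed.

Definition face_hit F s y : R :=
  (`[< (ff F).1 ord0 i != 0 /\ F (ins i s y) >])%:R.

Section good.
Variables (y : 'rV[R]_n) (a : R).
Hypotheses (gy : good_line y) (a1 : 1 <= a).

Lemma off_crossings t : t \notin crossings y -> off_all Ls (ins i t y).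
Proof.
move=> tD l lL; have [li|li] := eqVneq (l.1 ord0 i) 0.
  by have := gy.1 l lL li; rewrite !col'_formE.
by apply: contra tD => /eqP l0; apply/crossingsP; exists l.
Qed.

Lemma same_side_line (x z : R) : x <= z ->
  (forall s, s \in crossings y -> ~~ (x <= s <= z)) ->
  same_side Ls (ins i x y) (ins i z y).
Proof.
move=> xz hxz l lL; rewrite ltNge; apply/negP => le0.
have [li|li] := eqVneq (l.1 ord0 i) 0.
  move: le0; rewrite !(col'_formE _ _ li) -expr2 le_eqVlt ltNge sqr_ge0 orbF.
  by rewrite sqrf_eq0; apply/negP; have := gy.1 l lL li; rewrite col'_formE.
pose s := - aev l (ins i 0 y) / l.1 ord0 i.
have sE t : aev l (ins i t y) = (t - s) * l.1 ord0 i.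
  by rewrite aev_ins /s mulrBl divfK// opprK addrC.
have sD : s \in crossings y.
  by apply/crossingsP; exists l; split => //; rewrite sE subrr mul0r.
have /negP := hxz s sD; apply.
move: le0; rewrite !sE mulrACA -expr2 pmulr_lle0; last first.
  by rewrite lt_def sqrf_eq0 li sqr_ge0.
move=> H; apply/andP; split; nra.
Qed.

Lemma close_to_line (s x : R) : (forall s', s' \in crossings y ->
    Num.min x s <= s' <= Num.max x s -> s' = s) ->
  close_to Ls (ins i s y) (ins i x y).
Proof.
move=> hx l lL ls; rewrite ltNge; apply/negP => le0.
have [li|li] := eqVneq (l.1 ord0 i) 0.
  move: le0 ls; rewrite !(col'_formE _ _ li) -expr2 le_eqVlt ltNge sqr_ge0 orbF.
  by rewrite sqrf_eq0 => ->.
pose s0 := - aev l (ins i 0 y) / l.1 ord0 i.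
have sE t : aev l (ins i t y) = (t - s0) * l.1 ord0 i.
  by rewrite aev_ins /s0 mulrBl divfK// opprK addrC.
have sD : s0 \in crossings y.
  by apply/crossingsP; exists l; split => //; rewrite sE subrr mul0r.
suff ss : s0 = s by move: ls; rewrite sE ss subrr mul0r eqxx.
apply: hx => //; move: le0; rewrite !sE mulrACA -expr2 pmulr_lle0; last first.
  by rewrite lt_def sqrf_eq0 li sqr_ge0.
move=> H; rewrite ge_min le_max; apply/andP; split; apply/orP.
  by have [?|?] := leP x s0; [left|right; nra].
by have [?|?] := leP s0 x; [left|right; nra].
Qed.

Lemma face_hitP T F s : faces_of M T F -> F (ins i s y) -> face_hit F s y = 1.
Proof.
move=> [MF _] Fs; rewrite /face_hit asboolT//; split => //; apply/eqP => fi.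
have /negP := gy.1 _ (sf_ffL sf MF) fi; apply.
by rewrite (col'_formE _ _ fi) -(col'_formE s _ fi) (face_form hM sf MF Fs).
Qed.

(** [K T F z] is the share of the element [T] in the jump across [F] at the chart point [z]: an
    interface is charged to both of its elements, a boundary face to the element that is left
    there. *)
Variables (E : 'rV[R]_n.+1 -> \bar R) (K : set 'rV[R]_n.+1 -> set 'rV[R]_n.+1 -> 'rV[R]_n -> R).
Hypotheses (mE : measurable_fun setT E) (E0 : forall x, (0 <= E x)%E).
Hypothesis HE : forall T x, elements M T -> T x ->
  ((a * `|peval (vT v T) x| `^ (a - 1) * `|peval (mpoly.mderiv i (vT v T)) x|)%:E <= E x)%E.
Hypothesis K0 : forall T F z, 0 <= K T F z.
Hypothesis HJ : forall F T1 T2 z, elements M T1 -> elements M T2 -> T1 <> T2 ->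
  faces_of M T1 F -> faces_of M T2 F -> F (chart M F z) ->
  `|spow a (peval (vT v T1) (chart M F z)) - spow a (peval (vT v T2) (chart M F z))|
    <= K T1 F z + K T2 F z.
Hypothesis HB : forall F T z, elements M T -> faces_of M T F ->
  boundary_face Omega M F -> F (chart M F z) ->
  `|spow a (peval (vT v T) (chart M F z))| <= K T F z.

Definition jump_at (s : R) : R := \sum_(T <- enum_set (elements M))
  \sum_(F <- enum_set (faces_of M T)) face_hit F s y * K T F (chart_coord F y).

Let inner (s : R) T : R :=
  \sum_(F <- enum_set (faces_of M T)) face_hit F s y * K T F (chart_coord F y).

Let inner0 s T : 0 <= inner s T.
Proof. by apply: sumr_ge0 => F _; rewrite mulr_ge0// ler0n. Qed.

Let inner_ge s T F : faces_of M T F -> F (ins i s y) ->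
  K T F (chart_coord F y) <= inner s T.
Proof.
move=> TF Fs; rewrite /inner (bigD1_seq F)//=; last first.
- exact: enum_set_uniq.
- by rewrite mem_enum_set ?inE//; exact: finite_faces_of.
rewrite (face_hitP TF Fs) mul1r lerDl sumr_ge0// => F' _.
by rewrite mulr_ge0// ler0n.
Qed.

Lemma jump_at_ge0 s : 0 <= jump_at s.
Proof. by apply: sumr_ge0 => T _; exact: inner0. Qed.

Lemma jump_at_ge1 s T F : elements M T -> faces_of M T F -> F (ins i s y) ->
  K T F (chart_coord F y) <= jump_at s.
Proof.
move=> MT TF Fs; apply: (le_trans (inner_ge TF Fs)).
rewrite /jump_at (bigD1_seq T)//=; last first.
- exact: enum_set_uniq.
- by rewrite mem_enum_set ?inE//; exact: finite_elements.
by rewrite lerDl sumr_ge0// => T' _; exact: inner0.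
Qed.

Lemma jump_at_ge2 s T1 T2 F : elements M T1 -> elements M T2 -> T1 <> T2 ->
  faces_of M T1 F -> faces_of M T2 F -> F (ins i s y) ->
  K T1 F (chart_coord F y) + K T2 F (chart_coord F y) <= jump_at s.
Proof.
move=> MT1 MT2 T12 TF1 TF2 Fs.
apply: (le_trans (lerD (inner_ge TF1 Fs) (inner_ge TF2 Fs))).
have uT := enum_set_uniq (elements M).
have mT T : elements M T -> T \in enum_set (elements M).
  by move=> MT; rewrite mem_enum_set ?inE//; exact: finite_elements.
rewrite /jump_at (bigD1_seq T1)//=; last exact: mT.
rewrite lerD2l -big_filter (bigD1_seq T2)//=.
- by rewrite lerDl sumr_ge0// => T' _; exact: inner0.
- by rewrite mem_filter mT// andbT; apply/eqP => E1; apply: T12.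
- exact: filter_uniq.
Qed.

Let P t := line_poly (vpoly (ins i t y)) (ins i 0 y) (delta_mx ord0 i).

Let PtE t s : (P t).[s] = peval (vpoly (ins i t y)) (ins i s y).
Proof. by rewrite /P line_polyE -insE add0r. Qed.

Let P_const (x z : R) : x <= z -> (forall s, s \in crossings y -> ~~ (x <= s <= z)) ->
  P x = P z.
Proof.
move=> xz hxz; rewrite /P (@vpoly_eq _ (ins i z y))// => T MT.
have ss := same_side_line xz hxz.
by split; apply: (same_side_element hM hS sf MT) => //; exact: same_side_sym.
Qed.

(** Four cases, according to which of the two neighbouring points lie in elements. Two distinct
    elements share the crossed face, because each has a face through the generic point and there is
    only one; an element against the exterior gives a boundary face; in the other cases there is no
    jump. *)
Let face_jump (s x z : R) : s \in crossings y -> x < s -> s < z ->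
  (forall s', s' \in crossings y -> x <= s' <= z -> s' = s) ->
  `|spow a (P x).[s] - spow a (P z).[s]| <= jump_at s.
Proof.
move=> sD xs sz hs; rewrite !PtE.
have gs := gy.2 s.
have cx : close_to Ls (ins i s y) (ins i x y).
  apply: close_to_line => s' s'D; rewrite (min_l (ltW xs)) (max_r (ltW xs)) => /andP[h1 h2].
  by apply: hs => //; rewrite h1 (le_trans h2)// ltW.
have cz : close_to Ls (ins i s y) (ins i z y).
  apply: close_to_line => s' s'D; rewrite (min_r (ltW sz)) (max_l (ltW sz)) => /andP[h1 h2].
  by apply: hs => //; rewrite h2 andbT (le_trans _ h1)// ltW.
have /crossingsP[l [lL li ls]] := sD.
have lE t : aev l (ins i t y) = (t - s) * l.1 ord0 i.
  have := ls; rewrite (aev_ins l s) (aev_ins l t) => /eqP; rewrite addr_eq0 => /eqP ->.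
  by ring.
have lxz : aev l (ins i x y) * aev l (ins i z y) < 0.
  rewrite !lE mulrACA -expr2 pmulr_llt0; last by rewrite lt_def sqrf_eq0 li sqr_ge0.
  by rewrite nmulr_rlt0 ?subr_lt0// subr_gt0.
have lzx : aev l (ins i z y) * aev l (ins i x y) < 0 by rewrite mulrC.
have coordP F : faces M F -> F (ins i s y) -> chart M F (chart_coord F y) = ins i s y.
  move=> MF Fs; apply: chart_coordE => //; apply/eqP => fi.
  have /negP := gy.1 _ (sf_ffL sf MF) fi; apply.
  by rewrite (col'_formE _ _ fi) -(col'_formE s _ fi) (face_form hM sf MF Fs).
have [[T [MT Tx]]|Nx] := pselect (exists T, elements M T /\ T (ins i x y));
    have [[T' [MT' Tz]]|Nz] := pselect (exists T, elements M T /\ T (ins i z y)).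
- rewrite (vpolyE MT Tx) (vpolyE MT' Tz).
  have [TT|TT] := pselect (T = T').
    by rewrite TT subrr normr0 jump_at_ge0.
  have Tz' : ~ T (ins i z y) by move=> Tz'; apply: TT; exact: (element_inj hM MT MT' Tz' Tz).
  have Tx' : ~ T' (ins i x y) by move=> Tx'; apply: TT; exact: (element_inj hM MT MT' Tx Tx').
  have [F TF Fs] := crossing_bdry hM hS sf gs lL ls cx cz lxz MT Tx Tz'.
  have [F' TF' Fs'] := crossing_bdry hM hS sf gs lL ls cz cx lzx MT' Tz Tx'.
  have FF : F = F' := generic_face_inj hM hS sf TF.1 TF'.1 Fs Fs' gs.
  rewrite -FF in TF'; apply: le_trans (jump_at_ge2 MT MT' TT TF TF' Fs).
  have cE := coordP F TF.1 Fs.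
  by rewrite -cE; apply: HJ => //; rewrite cE.
- have Nz' T' : elements M T' -> ~ T' (ins i z y) by move=> MT' T'z; apply: Nz; exists T'.
  rewrite (vpolyE MT Tx) (vpoly0 Nz') /peval mpoly.meval0 [spow a 0]mul0r subr0.
  have [F [TF bF Fs]] := crossing_exit hM hS sf gs lL ls cx cz lxz MT Tx Nz'.
  apply: le_trans (jump_at_ge1 MT TF Fs); have cE := coordP F TF.1 Fs.
  by rewrite -cE; apply: HB => //; rewrite cE.
- have Nx' T : elements M T -> ~ T (ins i x y) by move=> MT Tx; apply: Nx; exists T.
  rewrite (vpolyE MT' Tz) (vpoly0 Nx') /peval mpoly.meval0 [spow a 0]mul0r distrC subr0.
  have [F [TF bF Fs]] := crossing_exit hM hS sf gs lL ls cz cx lzx MT' Tz Nx'.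
  apply: le_trans (jump_at_ge1 MT' TF Fs); have cE := coordP F TF.1 Fs.
  by rewrite -cE; apply: HB => //; rewrite cE.
- rewrite !vpoly0 ?subrr ?normr0 ?jump_at_ge0// => T MT Tx.
    by apply: Nz; exists T.
  by apply: Nx; exists T.
Qed.

Lemma line_bound t : bounded_set Omega -> t \notin crossings y ->
  (`|spow a (vh M v (ins i t y))|%:E <=
   \int[lebesgue_measure]_s E (ins i s y) + (\sum_(s <- crossings y) jump_at s)%:E)%E.
Proof.
move=> bO tD; rewrite vhE -PtE.
apply: (@piecewise_bound R a (crossings y) P (fun s => E (ins i s y)) jump_at) => //.
- exact: undup_uniq.
- have [B B0 BO] := bounded_coord bO.
  exists (- B - 1) => x xB; rewrite /P vpoly0; first exact: mpoly.mmap0.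
  move=> T MT Tx.
  have cO : closed [set x : 'rV[R]_n.+1 | - B <= x ord0 i].
    rewrite (_ : [set _ | _] = (fun z : 'rV[R]_n.+1 => z ord0 i) @^-1` [set t | - B <= t])//.
    by apply: preimage_closed; [move=> z _; exact: coord_continuous|exact: closed_ge].
  have : closure Omega `<=` [set x : 'rV[R]_n.+1 | - B <= x ord0 i].
    rewrite [X in _ `<=` X](closure_id _).1//; apply: closureS => z Oz /=.
    by have := BO z i Oz; rewrite ler_norml => /andP[].
  move=> /(_ _ (closure_Omega_element hM MT Tx)) /=; rewrite ins_i; lra.
- apply: measurableT_comp => //; exact: measurable_ins.
- move=> x xD; rewrite deriv_line_poly -insE add0r PtE.
  have [[T [MT Tx]]|Nx] := pselect (exists T, elements M T /\ T (ins i x y)).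
    by rewrite (vpolyE MT Tx); exact: HE.
  rewrite vpoly0; last by move=> T MT Tx; apply: Nx; exists T.
  by rewrite (mpoly.mderiv0 (n := n.+1)) /peval mpoly.meval0 normr0 mulr0.
- exact: jump_at_ge0.
Qed.

Definition face_cross F : R :=
  (`[< (ff F).1 ord0 i != 0 /\ F (chart M F (chart_coord F y)) >])%:R.

(** Only faces transversal to the line are counted; the equation of such a face has a single zero on
    the line. *)
Lemma sum_face_hit F : faces M F -> \sum_(s <- crossings y) face_hit F s y <= face_cross F.
Proof.
move=> MF; have [[s sD [fi Fs]]|Ns] := pselect (exists2 s, s \in crossings y & (ff F).1 ord0 i != 0 /\ F (ins i s y)); last first.
  rewrite big_seq big1 ?ler0n// => s sD; rewrite /face_hit asboolF// => Fs.
  by apply: Ns; exists s.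
rewrite (bigD1_seq s)//=; last exact: undup_uniq.
rewrite big1 ?addr0 => [|s' s's].
  by rewrite /face_hit /face_cross !asboolT// (chart_coordE MF fi Fs).
rewrite /face_hit asboolF// => -[_ Fs']; move/eqP: s's; apply.
apply: (mulIf fi); apply: (addrI (aev (ff F) (ins i 0 y))).
by rewrite -!aev_ins !(face_form hM sf MF).
Qed.

Lemma sum_jump_at : \sum_(s <- crossings y) jump_at s <=
  \sum_(T <- enum_set (elements M)) \sum_(F <- enum_set (faces_of M T))
    face_cross F * K T F (chart_coord F y).
Proof.
rewrite /jump_at exchange_big/=; apply: ler_sum => T _.
rewrite exchange_big/= big_seq [leRHS]big_seq; apply: ler_sum => F.
rewrite mem_enum_set ?inE => [[MF _]|]; last exact: finite_faces_of.
by rewrite -mulr_suml ler_wpM2r// sum_face_hit.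
Qed.

End good.

End coordinate_lines.

Section null_sets.
Context {R : realType}.

Definition hyperplanes (n : nat) (Ls : seq ('rV[R]_n * R)) : set 'rV[R]_n :=
  [set x | exists2 l : 'rV[R]_n * R, l \in Ls & aev l x = 0].

Lemma hyperplanes_cons n (l : 'rV[R]_n * R) Ls :
  hyperplanes (l :: Ls) = [set x | dot l.1 x = - l.2] `|` hyperplanes Ls.
Proof.
apply/seteqP; split => x /=.
  move=> [l']; rewrite inE => /orP[/eqP ->|lL] lx; last by right; exists l'.
  by left; apply/eqP; rewrite -addr_eq0; apply/eqP.
move=> [lx|[l' lL lx]]; last by exists l' => //; rewrite inE lL orbT.
by exists l; rewrite ?mem_head// /aev lx addNr.
Qed.

Lemma measurable_hyperplanes n (Ls : seq ('rV[R]_n * R)) : measurable (hyperplanes Ls).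
Proof.
elim: Ls => [|l Ls IH].
  rewrite (_ : hyperplanes _ = set0)//.
  by apply/seteqP; split => // x [].
by rewrite hyperplanes_cons; apply: measurableU => //; exact: measurable_hyperplane.
Qed.

Lemma hyperplanes_null n (Ls : seq ('rV[R]_n * R)) : (forall l, l \in Ls -> l.1 != 0) ->
  lebesgue_rV R n (hyperplanes Ls) = 0%E.
Proof.
elim: Ls => [|l Ls IH] h.
  rewrite (_ : hyperplanes _ = set0) ?measure0//.
  by apply/seteqP; split => // x [].
rewrite hyperplanes_cons; apply/eqP; rewrite measureU0//.
- by apply/eqP; apply: hyperplane_null; apply: h; exact: mem_head.
- exact: measurable_hyperplane.
- exact: measurable_hyperplanes.
- by apply: IH => l' l'L; apply: h; rewrite inE l'L orbT.
Qed.

Lemma emeasurable_sum_seq d (T : measurableType d) (I : eqType) (s : seq I)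
    (f : I -> T -> \bar R) : (forall j, j \in s -> measurable_fun setT (f j)) ->
  measurable_fun setT (fun x => \sum_(j <- s) f j x)%E.
Proof.
elim: s => [|j s IH] mf.
  by under eq_fun do rewrite big_nil; exact: measurable_cst.
under eq_fun do rewrite big_cons; apply: emeasurable_funD.
  by apply: mf; exact: mem_head.
by apply: IH => k ks; apply: mf; rewrite inE ks orbT.
Qed.

Lemma measurable_sum_seq d (T : measurableType d) (I : eqType) (s : seq I)
    (f : I -> T -> R) : (forall j, j \in s -> measurable_fun setT (f j)) ->
  measurable_fun setT (fun x => \sum_(j <- s) f j x).
Proof.
move=> mf; apply/measurable_EFinP.
rewrite (_ : _ \o _ = fun x => (\sum_(j <- s) (f j x)%:E)%E).
  by apply: emeasurable_sum_seq => j js; apply/measurable_EFinP; exact: mf.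
by apply/funext => x /=; rewrite sumEFin.
Qed.

Lemma ge0_integral_sum_seq d (T : measurableType d) (mu : {measure set T -> \bar R})
    (I : eqType) (s : seq I) (f : I -> T -> \bar R) :
  (forall j, j \in s -> measurable_fun setT (f j)) ->
  (forall j x, j \in s -> (0 <= f j x)%E) ->
  (\int[mu]_x (\sum_(j <- s) f j x) = \sum_(j <- s) \int[mu]_x f j x)%E.
Proof.
elim: s => [|j s IH] mf f0.
  by under eq_integral do rewrite big_nil; rewrite integral0 big_nil.
have ss k : k \in s -> k \in j :: s by move=> ks; rewrite inE ks orbT.
rewrite big_cons -IH; last 2 first.
- by move=> k /ss; exact: mf.
- by move=> k x /ss; exact: f0.
under eq_integral do rewrite big_cons.
rewrite ge0_integralD//.
- by move=> x _; apply: f0; exact: mem_head.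
- by apply: mf; exact: mem_head.
- by move=> x _; rewrite big_seq; apply: sume_ge0 => k /ss; exact: f0.
- by apply: emeasurable_sum_seq => k /ss; exact: mf.
Qed.

End null_sets.

(** * Integration over all lines and the Sobolev inequality by total variation *)

Section total_variation.
Context {R : realType} {n : nat}.
Variables (Omega : set 'rV[R]_n.+1) (M : mesh R n.+1) (Ss : set (set 'rV[R]_n.+1)).
Variables (av : set 'rV[R]_n.+1 -> 'I_n.+2 -> 'rV[R]_n.+1).
Variables (bf : set 'rV[R]_n.+1 -> 'I_n.+2 -> 'rV[R]_n.+1 * R).
Variables (ff : set 'rV[R]_n.+1 -> 'rV[R]_n.+1 * R).
Variable Ls : seq ('rV[R]_n.+1 * R).
Variable h : R.
Hypothesis hM : is_mesh Omega h M.
Hypothesis hS : simplicial_submesh Omega M Ss.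
Hypothesis sf : submesh_forms M Ss av bf ff Ls.
Hypothesis bO : bounded_set Omega.
Variables (v : dofs R n.+1) (a : R).
Hypothesis a1 : 1 <= a.
Implicit Types (x : 'rV[R]_n.+1) (y : 'rV[R]_n) (S T F : set 'rV[R]_n.+1).

Lemma measurable_element T : elements M T -> measurable T.
Proof. by move=> MT; apply: open_measurable_rV; exact: (element_open hM). Qed.

Lemma measurable_vh : measurable_fun setT (vh M v).
Proof.
rewrite (_ : vh M v = fun x => \sum_(T <- enum_set (elements M)) (peval (vT v T) \_ T) x).
  apply: measurable_sum_seq => T; rewrite mem_enum_set ?inE; last exact: (finite_elements hM).
  move=> MT; apply/(measurable_restrictT _ (measurable_element MT)).
  by apply: measurable_funTS; exact: measurable_peval.
by apply/funext => x; rewrite /vh fsbig_finite//; exact: (finite_elements hM).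
Qed.

Lemma face_closed F : faces M F -> closed F.
Proof. by move=> MF; case: hM => _ _ _ [_ /(_ F MF)[_ []]]. Qed.

Lemma measurable_chart F : measurable_fun setT (chart M F).
Proof.
rewrite /chart; under eq_fun do rewrite addrC; exact: measurable_mulmx.
Qed.

Lemma measurable_chart_preimage F : faces M F -> measurable (chart M F @^-1` F).
Proof.
move=> MF; rewrite -[X in measurable X]setTI; apply: measurable_chart => //.
apply: closed_measurable_rV; exact: face_closed.
Qed.

Variables (E : 'rV[R]_n.+1 -> \bar R).
Variable (K : set 'rV[R]_n.+1 -> set 'rV[R]_n.+1 -> 'rV[R]_n -> R).
Hypotheses (mE : measurable_fun setT E) (E0 : forall x, (0 <= E x)%E).
Hypothesis HE : forall i T x, elements M T -> T x ->
  ((a * `|peval (vT v T) x| `^ (a - 1) * `|peval (mpoly.mderiv i (vT v T)) x|)%:E <= E x)%E.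
Hypothesis K0 : forall T F z, 0 <= K T F z.
Hypothesis mK : forall T F, measurable_fun setT (K T F).
Hypothesis HJ : forall F T1 T2 z, elements M T1 -> elements M T2 -> T1 <> T2 ->
  faces_of M T1 F -> faces_of M T2 F -> F (chart M F z) ->
  `|spow a (peval (vT v T1) (chart M F z)) - spow a (peval (vT v T2) (chart M F z))|
    <= K T1 F z + K T2 F z.
Hypothesis HB : forall F T z, elements M T -> faces_of M T F ->
  boundary_face Omega M F -> F (chart M F z) ->
  `|spow a (peval (vT v T) (chart M F z))| <= K T F z.

Let cross i T F y : \bar R :=
  (face_cross M ff i y F * K T F (chart_coord M i F y))%:E.

Let cross_prod i T F : faces M F -> (ff F).1 ord0 i != 0 ->
  cross i T F = (fun y => (((K T F) \_ (chart M F @^-1` F))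
     (y *m invmx (chart_minor M i F) - col' i (chart_origin M F) *m invmx (chart_minor M i F)))%:E).
Proof.
move=> MF fi; apply/funext => y; rewrite /cross /chart_coord -mulmxBl patchE.
rewrite /face_cross; case: asboolP => [[_ Fy]|Fy].
  by rewrite mem_set ?mul1r.
rewrite memNset ?mul0r// => Fy'; apply: Fy; split => //.
Qed.

Let cross0 i T F : (ff F).1 ord0 i = 0 -> cross i T F = cst 0%E.
Proof.
move=> fi; apply/funext => y; rewrite /cross /face_cross asboolF ?mul0r//.
by rewrite fi eqxx => -[].
Qed.

Let mKF T F : faces M F -> measurable_fun setT (fun y => ((K T F) \_ (chart M F @^-1` F) y)%:E).
Proof.
move=> MF; apply/measurable_EFinP; apply/measurable_restrict => //.
- exact: measurable_chart_preimage.
- by apply: measurable_funTS.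
Qed.

Let measurable_cross i T F : faces M F -> measurable_fun setT (cross i T F).
Proof.
move=> MF; have [fi|fi] := eqVneq ((ff F).1 ord0 i) 0; first by rewrite cross0.
rewrite cross_prod//.
apply: (measurableT_comp (mKF T MF)); exact: measurable_mulmx.
Qed.

Let cross_ge0 i T F y : (0 <= cross i T F y)%E.
Proof. by rewrite lee_fin mulr_ge0// ler0n. Qed.

(** Projecting [F] along the direction [i] has the minor of the frame as Jacobian, of absolute value
    at most [n!]; a face parallel to the direction contributes nothing. *)
Let integral_cross i T F : faces M F ->
  (\int[lebesgue_rV R n]_y cross i T F y <=
   (n`!%:R)%:E * \int[lebesgue_rV R n]_(z in chart M F @^-1` F) (K T F z)%:E)%E.
Proof.
move=> MF; have I0 : (0 <= \int[lebesgue_rV R n]_(z in chart M F @^-1` F) (K T F z)%:E)%E.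
  by apply: integral_ge0 => z _; rewrite lee_fin.
have [fi|fi] := eqVneq ((ff F).1 ord0 i) 0.
  rewrite cross0// integral0 mule_ge0// lee_fin ler0n//.
have uB := chart_minor_unit hM sf MF fi.
rewrite cross_prod//.
pose f y := ((K T F) \_ (chart M F @^-1` F) y)%:E.
have fE : (\int[lebesgue_rV R n]_y f y)%E =
    (\int[lebesgue_rV R n]_(z in chart M F @^-1` F) (K T F z)%:E)%E.
  rewrite [RHS]integral_mkcond; apply: eq_integral => z _.
  by rewrite /f restrict_EFin.
have f0 y : (0 <= f y)%E by rewrite /f patchE; case: ifP => // _; rewrite lee_fin.
have uB' : invmx (chart_minor M i F) \in unitmx by rewrite unitmx_inv.
have := integral_mulmx (- (col' i (chart_origin M F) *m invmx (chart_minor M i F))) uB' (mKF T MF) f0.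
rewrite -/f fE => <-; rewrite det_inv normfV muleA -EFinM.
have d0 : 0 < `|\det (chart_minor M i F)|.
  by rewrite normr_gt0; move: uB; rewrite unitmxE unitfE.
rewrite -[leLHS]mul1e; apply: lee_wpmul2r.
  by apply: integral_ge0 => y _; exact: f0.
rewrite lee_fin ler_pdivlMr// mul1r; exact: (chart_minor_det hM).
Qed.

(** One bound for the variations in all coordinate directions, as [sobolev_line_bounds] asks for a
    common [K]. *)
Definition tv_bound : \bar R := (\int[lebesgue_rV R n.+1]_x E x + (n`!%:R)%:E *
  \sum_(T <- enum_set (elements M)) \sum_(F <- enum_set (faces_of M T))
    \int[lebesgue_rV R n]_(z in chart M F @^-1` F) (K T F z)%:E)%E.

Let faces_ofP T F : F \in enum_set (faces_of M T) -> faces_of M T F.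
Proof. by rewrite mem_enum_set ?inE//; exact: (finite_faces_of hM). Qed.

Let crosses i y : \bar R :=
  (\sum_(T <- enum_set (elements M)) \sum_(F <- enum_set (faces_of M T)) cross i T F y)%E.

Let crosses0 i y : (0 <= crosses i y)%E.
Proof. by apply: sume_ge0 => T _; apply: sume_ge0 => F _; exact: cross_ge0. Qed.

Let measurable_crosses i : measurable_fun setT (crosses i).
Proof.
apply: emeasurable_sum_seq => T TM; apply: emeasurable_sum_seq => F /faces_ofP[MF _].
exact: measurable_cross.
Qed.

Let integral_crosses i : (\int[lebesgue_rV R n]_y crosses i y <= (n`!%:R)%:E *
  \sum_(T <- enum_set (elements M)) \sum_(F <- enum_set (faces_of M T))
    \int[lebesgue_rV R n]_(z in chart M F @^-1` F) (K T F z)%:E)%E.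
Proof.
have I0 T F : (0 <= \int[lebesgue_rV R n]_(z in chart M F @^-1` F) (K T F z)%:E)%E.
  by apply: integral_ge0 => z _; rewrite lee_fin.
rewrite ge0_integral_sum_seq; last 2 first.
- move=> T _; apply: emeasurable_sum_seq => F /faces_ofP[MF _].
  exact: measurable_cross.
- by move=> T y _; apply: sume_ge0 => F _; exact: cross_ge0.
rewrite ge0_sume_distrr; last by move=> T _; apply: sume_ge0 => F _.
apply: lee_sum => T _; rewrite ge0_integral_sum_seq; last 2 first.
- by move=> F /faces_ofP[MF _]; exact: measurable_cross.
- by move=> F y _; exact: cross_ge0.
rewrite ge0_sume_distrr; last by move=> F _.
rewrite big_seq [leRHS]big_seq; apply: lee_sum => F /faces_ofP[MF _].
exact: integral_cross.
Qed.

(** Infinite on exceptional lines: the line bound becomes true for every [y], and the integral is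
    unchanged because these lines form a null set. *)
Let bad i y : \bar R := (+oo * (\1_(hyperplanes (bad_forms Ls i)) y)%:E)%E.

Let bad0 i y : (0 <= bad i y)%E.
Proof. by rewrite /bad mule_ge0// lee_fin. Qed.

Let measurable_bad i : measurable_fun setT (bad i).
Proof.
apply: emeasurable_funM => //; apply/measurable_EFinP.
apply: measurable_indic; exact: measurable_hyperplanes.
Qed.

Let integral_bad i : (\int[lebesgue_rV R n]_y bad i y = 0)%E.
Proof.
rewrite ge0_integralZl//.
- rewrite integral_indic// ?setIT; last exact: measurable_hyperplanes.
  rewrite [X in (_ * X)%E](_ : _ = 0%E) ?mule0//.
  by apply: hyperplanes_null => l; exact: bad_forms_neq0.
- apply/measurable_EFinP; apply: measurable_indic; exact: measurable_hyperplanes.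
Qed.

Let G i y : \bar R := (\int[lebesgue_measure]_s E (ins i s y) + crosses i y + bad i y)%E.

Let lineE_ge0 i y : (0 <= \int[lebesgue_measure]_s E (ins i s y))%E.
Proof. exact: integral_ge0. Qed.

Let measurable_G i : measurable_fun setT (G i).
Proof.
apply: emeasurable_funD; last exact: measurable_bad.
by apply: emeasurable_funD => //; exact: measurable_integral_ins.
Qed.

Let integral_G i : (\int[lebesgue_rV R n]_y G i y <= tv_bound)%E.
Proof.
rewrite ge0_integralD//; last 2 first.
- by move=> y _; exact: adde_ge0.
- by apply: emeasurable_funD => //; exact: measurable_integral_ins.
rewrite integral_bad adde0 ge0_integralD//; last exact: measurable_integral_ins.
by rewrite -integral_ins//; apply: leeD => //; exact: integral_crosses.
Qed.

(** Put to zero on the hyperplanes, since the line bound is available only off the crossings of a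
    line. *)
Let w : 'rV[R]_n.+1 -> \bar R :=
  (fun x => `|spow a (vh M v x)|%:E) \_ (~` hyperplanes Ls).

Let w_le i x : (w x <= G i (col' i x))%E.
Proof.
have G0 y : (0 <= G i y)%E.
  by apply: adde_ge0 => //; apply: adde_ge0.
rewrite /w patchE; case: ifPn => //; rewrite inE => xL.
set y := col' i x; have xE : x = ins i (x ord0 i) y by rewrite ins_col'.
have [yb|yb] := pselect (hyperplanes (bad_forms Ls i) y).
  rewrite /G /bad indicE mem_set// mule1 addey ?leey//.
  by rewrite -ltNye (lt_le_trans ltNy0)// adde_ge0.
have gy : good_line Ls i y.
  by apply: (good_lineP sf) => m mb; apply/eqP => my; apply: yb; exists m.
have xD : x ord0 i \notin crossings Ls i y.
  apply/crossingsP => -[l [lL li lx]]; apply: xL.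
  by exists l => //; rewrite xE.
have HE' T x' := @HE i T x'.
have := line_bound hM hS sf gy a1 mE E0 HE' K0 HJ HB bO xD.
rewrite -xE => /le_trans; apply; rewrite /G.
apply: (@le_trans _ _ (\int[lebesgue_measure]_s E (ins i s y) + crosses i y)%E); last first.
  by rewrite leeDl.
apply: leeD => //; rewrite /crosses /cross.
under [leRHS]eq_bigr do rewrite sumEFin.
by rewrite [leRHS]sumEFin lee_fin; exact: (sum_jump_at hM sf i y K0).
Qed.

Lemma spow_norm (u : R) : `|spow a u| = `|u| `^ a.
Proof.
rewrite /spow normrM [`|_ `^ _|]ger0_norm ?powR_ge0//.
have [->|u0] := eqVneq u 0.
  by rewrite normr0 mul0r powR0// gt_eqF// (lt_le_trans _ a1).
by rewrite powRB ?normr_eq0 ?u0 ?implybT// powRr1// mulrC divfK// normr_eq0.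
Qed.

(** [sobolev_line_bounds] is applied to [|v_h|^a], the absolute value of the signed power, so that
    raising to [s] gives the exponent [a s]. Replacing [v_h] by [w] alters the integrand on a null
    set only. *)
Lemma discrete_sobolev (s : R) (D : set 'rV[R]_n.+1) : 1 <= s ->
  ((n > 0)%N -> s = n.+1%:R / n%:R) -> measurable D ->
  (\int[lebesgue_rV R n.+1]_(x in D) (`|vh M v x| `^ (a * s))%:E <=
   (1 + lebesgue_rV R n.+1 D) * tv_bound `^ s)%E.
Proof.
move=> s1 sn mD.
have ms : measurable_fun setT (fun x => `|spow a (vh M v x)|%:E).
  apply/measurable_EFinP; apply: (measurableT_comp (@normr_measurable _ _)).
  apply: (measurableT_comp _ measurable_vh).
  by apply: continuous_measurable_fun; exact: continuous_spow.
have mL := measurable_hyperplanes Ls.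
have mw : measurable_fun setT w.
  by apply/(measurable_restrictT _ (measurableC mL)); exact: measurable_funTS.
have w0 x : (0 <= w x)%E by rewrite /w patchE; case: ifP.
have := sobolev_line_bounds s1 sn mD mw w0 measurable_G _ w_le integral_G.
move=> /(_ (fun i (x : 'rV[R]_n) => adde_ge0 (adde_ge0 (lineE_ge0 i x) (crosses0 i x)) (bad0 i x))).
apply: le_trans; rewrite le_eqVlt; apply/orP; left; apply/eqP.
apply: ge0_ae_eq_integral => //.
- apply: measurable_funTS; apply/measurable_EFinP.
  by apply: (measurableT_comp (measurable_powR _)); apply: measurableT_comp => //; exact: measurable_vh.
- by apply: measurable_funTS; exact: measurable_fun_poweR.
- by move=> x _; rewrite poweR_ge0.
exists (hyperplanes Ls); split => //; first by apply: hyperplanes_null => l; exact: (sf_neq0 sf).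
move=> x /= hx; apply: contrapT => xL; apply: hx => _.
by rewrite /w patchE mem_set// poweR_EFin powRrM spow_norm.
Qed.

End total_variation.

(** * Exponents *)

Section exponents.
Context {R : realType}.

Lemma powR_le1D (u e m : R) : 0 <= u -> 0 <= e -> e <= m -> u `^ e <= 1 + u `^ m.
Proof.
move=> u0 e0 em; have [u1|u1] := leP 1 u.
  by rewrite (le_trans (ler_powR u1 em))// lerDr.
apply: (@le_trans _ _ 1); last by rewrite lerDl powR_ge0.
have <- : 1 `^ e = 1 :> R by rewrite powR1.
by apply: ge0_ler_powR; rewrite ?nnegrE// ltW.
Qed.

(* The two regimes of Young's inequality are separated according to whether
   [b <= delta * h * A ^ (1 / (p - 1))]. *)
Lemma weighted_young (p A b h delta : R) : 1 < p -> 0 <= A -> 0 <= b -> 0 < h ->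
  0 < delta ->
  A * b <= delta * h * A `^ (p / (p - 1)) + delta `^ (1 - p) * h `^ (1 - p) * b `^ p.
Proof.
move=> p1 A0 b0 h0 d0; have pp : 0 < p - 1 by rewrite subr_gt0.
have E : A `^ (p / (p - 1)) = A * A `^ ((p - 1)^-1).
  have -> : p / (p - 1) = 1 + (p - 1)^-1 by field; rewrite gt_eqF.
  have [->|An0] := eqVneq A 0.
    by rewrite powR0 ?mul0r// gt_eqF// addr_gt0// invr_gt0.
  by rewrite powRD ?An0 ?implybT// powRr1.
have [bs|bl] := leP b (delta * h * A `^ ((p - 1)^-1)).
  apply: (@le_trans _ _ (delta * h * A `^ (p / (p - 1)))).
    by rewrite E mulrCA ler_wpM2l.
  by rewrite lerDl !mulr_ge0 ?powR_ge0.
apply: (@le_trans _ _ (delta `^ (1 - p) * h `^ (1 - p) * b `^ p)); last first.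
  by rewrite lerDr !mulr_ge0 ?powR_ge0// ltW.
have bp : 0 < b by apply: le_lt_trans bl; rewrite !mulr_ge0 ?powR_ge0// ltW.
have -> : b `^ p = b `^ (p - 1) * b.
  by rewrite -[X in _ * X](powRr1 b0) -powRD ?subrK// (gt_eqF bp) implybT.
rewrite -(powRM _ (ltW d0) (ltW h0)) mulrA (ler_wpM2r b0)//.
have -> : 1 - p = - (p - 1) by rewrite opprB.
have dh : 0 < delta * h by rewrite mulr_gt0.
rewrite powRN mulrC ler_pdivlMr ?powR_gt0//.
have Ap : A = (A `^ (p - 1)^-1) `^ (p - 1) by rewrite -powRrM mulVf ?powRr1// gt_eqF.
rewrite {1}Ap -(powRM _ (powR_ge0 _ _) (ltW dh)).
apply: ge0_ler_powR; rewrite ?nnegrE ?(ltW pp)//.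
  by rewrite mulr_ge0 ?powR_ge0// ltW.
by rewrite mulrC ltW.
Qed.

(** Young's inequality turns [u^(a-1)] into [u^((a-1)p/(p-1))], which is at most [1 + u^m] under the
    hypothesis on exponents. For [p = 1] there is no conjugate exponent, but then [a = 1] and
    nothing has to be split. *)
Lemma sobolev_young (a p m : R) : 1 <= a -> 1 <= p -> 0 <= m ->
  (p = 1 -> a = 1) -> (1 < p -> (a - 1) * (p / (p - 1)) <= m) ->
  forall eps : R, 0 < eps -> exists2 C : R, 0 <= C &
    forall u b h, 0 <= u -> 0 <= b -> 0 < h ->
      a * u `^ (a - 1) * b <= eps * h * (1 + u `^ m) + C * h `^ (1 - p) * b `^ p.
Proof.
move=> a1 p1 m0 hp1 hm eps e0.
have [pE|pN] := eqVneq p 1.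
  exists 1 => // u b h u0 b0 h0.
  rewrite pE (hp1 pE) !subrr !powRr0 !mul1r powRr1// lerDr.
  by rewrite !mulr_ge0 ?addr_ge0 ?powR_ge0 ?ltW.
have {}p1 : 1 < p by rewrite lt_neqAle eq_sym pN.
(* [weighted_young] is applied to [a u^(a-1)], whose power [r] carries the factor [a^r] that this
   [delta] cancels. *)
pose r := p / (p - 1); pose delta := eps / a `^ r.
have a0 : 0 < a by apply: lt_le_trans a1.
have d0 : 0 < delta by rewrite divr_gt0 ?powR_gt0.
exists (delta `^ (1 - p)); first exact: powR_ge0.
move=> u b h u0 b0 h0.
apply: le_trans (weighted_young p1 _ b0 h0 d0) _.
  by rewrite mulr_ge0 ?powR_ge0// ltW.
rewrite lerD2r -/r (powRM _ (ltW a0) (powR_ge0 _ _)) -powRrM.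
have -> : delta * h * (a `^ r * u `^ ((a - 1) * r)) = eps * h * u `^ ((a - 1) * r).
  by rewrite /delta; field; rewrite gt_eqF// powR_gt0.
rewrite (ler_wpM2l (mulr_ge0 (ltW e0) (ltW h0)))//.
apply: powR_le1D => //; last exact: hm.
by rewrite mulr_ge0 ?subr_ge0// divr_ge0 ?subr_ge0 ?ltW// (lt_trans _ p1).
Qed.

(** With [d = n + 1]: for [d = 1], [s] is free and [a = 1], [s = q] will do. For [p < d],
    [a = p n / (d - p)] is the value with [a s = p*], and it gives equality in the last condition
    when [1 < p]. For [d <= p], [a = q] works because [p/(p-1) <= d/(d-1) = s]. *)
Lemma sobolev_exponents (n : nat) (p q : R) : 1 <= p -> 1 <= q ->
  (p < n.+1%:R -> q <= sobolev_exponent n.+1 p) ->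
  exists a s : R, [/\ 1 <= a, 1 <= s, (0 < n)%N -> s = n.+1%:R / n%:R, q <= a * s &
    (p = 1 -> a = 1) /\ (1 < p -> (a - 1) * (p / (p - 1)) <= a * s)].
Proof.
move=> p1 q1 hq; have [n0|n0] := posnP n.
  exists 1, q; split; rewrite ?n0 ?mul1r//.
  split => // _; rewrite subrr mul0r; exact: le_trans q1.
have nR : 1 <= n%:R :> R by rewrite ler1n.
have nR0 : n%:R != 0 :> R by rewrite gt_eqF// (lt_le_trans _ nR).
have s1 : 1 <= n.+1%:R / n%:R :> R.
  by rewrite ler_pdivlMr ?mul1r ?ler_nat// (lt_le_trans _ nR).
have sE : n.+1%:R = n%:R + 1 :> R by rewrite -natr1.
rewrite /sobolev_exponent in hq.
have [pd|pd] := ltP p n.+1%:R.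
  have {}hq := hq pd; have dp : 0 < n.+1%:R - p by rewrite subr_gt0.
  exists (p * n%:R / (n.+1%:R - p)), (n.+1%:R / n%:R).
  rewrite sE in hq pd dp *; move: (n%:R) hq pd dp nR nR0 => d hq pd dp d1 d0.
  split => //.
  - by rewrite ler_pdivlMr// mul1r; nra.
  - by rewrite sE in s1; rewrite ler_pdivlMr ?mul1r ?lerDl// (lt_le_trans _ d1).
  - apply: (le_trans hq); rewrite le_eqVlt; apply/orP; left; apply/eqP.
    by field; rewrite d0 gt_eqF.
  split => [->|pp]; first by rewrite mul1r addrK divff.
  rewrite le_eqVlt; apply/orP; left; apply/eqP; field.
  by rewrite d0 !gt_eqF ?subr_gt0.
exists q, (n.+1%:R / n%:R); split => //.
  by rewrite ler_peMr// (le_trans _ q1).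
rewrite sE in pd *; move: (n%:R) pd nR nR0 => d pd d1 d0.
split => [pE|pp]; first by exfalso; move: pd; rewrite pE; lra.
have p0 : 0 < p - 1 by lra.
have -> : p / (p - 1) = 1 + (p - 1)^-1 by field; rewrite gt_eqF.
have -> : (d + 1) / d = 1 + d^-1 by field.
have : (p - 1)^-1 <= d^-1 by rewrite lef_pV2 ?posrE//; lra.
have : 0 < (p - 1)^-1 by rewrite invr_gt0.
move: (_^-1) (d^-1) => x y; nra.
Qed.

End exponents.

(** * Trace inequality *)

Section cones.
Context {R : realType} {n : nat}.

Lemma dotE (m : nat) (x y : 'rV[R]_m) : dot x y = (x *m y^T) ord0 ord0.
Proof. by rewrite mxE; apply: eq_bigr => j _; rewrite mxE. Qed.

Lemma dot_mulmxr (m k : nat) (l : 'rV[R]_m) (z : 'rV[R]_k) (Q : 'M[R]_(k, m)) :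
  dot l (z *m Q) = dot (l *m Q^T) z.
Proof. by rewrite !dotE trmx_mul mulmxA. Qed.

Lemma mul_rV_cons_col (m : nat) (t : R) (w : 'rV[R]_n) (r : 'rV[R]_m) (Q : 'M[R]_(n, m)) :
  rV_cons (t, w) *m (col_mx r Q : 'M[R]_(1 + n, m)) = t *: r + w *m Q.
Proof. by rewrite rV_consE (mul_row_col t%:M w r Q) mul_scalar_mx. Qed.

(** [a] is the apex, [o + z Q] is an isometric parametrisation of the base hyperplane, and [l] is
    the form that grows from 0 on the base to 1 at the apex. *)
Variables (a o : 'rV[R]_n.+1) (Q : 'M[R]_(n, n.+1)) (l : 'rV[R]_n.+1 * R).
Hypotheses (QQ : Q *m Q^T = 1%:M) (la : aev l a = 1).
Hypothesis lQ : forall z : 'rV[R]_n, aev l (o + z *m Q) = 0.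

Let lo : aev l o = 0.
Proof. by have := lQ 0; rewrite mul0mx addr0. Qed.

Let lao : dot l.1 (a - o) = 1.
Proof. by move: la lo; rewrite /aev dotDr dotNr => h1 h2; rewrite -h1 -[RHS]subr0 -h2; ring. Qed.

Let lQ0 : Q *m l.1^T = 0.
Proof.
apply/colP => j; have := lQ (delta_mx ord0 j).
rewrite -[_ *m Q]scale1r aevD lo add0r mul1r -rowE dotC dotE -row_mul mxE.
by move=> ->; rewrite [RHS]mxE.
Qed.

Definition cone_mx : 'M[R]_(1 + n) := col_mx (a - o) Q.

(** [|det cone_mx|] is the height of the apex over the base, and a form growing from 0 to 1 over
    this height along its gradient has gradient of norm 1/height. Multiplying by the matrix with
    rows [l.1] and [Q] makes both determinants explicit. *)
Lemma cone_mx_det : `|\det cone_mx| ^+ 2 * dot l.1 l.1 = 1.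
Proof.
pose L : 'M[R]_(1 + n) := col_mx l.1 Q.
have BL : cone_mx *m L^T = block_mx 1%:M ((a - o) *m Q^T) 0 1%:M.
  rewrite /cone_mx /L tr_col_mx mul_col_row lQ0 QQ; congr block_mx.
  by rewrite [LHS]mx11_scalar -dotE dotC lao.
have h1 : \det cone_mx * \det L = 1.
  by rewrite -(det_tr L) -det_mulmx BL det_ublock !det1 mulr1.
have LL : L *m L^T = block_mx (dot l.1 l.1)%:M 0 0 1%:M.
  rewrite /L tr_col_mx mul_col_row lQ0 QQ; congr block_mx.
    by rewrite [LHS]mx11_scalar -dotE.
  by rewrite -[LHS]trmxK trmx_mul trmxK lQ0 trmx0.
have h2 : \det L * \det L = dot l.1 l.1.
  by rewrite -{2}(det_tr L) -det_mulmx LL det_ublock det1 mulr1 det_scalar1.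
by rewrite -normrX ger0_norm ?sqr_ge0// -h2 expr2 mulrACA h1 mulr1.
Qed.

Let unit_B : cone_mx \in unitmx.
Proof.
rewrite unitmxE unitfE; apply/eqP => h; have := cone_mx_det.
by rewrite h normr0 expr2 !mul0r => /eqP; rewrite eq_sym oner_eq0.
Qed.

Lemma cone_mx_gt0 : 0 < `|\det cone_mx|.
Proof. by rewrite normr_gt0; move: unit_B; rewrite unitmxE unitfE. Qed.

(* The inverse is written as a power to be covered by [measurable_powR]; it is
   only used for [aev l X < 1]. *)
Definition cone_coord (X : 'rV[R]_n.+1) : 'rV[R]_n :=
  ((1 - aev l X) `^ (-1) *: (X - aev l X *: a) - o) *m Q^T.

Definition cone (A : set 'rV[R]_n) : set 'rV[R]_n.+1 :=
  [set X | 0 < aev l X < 1/2 /\ A (cone_coord X)].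

Let ray (t : R) (z : 'rV[R]_n) : 'rV[R]_n.+1 :=
  o + z *m Q + t *: (a - (o + z *m Q)).

Lemma aev_ray t z : aev l (ray t z) = t.
Proof. by rewrite /ray aev_conv lQ la mulr0 add0r mulr1. Qed.

Lemma cone_coord_ray t z : t < 1 -> cone_coord (ray t z) = z.
Proof.
move=> t1; rewrite /cone_coord aev_ray.
have -> : ray t z - t *: a = (1 - t) *: (o + z *m Q).
  rewrite /ray; move: (o + z *m Q) => w.
  by rewrite scalerBr scalerBl scale1r addrCA [X in X - _]addrC addrK.
rewrite powR_inv1 ?subr_ge0 ?ltW// scalerA mulVf ?scale1r ?subr_eq0 ?gt_eqF//.
by rewrite addrC addKr -mulmxA QQ mulmx1.
Qed.

Lemma measurable_aev (m : nat) (l' : 'rV[R]_m * R) : measurable_fun setT (aev l').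
Proof. by apply: measurable_funD => //; exact: measurable_dot. Qed.

Lemma measurable_cone_coord : measurable_fun setT cone_coord.
Proof.
apply: measurable_rVP => j; rewrite /cone_coord.
under eq_fun do rewrite mxE.
apply: measurable_sum => i; apply: measurable_funM => //.
under eq_fun do rewrite !mxE.
apply: measurable_funB => //; apply: measurable_funM.
  apply: (measurableT_comp (measurable_powR _)); apply: measurable_funB => //.
  exact: measurable_aev.
apply: measurable_funB; first exact: measurable_rV_coord.
by apply: measurable_funM => //; exact: measurable_aev.
Qed.

Lemma measurable_cone A : measurable A -> measurable (cone A).
Proof.
move=> mA; rewrite (_ : cone A = (aev l) @^-1` `]0, 1/2[ `&` cone_coord @^-1` A).
  apply: measurableI; rewrite -[X in measurable X]setTI.
    exact: measurable_aev.
  exact: measurable_cone_coord.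
by apply/seteqP; split => X /=; rewrite in_itv.
Qed.

Variables (A : set 'rV[R]_n) (g : 'rV[R]_n.+1 -> R) (H : 'rV[R]_n -> R) (c : R).
Hypotheses (mA : measurable A) (mg : measurable_fun setT g) (g0 : forall x, 0 <= g x).
Hypotheses (mH : measurable_fun setT H) (H0 : forall x, 0 <= H x) (c0 : 0 <= c).
Hypothesis gH : forall z, A z ->
  ((H z)%:E <= c%:E * \int[lebesgue_measure]_(t in `]0%R, (1/2)%R[) (g (ray t z))%:E)%E.

(* The slice of the cone at height [t] is a copy of [A] scaled by [1 - t], hence
   of measure at least [2 ^- n] times that of [A] for [t < 1/2]. *)
Lemma cone_integral :
  (`|\det cone_mx|%:E * \int[lebesgue_rV R n]_(z in A) (H z)%:E <=
   (c * 2 ^+ n)%:E * \int[lebesgue_rV R n.+1]_(x in cone A) (g x)%:E)%E.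
Proof.
have mC := measurable_cone mA.
pose f X := (\1_(cone A) X * g X)%:E.
pose I12 := `]0, (1 / 2)[%classic : set R.
pose tl (X : 'rV[R]_n.+1) : 'rV[R]_n := \row_j X ord0 (lift ord0 j).
pose h (X : 'rV[R]_n.+1) := (\1_I12 (X ord0 ord0) * \1_A (tl X) *
  g (ray (X ord0 ord0) (tl X)))%:E.
have tl_cons t z : tl (rV_cons (t, z)) = z.
  by apply/rowP => k; rewrite mxE rV_consS.
have hE t z : h (rV_cons (t, z)) = (\1_I12 t * \1_A z * g (ray t z))%:E.
  by rewrite /h tl_cons rV_cons0.
have f0 X : (0 <= f X)%E by rewrite lee_fin mulr_ge0.
have h0 X : (0 <= h X)%E by rewrite lee_fin !mulr_ge0.
have mf : measurable_fun setT f.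
  by apply/measurable_EFinP; apply: measurable_funM => //; exact: measurable_indic.
have mtl : measurable_fun setT tl.
  apply: measurable_rVP => k; under eq_fun do rewrite mxE.
  exact: measurable_rV_coord.
have m0 : measurable_fun setT (fun X : 'rV[R]_n.+1 => X ord0 ord0).
  exact: measurable_rV_coord.
have mh : measurable_fun setT h.
  apply/measurable_EFinP; apply: measurable_funM.
    apply: measurable_funM.
      exact: (measurableT_comp (measurable_indic (measurable_itv _ : measurable I12)) m0).
    exact: (measurableT_comp (measurable_indic mA) mtl).
  apply: (measurableT_comp mg); apply: measurable_rVP => k; rewrite /ray.
  under eq_fun do rewrite !mxE.
  have mz : measurable_fun [set: 'rV[R]_n.+1] (fun X => \sum_j tl X ord0 j * Q j k).
    apply: measurable_sum => j; apply: measurable_funM => //.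
    exact: (measurableT_comp (measurable_rV_coord j) mtl).
  apply: measurable_funD; first exact: measurable_funD.
  apply: measurable_funM => //; apply: measurable_funB => //; exact: measurable_funD.
have fE : (\int[lebesgue_rV R n.+1]_(x in cone A) (g x)%:E =
    \int[lebesgue_rV R n.+1]_x f x)%E.
  rewrite integral_mkcond; apply: eq_integral => x _.
  rewrite /f patchE indicE; case: ifP => xA; last by rewrite mul0r.
  by rewrite mul1r.
have mfB : measurable_fun setT (fun x => f (x *m cone_mx + o)).
  by apply: (measurableT_comp mf); exact: measurable_mulmx.
rewrite fE -(integral_mulmx o unit_B mf f0) (integral_rV1 mfB); last first.
  by move=> x; exact: f0.
rewrite EFinM [leRHS]muleCA -!muleA.
have step t : (\int[lebesgue_rV R n]_y h (rV_cons (t, y)) <=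
    (2 ^+ n)%:E * \int[lebesgue_rV R n]_y f (rV_cons (t, y) *m cone_mx + o)%R)%E.
  have If0 : (0 <= \int[lebesgue_rV R n]_y f (rV_cons (t, y) *m cone_mx + o)%R)%E.
    by apply: integral_ge0 => y _; exact: f0.
  have [|tN] := boolP (t \in I12); last first.
    under eq_integral do rewrite hE indicE (negbTE tN) !mul0r.
    by rewrite integral0 mule_ge0// lee_fin exprn_ge0.
  rewrite inE /I12 /= in_itv/= => /andP[t0 t1].
  pose k y := f (rV_cons (t, y) *m cone_mx + o).
  have u0 : 0 < 1 - t by lra.
  have uM : (1 - t)%:M \in @unitmx R n.
    by rewrite unitmxE det_scalar unitfE expf_neq0// gt_eqF.
  have mk : measurable_fun setT k.
    apply: (measurableT_comp mfB (measurable_rV_consP _ _)) => //.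
  have k0 y : (0 <= k y)%E by exact: f0.
  rewrite -/(k _) -(integral_mulmx 0 uM mk k0) det_scalar ger0_norm ?exprn_ge0 ?(ltW u0)//.
  rewrite muleA -EFinM -exprMn.
  (* The factor [1 - t] turns the point of the slice into the point at parameter [t] of the ray from
     the base point [y] to the apex. *)
  have kE y : k (y *m (1 - t)%:M + 0) = h (rV_cons (t, y)).
    rewrite hE /k addr0 /cone_mx mul_rV_cons_col mul_mx_scalar.
    rewrite (_ : _ + o = ray t y); last first.
      rewrite /ray -scalemxAl scalerBl scale1r; move: (y *m Q) => w.
      by apply/rowP => j; rewrite !mxE; ring.
    rewrite /f !indicE; congr ((_ * _)%:E).
    rewrite -natrM mulnb; congr (nat_of_bool _)%:R.
    have tI : I12 t by rewrite /I12/= in_itv/= t0 t1.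
    rewrite (mem_set tI)/=; apply/idP/idP; rewrite !inE /cone/= aev_ray cone_coord_ray; try lra.
      by case.
    by move=> Ay; rewrite t0 t1.
  rewrite [X in (_ <= _ * X)%E](eq_integral (fun y => h (rV_cons (t, y)))); last by move=> y _; exact: kE.
  rewrite -[leLHS]mul1e; apply: lee_wpmul2r; first by apply: integral_ge0.
  by rewrite lee_fin exprn_ege1//; lra.
rewrite lee_pmul2l//; last by rewrite lte_fin cone_mx_gt0.
have mft : measurable_fun [set: R] (fun t => \int[lebesgue_rV R n]_y f (rV_cons (t, y) *m cone_mx + o)%R)%E.
  by apply: (measurable_integral_rV1 mfB) => x; exact: f0.
rewrite -ge0_integralZl_EFin//; last first.
  by move=> t _; apply: integral_ge0 => y _; exact: f0.
apply: (@le_trans _ _ (c%:E * \int[lebesgue_measure]_t \int[lebesgue_rV R n]_y h (rV_cons (t, y)))%E); last first.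
  apply: lee_wpmul2l; first by rewrite lee_fin.
  apply: ge0_le_integral => //.
  - by move=> t _; apply: integral_ge0.
  - exact: measurable_integral_rV1.
  - by apply: emeasurable_funM.
rewrite -integral_rV1// integral_rV2// -ge0_integralZl_EFin//; last 2 first.
- by move=> z _; apply: integral_ge0.
- exact: measurable_integral_rV2.
rewrite [leLHS]integral_mkcond; apply: ge0_le_integral => //.
- by move=> z _; rewrite patchE; case: ifP => // _; rewrite lee_fin.
- apply/(measurable_restrictT _ mA); apply: measurable_funTS; exact/measurable_EFinP.
- apply: emeasurable_funM => //; exact: measurable_integral_rV2.
move=> z _; rewrite patchE; case: ifPn => [|_]; last first.
  by rewrite mule_ge0// ?lee_fin//; apply: integral_ge0.
rewrite inE => Az; apply: (le_trans (gH Az)); apply: lee_wpmul2l; first by rewrite lee_fin.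
rewrite [leLHS]integral_mkcond; rewrite le_eqVlt; apply/orP; left; apply/eqP.
apply: eq_integral => t _; rewrite hE patchE indicE /I12 [\1_A z]indicE (mem_set Az) mulr1.
by case: ifP => _; rewrite ?mul1r ?mul0r.
Qed.

End cones.

(** * A polynomial value bounded by an average along a ray *)

Section ray_bound.
Context {R : realType}.

(** The summand 1 makes every power of [u] with exponent between 0 and [m] at most [Psi m u]. *)
Definition Psi (m u : R) : R := 1 + u `^ m.

Lemma Psi_ge1 (m u : R) : 1 <= Psi m u.
Proof. by rewrite lerDl powR_ge0. Qed.

Lemma Psi_ge0 (m u : R) : 0 <= Psi m u.
Proof. exact: le_trans (Psi_ge1 m u). Qed.

Lemma measurable_Psi (m : R) : measurable_fun [set: R] (Psi m).
Proof. by apply: measurable_funD => //; exact: measurable_powR. Qed.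

Lemma Psi_scale (m a u w : R) : 0 <= m -> 1 <= a -> 0 <= u -> 0 <= w ->
  u <= a * w -> Psi m u <= a `^ m * Psi m w.
Proof.
move=> m0 a1 u0 w0 uw; have a0 : 0 <= a by apply: le_trans a1.
rewrite /Psi mulrDr mulr1; apply: lerD.
  have <- : 1 `^ m = 1 :> R by rewrite powR1.
  by apply: ge0_ler_powR; rewrite ?nnegrE.
by rewrite -powRM//; apply: ge0_ler_powR; rewrite ?nnegrE// mulr_ge0.
Qed.

(** [(2^(k+1))^m] comes from extrapolation, [k + 1] is the number of sample points, and [2 (k + 1)]
    is the inverse of the length [tau] of the interval of averaging. *)
Definition ray_cst (k : nat) (m : R) : R :=
  (2 ^+ k.+1) `^ m * k.+1%:R * (2 * k.+1%:R).

(** For [t < tau] all sample points [j t], [1 <= j <= k + 1], stay in []0, 1/2[], and one of them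
    controls the value at 0. Which one depends on [t], so all are summed before integrating over
    []0, tau[]; the substitution [j t] divides the integral by [j >= 1]. *)
Lemma poly_ray_bound (k : nat) (m : R) (p : {poly R}) : 0 <= m ->
  (size p <= k.+1)%N ->
  ((Psi m `|p.[0]|)%:E <= (ray_cst k m)%:E *
    \int[lebesgue_measure]_(t in `]0%R, (1/2)%R[) (Psi m `|p.[t]|)%:E)%E.
Proof.
move=> m0 pk; pose K : R := k.+1%:R; pose c := (2 ^+ k.+1) `^ m : R.
have K0 : 0 < K by rewrite ltr0n.
have c0 : 0 <= c by exact: powR_ge0.
pose f : R -> \bar R := (fun t => (Psi m `|p.[t]|)%:E) \_ `]0%R, (1/2)%R[.
have mp : measurable_fun [set: R] (fun t => (Psi m `|p.[t]|)%:E).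
  apply/measurable_EFinP; apply: (measurableT_comp (measurable_Psi m)).
  apply: measurableT_comp => //; apply: continuous_measurable_fun => t.
  apply/differentiable_continuous/derivable1_diffP.
  exact: derivable_horner.
have mf : measurable_fun [set: R] f.
  by apply/(measurable_restrictT _ (measurable_itv _)); exact: measurable_funTS.
have f0 t : (0 <= f t)%E.
  by rewrite /f patchE; case: ifP => // _; rewrite lee_fin Psi_ge0.
pose I : \bar R := (\int[lebesgue_measure]_t f t)%E.
have -> : (\int[lebesgue_measure]_(t in `]0%R, (1/2)%R[) (Psi m `|p.[t]|)%:E = I)%E.
  by rewrite integral_mkcond.
have I0 : (0 <= I)%E by exact: integral_ge0.
have Ij (j : nat) : (0 < j)%N -> (\int[lebesgue_measure]_t f (j%:R * t)%R <= I)%E.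
  move=> j0; have jR : 1 <= j%:R :> R by rewrite ler1n.
  have jn0 : j%:R != 0 :> R by rewrite gt_eqF// (lt_le_trans _ jR).
  have -> : (\int[lebesgue_measure]_t f (j%:R * t)%R = \int[lebesgue_measure]_t f (j%:R * t + 0)%R)%E.
    by apply: eq_integral => t _; rewrite addr0.
  have := @integral_affine R j%:R 0 f jn0 mf f0.
  rewrite normr_nat -/I.
  move=> <-; rewrite -[leLHS]mul1e; apply: lee_wpmul2r; first exact: integral_ge0.
  by rewrite lee_fin.
pose tau : R := (2 * K)^-1; have tau0 : 0 < tau by rewrite invr_gt0 mulr_gt0.
have point t : 0 < t < tau -> ((Psi m `|p.[0]|)%:E <=
    c%:E * \sum_(0 <= j < k.+1) f (j.+1%:R * t)%R)%E.
  move=> /andP[t0 tt]; have [j /andP[j0 jk] pj] := extrapolation t pk.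
  have fj : f (j%:R * t) = (Psi m `|p.[j%:R * t]|)%:E.
    rewrite /f patchE mem_set//= in_itv/= mulr_gt0 ?ltr0n//=.
    have : j%:R * t < K * tau.
      apply: (@le_lt_trans _ _ (K * t)); first by rewrite ler_wpM2r ?(ltW t0)// ler_nat.
      by rewrite ltr_pM2l.
    suff -> : K * tau = 1/2 by [].
    by rewrite /tau; field; rewrite gt_eqF.
  apply: (@le_trans _ _ (c%:E * f (j%:R * t)%R)%E).
    rewrite fj -EFinM lee_fin; apply: Psi_scale => //.
    by rewrite exprn_ege1// ler1n.
  apply: lee_wpmul2l; first by rewrite lee_fin.
  rewrite (bigD1_seq j.-1) ?iota_uniq//=; last first.
    by rewrite mem_index_iota prednK.
  by rewrite prednK// leeDl// sume_ge0.
have H : (tau%:E * (Psi m `|p.[0]|)%:E <= c%:E * (K%:E * I))%E.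
  have -> : (tau%:E * (Psi m `|p.[0]|)%:E =
      \int[lebesgue_measure]_(t in `]0%R, tau[) (Psi m `|p.[0]|)%:E)%E.
    rewrite integral_cst//= lebesgue_measure_itv/= lte_fin tau0 oppr0 adde0.
    by rewrite muleC.
  apply: (@le_trans _ _ (\int[lebesgue_measure]_t
      (c%:E * \sum_(0 <= j < k.+1) f (j.+1%:R * t)%R))%E).
    rewrite integral_mkcond; apply: ge0_le_integral => //.
    - by move=> t _; rewrite patchE; case: ifP => // _; rewrite lee_fin Psi_ge0.
    - by apply/(measurable_restrictT _ (measurable_itv _)).
    - apply: emeasurable_funM => //; apply: emeasurable_sum => j.
      by apply: (measurableT_comp mf); exact: measurable_funM.
    - move=> t _; rewrite patchE; case: ifPn => [|_].
        by rewrite inE /= in_itv/=; exact: point.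
      by rewrite mule_ge0 ?lee_fin// sume_ge0.
  rewrite ge0_integralZl_EFin//; last 2 first.
  - by move=> t _; rewrite sume_ge0.
  - apply: emeasurable_sum => j.
    by apply: (measurableT_comp mf); exact: measurable_funM.
  apply: lee_wpmul2l; first by rewrite lee_fin.
  rewrite ge0_integral_sum//; last first.
    by move=> j; apply: (measurableT_comp mf); exact: measurable_funM.
  apply: (@le_trans _ _ (\sum_(0 <= j < k.+1) I)%E).
    by apply: lee_sum => j _; exact: Ij.
  by rewrite sumr_const_nat subn0 /K mule_natl.
rewrite /ray_cst -/c -/K.
have -> : ((c * K * (2 * K))%:E * I = (2 * K)%:E * (c%:E * (K%:E * I)))%E.
  by rewrite !muleA -!EFinM; congr (_%:E * _)%E; ring.
apply: (@le_trans _ _ ((2 * K)%:E * (tau%:E * (Psi m `|p.[0]|)%:E))%E).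
  have K2 : 2 * K != 0 by rewrite mulf_neq0// gt_eqF.
  by rewrite muleA -(EFinM (2 * K) tau) /tau mulfV// mul1e.
by apply: lee_wpmul2l => //; rewrite lee_fin mulr_ge0// ltW.
Qed.

End ray_bound.

Section diameters.
Context {R : realType} {n : nat}.
Implicit Types (A : set 'rV[R]_n) (x y z : 'rV[R]_n).

Lemma dot_ge0 x : 0 <= dot x x.
Proof. by apply: sumr_ge0 => i _; rewrite -expr2 sqr_ge0. Qed.

Lemma dot_gt0 x : x != 0 -> 0 < dot x x.
Proof.
move=> /rV0Pn[i xi]; rewrite /dot (bigD1 i)//= ltr_wpDr//.
  by apply: sumr_ge0 => j _; rewrite -expr2 sqr_ge0.
by rewrite -expr2 lt_def sqrf_eq0 xi sqr_ge0.
Qed.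

Lemma continuous_sqdist y : continuous (fun x => dot (x - y) (x - y)).
Proof.
move=> x; suff H s : (fun z : 'rV[R]_n => \sum_(i <- s) (z - y) ord0 i * (z - y) ord0 i) z @[z --> x]
    --> \sum_(i <- s) (x - y) ord0 i * (x - y) ord0 i by exact: H.
elim: s => [|i s IHs].
  have -> : (fun z : 'rV[R]_n => \sum_(i <- [::]) (z - y) ord0 i * (z - y) ord0 i) = cst 0.
    by apply/funext => z; rewrite big_nil.
  rewrite big_nil; exact: (@cvg_cst _ _ _ (nbhs x)).
rewrite big_cons.
have -> : (fun z : 'rV[R]_n => \sum_(i <- i :: s) (z - y) ord0 i * (z - y) ord0 i) =
  (fun z : 'rV[R]_n => (z - y) ord0 i * (z - y) ord0 i) \+
  (fun z => \sum_(i <- s) (z - y) ord0 i * (z - y) ord0 i).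
  by apply/funext => z; rewrite big_cons.
have ci : (fun z : 'rV[R]_n => (z - y) ord0 i) z @[z --> x] --> (x - y) ord0 i.
  have -> : (fun z : 'rV[R]_n => (z - y) ord0 i) = (fun z : 'rV[R]_n => z ord0 i - y ord0 i).
    by apply/funext => z; rewrite !mxE.
  rewrite !mxE; apply: (@cvgB R R _ (nbhs x)); first exact: coord_continuous.
  exact: cvg_cst.
by apply: (@cvgD R R _ (nbhs x)) => //; apply: (@cvgM _ _ (nbhs x)).
Qed.

Lemma closed_ball_enorm y (D : R) : closed [set x | enorm (x - y) <= D].
Proof.
rewrite (_ : [set _ | _] = (fun x => enorm (x - y)) @^-1` [set t | t <= D])//.
apply: preimage_closed; last exact: closed_le.
move=> x _; apply: (@continuous_comp _ _ _ (fun x => dot (x - y) (x - y)) Num.sqrt).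
  exact: continuous_sqdist.
exact: sqrt_continuous.
Qed.

Lemma enorm_dist_bounded A : bounded_set A ->
  exists B : R, forall x y, A x -> A y -> enorm (x - y) <= B.
Proof.
move=> /bounded_coord[M M0 AM]; exists (Num.sqrt (\sum_(i < n) (2 * M) ^+ 2)).
move=> x y Ax Ay; rewrite /enorm ler_sqrt; last by apply: sumr_ge0 => i _; exact: sqr_ge0.
apply: ler_sum => i _; rewrite -expr2 -[leLHS]ger0_norm ?sqr_ge0// normrX.
rewrite ler_sqr ?nnegrE// ?mulr_ge0 ?(ltW M0)// !mxE mulr_natl mulr2n.
by rewrite (le_trans (ler_normB _ _))// lerD// AM.
Qed.

Lemma le_diam A x y : bounded_set A -> A x -> A y -> enorm (x - y) <= diam A.
Proof.
move=> bA Ax Ay; have [B AB] := enorm_dist_bounded bA.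
apply: ub_le_sup; last by exists (x, y).
by exists B => _ [[u w] [Au Aw] <-]; exact: AB.
Qed.

Lemma diam_ge0 A : bounded_set A -> A !=set0 -> 0 <= diam A.
Proof.
move=> bA [x Ax]; apply: le_trans (le_diam bA Ax Ax).
exact: sqrtr_ge0.
Qed.

Lemma enormZ (t : R) x : enorm (t *: x) = `|t| * enorm x.
Proof.
by rewrite /enorm dotZr dotC dotZr mulrA -expr2 sqrtrM ?sqr_ge0// sqrtr_sqr.
Qed.

Lemma enormC x y : enorm (x - y) = enorm (y - x).
Proof. by rewrite /enorm -opprB dotNr dotC dotNr opprK. Qed.

Lemma le_diam_closure A x y : bounded_set A -> closure A x -> closure A y ->
  enorm (x - y) <= diam A.
Proof.
move=> bA; have step y' : A y' -> closure A `<=` [set x | enorm (x - y') <= diam A].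
  move=> Ay; rewrite [X in _ `<=` X](closure_id _).1; last exact: closed_ball_enorm.
  by apply: closureS => z Az; exact: le_diam.
move=> Ax; suff : closure A `<=` [set y | enorm (y - x) <= diam A].
  by move=> /[apply]; rewrite enormC.
rewrite [X in _ `<=` X](closure_id _).1; last exact: closed_ball_enorm.
by apply: closureS => z Az /=; rewrite enormC; exact: step.
Qed.

Lemma diam_le A (D : R) : 0 <= D -> (forall x y, A x -> A y -> enorm (x - y) <= D) ->
  diam A <= D.
Proof.
move=> D0 AD; have [->|/set0P[x Ax]] := eqVneq A set0.
  rewrite /diam (_ : [set _ | _ in _] = set0) ?sup0//.
  by apply/seteqP; split => // z [[u w] []].
apply: ge_sup; first by exists (enorm (x - x)), (x, x).
by move=> _ [[u w] [Au Aw] <-]; exact: AD.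
Qed.

End diameters.

Lemma sum_at_most_one (R : realType) (I : eqType) (s : seq I) (f : I -> \bar R)
    (B : \bar R) : uniq s -> (0 <= B)%E -> (forall i, i \in s -> (f i <= B)%E) ->
  (forall i j, i \in s -> j \in s -> f i != 0%E -> f j != 0%E -> i = j) ->
  (\sum_(i <- s) f i <= B)%E.
Proof.
move=> us B0 fB f1; have [/hasP[i si fi]|/hasPn h0] := boolP (has (fun i => f i != 0%E) s).
  rewrite (bigD1_seq i)//= big1_seq ?adde0; first exact: fB.
  move=> j /andP[ji sj]; apply/eqP; apply: contraTT isT => fj.
  by rewrite (f1 j i) ?eqxx in ji.
by rewrite big1_seq// => i /andP[_ si]; apply/eqP; rewrite -[_ == _]negbK h0.
Qed.

(** [rho^-2] compares the size of the element with the height of a cone, the bracket is the constant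
    of [cone_integral] along rays, and [n + 2] counts the vertices of a simplex, whose cones may
    overlap. *)
Definition trace_cst (R : realType) (n k : nat) (rho m : R) : R :=
  rho ^- 2 * (ray_cst k m * 2 ^+ n) * n.+2%:R.

Lemma trace_cst_ge0 (R : realType) (n k : nat) (rho m : R) : 0 <= trace_cst n k rho m.
Proof.
rewrite /trace_cst /ray_cst !mulr_ge0// ?powR_ge0// ?exprn_ge0//.
by rewrite invr_ge0 sqr_ge0.
Qed.

(** * From the faces of an element to its interior by cones *)

Section trace_inequality.
Context {R : realType} {n : nat}.
Variables (Omega : set 'rV[R]_n.+1) (M : mesh R n.+1) (Ss : set (set 'rV[R]_n.+1)).
Variables (av : set 'rV[R]_n.+1 -> 'I_n.+2 -> 'rV[R]_n.+1).
Variables (bf : set 'rV[R]_n.+1 -> 'I_n.+2 -> 'rV[R]_n.+1 * R).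
Variables (ff : set 'rV[R]_n.+1 -> 'rV[R]_n.+1 * R).
Variable Ls : seq ('rV[R]_n.+1 * R).
Variables h rho : R.
Hypothesis hM : is_mesh Omega h M.
Hypothesis hS : simplicial_submesh Omega M Ss.
Hypothesis sf : submesh_forms M Ss av bf ff Ls.
Hypothesis rho0 : 0 < rho.
Hypothesis hR : regular_submesh rho M Ss.
Hypothesis hFs : face_size_ok rho M.
Implicit Types (x y : 'rV[R]_n.+1) (z : 'rV[R]_n) (S T F : set 'rV[R]_n.+1).

Definition pull F (l : 'rV[R]_n.+1 * R) : 'rV[R]_n * R :=
  (l.1 *m (chart_frame M F)^T, aev l (chart_origin M F)).

Lemma pullE F l z : aev (pull F l) z = aev l (chart M F z).
Proof.
by rewrite /chart /aev/= dotDr dot_mulmxr addrA; congr (_ + _); rewrite addrC.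
Qed.

Definition chart_forms F : seq ('rV[R]_n * R) :=
  [seq m : 'rV[R]_n * R <- [seq pull F l | l <- Ls] | m.1 != 0].

Lemma chart_form F z : faces M F -> aev (ff F) (chart M F z) = 0.
Proof.
move=> MF; have : range (chart M F) (chart M F z) by exists z.
by rewrite (sf_face sf MF).
Qed.

Lemma chart_onto F y : faces M F -> aev (ff F) y = 0 -> exists z, chart M F z = y.
Proof.
move=> MF Fy; have : [set x | aev (ff F) x = 0] y by [].
by rewrite -(sf_face sf MF) => -[z _ <-]; exists z.
Qed.

(** Off the exceptional set, a form vanishing at the chart point has a pullback with zero linear
    part, so it vanishes on the whole hyperplane of [F]. One hyperplane contained in another is
    equal to it. *)
Lemma chart_forms_eq F z (l : 'rV[R]_n.+1 * R) : faces M F ->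
  ~ hyperplanes (chart_forms F) z ->
  l \in Ls -> aev l (chart M F z) = 0 -> forall y, aev l y = 0 <-> aev (ff F) y = 0.
Proof.
move=> MF zN lL lz; set x := chart M F z.
have p0 : (pull F l).1 = 0.
  apply/eqP; apply: contrapT => /negP p0; apply: zN; exists (pull F l).
    by rewrite mem_filter p0 map_f.
  by rewrite pullE.
have lF y : aev (ff F) y = 0 -> aev l y = 0.
  move=> /(chart_onto MF)[z' <-]; rewrite -pullE; move: lz; rewrite -pullE.
  by rewrite /aev p0 ![dot 0 _]dotC !dot0r.
move=> y; split; last exact: lF.
move=> ly; apply/eqP; apply: contrapT => /negP Fy.
have Fx : aev (ff F) x = 0 by exact: chart_form.
(* A zero [y] of [l] off the hyperplane of [F] would allow moving [w] along [y - x], without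
   changing [l], into that hyperplane, where [l] is zero; but [l] equals the squared norm of [l.1]
   at [w]. *)
pose w := x + 1 *: l.1.
pose s := aev (ff F) w / aev (ff F) y.
have e1 : dot (ff F).1 (y - x) = aev (ff F) y.
  by rewrite -[RHS]subr0 -Fx /aev dotDr dotNr; ring.
have e2 : dot l.1 (y - x) = 0.
  by rewrite -[RHS](subrr 0) -{1}ly -lz /aev dotDr dotNr; ring.
have : aev l (w + (- s) *: (y - x)) = 0.
  by apply: lF; rewrite aevD e1 /s mulNr divfK// subrr.
rewrite aevD e2 mulr0 addr0 /w aevD lz add0r mul1r => h0.
by have := dot_gt0 (sf_neq0 sf lL); rewrite h0 ltxx.
Qed.

Lemma generic_chart F z : faces M F -> ~ hyperplanes (chart_forms F) z ->
  generic Ls (chart M F z).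
Proof.
move=> MF zN l1 l2 l1L l2L l1z l2z y.
by rewrite (chart_forms_eq MF zN l1L l1z) (chart_forms_eq MF zN l2L l2z).
Qed.

Lemma cone_in_simplex S j x (t : R) : Ss S -> generic Ls x -> closure S x ->
  aev (bf S j) x = 0 -> 0 < t -> t < 1 -> S (x + t *: (av S j - x)).
Proof.
move=> SS gx Sx xj t0 t1; rewrite [X in X _](simplex_def sf SS) => i /=.
have [_ _ bd] := sf_bary sf SS; rewrite aev_conv bd.
have [->|ij] := eqVneq i j; first by rewrite xj mulr0 add0r mulr1.
rewrite mulr0 addr0 mulr_gt0 ?subr_gt0// lt_def (generic_facet sf SS gx xj ij)/=.
by move: Sx; rewrite (closure_simplex_def sf SS); exact.
Qed.

(** The part of [F] on the facet of [S] opposite the vertex [j], without the null set of chart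
    points where genericity may fail. *)
Definition facet_part F S j : set 'rV[R]_n :=
  [set z | [/\ F (chart M F z), ~ hyperplanes (chart_forms F) z,
    closure S (chart M F z) & aev (bf S j) (chart M F z) = 0]].

Lemma measurable_facet_part F S j : faces M F -> measurable (facet_part F S j).
Proof.
move=> MF; rewrite (_ : facet_part F S j = (chart M F @^-1` F `&`
    ~` hyperplanes (chart_forms F)) `&` (chart M F @^-1` closure S `&`
    [set z | dot (pull F (bf S j)).1 z = - (pull F (bf S j)).2])).
  apply: measurableI.
    apply: measurableI; first exact: (measurable_chart_preimage hM).
    by apply: measurableC; exact: measurable_hyperplanes.
  apply: measurableI; last exact: measurable_hyperplane.
  rewrite -[X in measurable X]setTI; apply: measurable_chart => //.
  by apply: closed_measurable_rV; exact: closed_closure.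
apply/seteqP; split => z /=.
  move=> [? ? ?]; rewrite -pullE => /eqP; rewrite /aev addr_eq0 => /eqP ?.
  by split.
move=> [[? ?] [? e]]; split => //; rewrite -pullE /aev e addNr//.
Qed.

Lemma face_cover T F z : elements M T -> faces_of M T F -> F (chart M F z) ->
  ~ hyperplanes (chart_forms F) z ->
  exists S j, [/\ Ss S, S `<=` T & facet_part F S j z].
Proof.
move=> MT [MF FT] Fz zN.
have [S [j [SS ST Sz jz]]] := bdry_element_facet hM hS sf MT (FT _ Fz).
by exists S, j.
Qed.

Lemma facet_partE F S j z y : faces M F -> Ss S -> facet_part F S j z ->
  aev (bf S j) y = 0 <-> aev (ff F) y = 0.
Proof.
move=> MF SS [_ zN _ jz]; apply: (chart_forms_eq MF zN) => //; exact: (sf_bfL sf).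
Qed.

Lemma facet_part_chart F S j z z' : faces M F -> Ss S -> facet_part F S j z ->
  aev (bf S j) (chart M F z') = 0.
Proof. by move=> MF SS Az; apply/(facet_partE _ MF SS Az); exact: chart_form. Qed.

(** In the simplex the form is at most 1, so moving against its gradient by 1 over the norm of the
    gradient makes it nonpositive and leaves the simplex; a ball in the simplex cannot have a larger
    radius. *)
Lemma inradius_bary S j : Ss S -> inradius S * enorm (bf S j).1 <= 1.
Proof.
move=> SS; have [b1 ba bd] := sf_bary sf SS; set l := bf S j.
have l0 : l.1 != 0 by apply: (sf_neq0 sf); exact: (sf_bfL sf).
have d0 := dot_gt0 l0.
have e0 : 0 < enorm l.1 by rewrite sqrtr_gt0.
have e2 : enorm l.1 ^+ 2 = dot l.1 l.1 by rewrite sqr_sqrtr// ltW.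
rewrite -ler_pdivlMr// mul1r; apply: ge_sup.
  exists 0; split => //; exists 0 => y /=.
  by rewrite ltNge sqrtr_ge0.
move=> r [r0 [x xS]]; rewrite leNgt; apply/negP => hr.
have rp : 0 < r by apply: lt_trans hr; rewrite invr_gt0.
have Sx : S x by apply: xS; rewrite /= subrr /enorm dot0r sqrtr0.
have lx : aev l x <= 1.
  rewrite -(b1 x) (bigD1 j)//= lerDl; apply: sumr_ge0 => i _.
  by move: Sx; rewrite [X in X x -> _](simplex_def sf SS) => /(_ i) /ltW.
have : S (x + (- (dot l.1 l.1)^-1) *: l.1).
  apply: xS; rewrite /= addrC addKr enormZ normrN ger0_norm ?invr_ge0 ?(ltW d0)//.
  by rewrite -e2 expr2 invfM -mulrA mulVf ?mulr1// gt_eqF.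
rewrite [X in X _ -> _](simplex_def sf SS) => /(_ j) /=; rewrite -/l aevD mulNr mulVf ?gt_eqF//.
by rewrite subr_gt0 ltNge lx.
Qed.

Lemma element_bounded T : elements M T -> bounded_set T.
Proof. by case: hM => -[_ hT _] _ _ _ _ /hT[_ []]. Qed.

Lemma element_nonempty T : elements M T -> T !=set0.
Proof. by case: hM => -[_ hT _] _ _ _ _ /hT[]. Qed.

(** The determinant is the height over the facet, which is at least the inradius of [S], hence at
    least [rho diam S], hence at least [rho^2 diam T]. *)
Lemma cone_det_ge T F S j z : elements M T -> faces M F -> Ss S -> S `<=` T ->
  facet_part F S j z ->
  rho ^+ 2 * diam T <= `|\det (cone_mx (av S j) (chart_origin M F) (chart_frame M F))|.
Proof.
move=> MT MF SS ST Az; have [b1 ba bd] := sf_bary sf SS.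
have ba1 : aev (bf S j) (av S j) = 1 by rewrite bd eqxx.
have E := cone_mx_det (frame_orthonormal hM MF) ba1 (fun z' => facet_part_chart z' MF SS Az).
set D := `|\det _| in E *.
have D0 : 0 < D by exact: (cone_mx_gt0 (frame_orthonormal hM MF) ba1 (fun z' => facet_part_chart z' MF SS Az)).
have l0 : (bf S j).1 != 0 by apply: (sf_neq0 sf); exact: (sf_bfL sf).
have e0 : 0 < enorm (bf S j).1 by rewrite sqrtr_gt0 dot_gt0.
have e2 : enorm (bf S j).1 ^+ 2 = dot (bf S j).1 (bf S j).1 by rewrite sqr_sqrtr// dot_ge0.
have De : D * enorm (bf S j).1 = 1.
  move: E; rewrite -e2 -exprMn => /eqP; rewrite sqrf_eq1 => /orP[/eqP//|/eqP H].
  have : 0 < D * enorm (bf S j).1 by rewrite mulr_gt0.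
  by rewrite H oppr_gt0 ltr10.
have [hr1 hr2] := hR.
have : inradius S <= D.
  by rewrite -(ler_pM2r e0) De; exact: inradius_bary.
apply: le_trans; apply: le_trans (hr1 S SS).
by rewrite expr2 -mulrA ler_pM2l//; exact: hr2.
Qed.

Lemma face_size_le T F : elements M T -> faces_of M T F -> face_size M F <= diam T.
Proof.
move=> MT FT; have := hFs FT.1; case: ifP => [_ [_ /(_ T MT FT)/andP[]]//|_ ->].
apply: diam_le; first by apply: diam_ge0; [exact: element_bounded|exact: element_nonempty].
move=> x y Fx Fy; apply: le_diam_closure; first exact: element_bounded.
  by have [] := FT.2 _ Fx.
by have [] := FT.2 _ Fy.
Qed.

(** For [d = 1] positivity is part of the convention on [h_F]. Otherwise the face contains a facet
    of a simplex, which has two distinct vertices. *)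
Lemma face_size_gt0 T F x : elements M T -> faces_of M T F -> F x -> 0 < face_size M F.
Proof.
move=> MT FT Fx; have := hFs FT.1; case: ifPn => [_ []//|n0 ->].
have [S [j [SS SF _ _]]] := face_facet hS sf FT.1 Fx.
have [_ _ bd] := sf_bary sf SS.
have vF i : i != j -> F (av S i).
  by move=> ij; apply: SF; split => [k|]; rewrite bd ?ler0n// eq_sym (negbTE ij).
have n1 : (0 < n)%N by rewrite lt0n.
pose i0 := lift j (ord0 : 'I_n.+1); pose i1 := lift j (ord_max : 'I_n.+1).
have i01 : i0 != i1.
  by rewrite (inj_eq lift_inj) -val_eqE/= eq_sym -lt0n.
have F0 : F (av S i0) by apply: vF; rewrite eq_sym neq_lift.
have F1 : F (av S i1) by apply: vF; rewrite eq_sym neq_lift.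
apply: (@lt_le_trans _ _ (enorm (av S i0 - av S i1))).
  rewrite sqrtr_gt0 dot_gt0// subr_eq0; apply/eqP => E.
  have := bd i0 i1; rewrite -E bd eqxx (negbTE i01) => /eqP.
  by rewrite oner_eq0.
apply: ub_le_sup; last by exists (av S i0, av S i1).
exists (diam T) => _ [[u w] [Fu Fw] <-]; apply: le_diam_closure.
- exact: element_bounded.
- by have [] := FT.2 _ Fu.
- by have [] := FT.2 _ Fw.
Qed.

Definition facet_cone F S j : set 'rV[R]_n.+1 :=
  cone (av S j) (chart_origin M F) (chart_frame M F) (bf S j) (facet_part F S j).

(** [z] is the central projection of [X] from the vertex onto the base, determined by [S], [j] and
    [X]. As its chart point is generic, the ray from it to the vertex runs inside the open
    simplex. *)
Lemma facet_coneP F S j X : faces M F -> Ss S -> facet_cone F S j X ->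
  exists z, [/\ facet_part F S j z, S X &
    chart M F z = (1 - aev (bf S j) X)^-1 *: (X - aev (bf S j) X *: av S j)].
Proof.
move=> MF SS [/andP[]]; set t := aev (bf S j) X => t0 t1 Az.
have [b1 ba bd] := sf_bary sf SS.
have u0 : 0 < 1 - t by lra.
set p := (1 - t)^-1 *: (X - t *: av S j).
set z := cone_coord _ _ _ _ _ in Az.
have zE : chart M F z = p.
  have [z' z'p] : exists z', chart M F z' = p.
    apply: chart_onto => //; apply/(facet_partE _ MF SS Az).
    have pE : p = X + (- t / (1 - t)) *: (av S j - X).
      by apply/rowP => i; rewrite !mxE; field; rewrite gt_eqF.
    have da : dot (bf S j).1 (av S j - X) = 1 - t.
      have <- : aev (bf S j) (av S j) = 1 by rewrite bd eqxx.
      by rewrite /t /aev dotDr dotNr; ring.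
    by rewrite pE aevD da divfK ?gt_eqF// subrr.
  rewrite -z'p; congr (chart M F _).
  rewrite /z /cone_coord -/t powR_inv1 ?(ltW u0)// -/p -z'p /chart addrC addKr.
  by rewrite -mulmxA (frame_orthonormal hM MF) mulmx1.
exists z; split => //.
have XE : X = chart M F z + t *: (av S j - chart M F z).
  by rewrite zE; apply/rowP => i; rewrite !mxE; field; rewrite gt_eqF.
have [_ zN Sz zj] := Az.
by rewrite XE; apply: cone_in_simplex => //; [exact: generic_chart|lra].
Qed.

(** For a fixed vertex index the cones are disjoint: [X] lies in only one simplex, and its
    projection from the vertex is generic, hence on only one face. *)
Lemma facet_cone_inj F1 F2 S1 S2 j X : faces M F1 -> faces M F2 -> Ss S1 -> Ss S2 ->
  facet_cone F1 S1 j X -> facet_cone F2 S2 j X -> S1 = S2 /\ F1 = F2.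
Proof.
move=> MF1 MF2 SS1 SS2 /(facet_coneP MF1 SS1)[z1 [[Fz1 zN1 _ _] SX1 E1]].
move=> /(facet_coneP MF2 SS2)[z2 [[Fz2 _ _ _] SX2 E2]].
have S12 : S1 = S2.
  by case: hS => -[_ _ tS _ _] _ _ _; apply: tS => //; exists X.
split => //; rewrite -S12 -E1 in E2; rewrite E2 in Fz2.
by apply: (generic_face_inj hM hS sf MF1 MF2 Fz1 Fz2); exact: generic_chart.
Qed.

Lemma measurable_facet_cone F S j : faces M F -> measurable (facet_cone F S j).
Proof. by move=> MF; apply: measurable_cone; exact: measurable_facet_part. Qed.

Variables (T : set 'rV[R]_n.+1) (k : nat) (v : mpoly.mpoly n.+1 R) (m : R).
Hypotheses (MT : elements M T) (vk : degree_le k v) (m0 : 0 <= m).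

Let g X : R := Psi m `|peval v X|.
Let c : R := ray_cst k m * 2 ^+ n.

Let mg : measurable_fun setT g.
Proof.
apply: (measurableT_comp (measurable_Psi m)); apply: measurableT_comp => //.
exact: measurable_peval.
Qed.

Let g0 X : 0 <= g X.
Proof. exact: Psi_ge0. Qed.

Let ray_cst_ge0 : 0 <= ray_cst k m.
Proof. by rewrite !mulr_ge0 ?powR_ge0. Qed.

Let c0 : 0 <= c.
Proof. by rewrite mulr_ge0 ?exprn_ge0. Qed.

Let mgF F : measurable_fun setT (fun z => g (chart M F z)).
Proof. by apply: (measurableT_comp mg); exact: measurable_chart. Qed.

(** The cone estimate combined with [face_size M F <= diam T <= rho^-2 |det|]; its hypothesis on
    rays is [poly_ray_bound] for the restriction of [v] to the ray towards [av S j]. *)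
Lemma facet_bound F S j : faces_of M T F -> Ss S -> S `<=` T ->
  ((face_size M F)%:E * \int[lebesgue_rV R n]_(z in facet_part F S j) (g (chart M F z))%:E <=
   (rho ^- 2 * c)%:E * \int[lebesgue_rV R n.+1]_(X in facet_cone F S j) (g X)%:E)%E.
Proof.
move=> FT SS ST; have MF := FT.1.
have rc : 0 <= rho ^- 2 * c by rewrite mulr_ge0// invr_ge0 exprn_ge0// ltW.
have Ic : (0 <= \int[lebesgue_rV R n.+1]_(X in facet_cone F S j) (g X)%:E)%E.
  by apply: integral_ge0 => X _; rewrite lee_fin.
have [A0|/set0P[z0 Az0]] := eqVneq (facet_part F S j) set0.
  by rewrite A0 integral_set0 mule0 mule_ge0.
have [b1 ba bd] := sf_bary sf SS.
have ba1 : aev (bf S j) (av S j) = 1 by rewrite bd eqxx.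
have IA : (0 <= \int[lebesgue_rV R n]_(z in facet_part F S j) (g (chart M F z))%:E)%E.
  by apply: integral_ge0 => X _; rewrite lee_fin.
have := cone_integral (frame_orthonormal hM MF) ba1
  (fun z' => facet_part_chart z' MF SS Az0) (measurable_facet_part S j MF) mg g0 (mgF F)
  (fun z => g0 (chart M F z)) ray_cst_ge0.
rewrite -/(facet_cone F S j) -/c.
have ray_hyp (z : 'rV[R]_n) : facet_part F S j z -> ((g (chart M F z))%:E <= (ray_cst k m)%:E *
    \int[lebesgue_measure]_(t in `]0%R, (1 / 2)%R[)
      (g (chart M F z + t *: (av S j - chart M F z)))%:E)%E.
  move=> _; have := poly_ray_bound m0 (size_line_poly (chart M F z) (av S j - chart M F z) vk).
  rewrite line_polyE scale0r addr0; congr (_ <= _ * _)%E.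
  by apply: eq_integral => t _; rewrite line_polyE.
move=> /(_ ray_hyp); set D := `|_| => H.
apply: (@le_trans _ _ ((rho ^- 2)%:E * (D%:E *
    \int[lebesgue_rV R n]_(z in facet_part F S j) (g (chart M F z))%:E))%E).
  rewrite muleA -EFinM; apply: lee_wpmul2r => //; rewrite lee_fin.
  rewrite mulrC ler_pdivlMr ?exprn_gt0//.
  apply: le_trans (cone_det_ge MT MF SS ST Az0).
  by rewrite mulrC ler_wpM2l ?sqr_ge0//; exact: face_size_le.
rewrite EFinM -muleA; apply: lee_wpmul2l => //.
by rewrite lee_fin invr_ge0 sqr_ge0.
Qed.

Let Ts : seq (set 'rV[R]_n.+1) := enum_set [set S | Ss S /\ S `<=` T].

Let TsP S : S \in Ts -> Ss S /\ S `<=` T.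
Proof.
rewrite /Ts mem_enum_set ?inE//; apply: sub_finite_set (_ : _ `<=` Ss) _ => [? []//|].
by case: hS => -[].
Qed.

Let TsI S : Ss S -> S `<=` T -> S \in Ts.
Proof.
move=> SS ST; rewrite /Ts mem_enum_set ?inE//.
apply: sub_finite_set (_ : _ `<=` Ss) _ => [? []//|]; by case: hS => -[].
Qed.

(** The facet parts cover the face up to a null set; overlaps only enlarge the right-hand side. *)
Let face_integral_le F : faces_of M T F ->
  (\int[lebesgue_rV R n]_(z in chart M F @^-1` F) (g (chart M F z))%:E <=
   \sum_(S <- Ts) \sum_(j < n.+2)
     \int[lebesgue_rV R n]_(z in facet_part F S j) (g (chart M F z))%:E)%E.
Proof.
move=> FT; have MF := FT.1.
pose G z := (g (chart M F z))%:E.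
have mG : measurable_fun setT G by apply/measurable_EFinP; exact: mgF.
have G0 z : (0 <= G z)%E by rewrite lee_fin.
have mA := measurable_facet_part.
have mGA S j : measurable_fun setT (G \_ (facet_part F S j)).
  by apply/(measurable_restrictT _ (mA F S j MF)); exact: measurable_funTS.
have GA0 S j z : (0 <= (G \_ (facet_part F S j)) z)%E.
  by rewrite patchE; case: ifP.
have mC := measurable_chart_preimage hM MF.
have mH := measurable_hyperplanes (chart_forms F).
have null : lebesgue_rV R n (hyperplanes (chart_forms F)) = 0%E.
  by apply: hyperplanes_null => l; rewrite mem_filter => /andP[].
have -> := ge0_negligible_integral mH mC (measurable_funTS mG) (fun z _ => G0 z) null.
rewrite [leLHS]integral_mkcond.
under eq_bigr do under eq_bigr do rewrite integral_mkcond.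
under eq_bigr do rewrite -ge0_integral_sum_seq//.
rewrite -ge0_integral_sum_seq//; last 2 first.
- by move=> S _; apply: emeasurable_sum => j.
- by move=> S z _; apply: sume_ge0 => j _.
apply: ge0_le_integral => //.
- by move=> z _; rewrite patchE; case: ifP.
- by apply/(measurable_restrictT _ (measurableD mC mH)); exact: measurable_funTS.
- by apply: emeasurable_sum => S; apply: emeasurable_sum => j.
move=> z _; rewrite patchE; case: ifPn => [|_]; last first.
  by apply: sume_ge0 => S _; apply: sume_ge0 => j _.
rewrite inE => -[Fz zN]; have [S [j [SS ST Az]]] := face_cover MT FT Fz zN.
rewrite (bigD1_seq S)//=; [|exact: TsI|exact: enum_set_uniq].
rewrite (bigD1 j)//= patchE mem_set// -addeA leeDl// adde_ge0//.
  by apply: sume_ge0 => l _.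
by apply: sume_ge0 => S' _; apply: sume_ge0 => l _.
Qed.

(** For each of the [n + 2] vertex indices at most one cone contains [X], and it lies in [T]. *)
Let cone_sum_le X :
  (\sum_(F <- enum_set (faces_of M T)) \sum_(S <- Ts) \sum_(j < n.+2)
     ((EFin \o g) \_ (facet_cone F S j)) X <=
   n.+2%:R%:E * ((EFin \o g) \_ T) X)%E.
Proof.
have fT F : F \in enum_set (faces_of M T) -> faces_of M T F.
  by rewrite mem_enum_set ?inE//; exact: (finite_faces_of hM).
under eq_bigr do rewrite exchange_big/=.
rewrite exchange_big/=.
have gT0 : (0 <= ((EFin \o g) \_ T) X)%E.
  by rewrite patchE; case: ifP => // _; rewrite lee_fin.
apply: (@le_trans _ _ (\sum_(j < n.+2) ((EFin \o g) \_ T) X)%E); last first.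
  by rewrite sumr_const card_ord mule_natl.
apply: lee_sum => j _.
have hit F S : ((EFin \o g) \_ (facet_cone F S j)) X != 0%E -> facet_cone F S j X.
  by rewrite patchE; case: ifPn; rewrite ?eqxx// inE.
have inT F S : F \in enum_set (faces_of M T) -> S \in Ts -> facet_cone F S j X -> T X.
  move=> /fT[MF _] /TsP[SS ST] /(facet_coneP MF SS)[z [_ SX _]]; exact: ST.
have inner F : F \in enum_set (faces_of M T) ->
    (\sum_(S <- Ts) ((EFin \o g) \_ (facet_cone F S j)) X <= ((EFin \o g) \_ T) X)%E.
  move=> FM; apply: sum_at_most_one => //; first exact: enum_set_uniq.
    move=> S ST; rewrite [leLHS]patchE; case: ifPn => // ; rewrite inE => CX.
    by rewrite patchE mem_set//; exact: inT CX.
  move=> S1 S2 S1T S2T /hit C1 /hit C2; have [MF _] := fT F FM.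
  by have [] := facet_cone_inj MF MF (TsP S1T).1 (TsP S2T).1 C1 C2.
apply: sum_at_most_one => //; first exact: enum_set_uniq.
have ex F : (\sum_(S <- Ts) ((EFin \o g) \_ (facet_cone F S j)) X)%E != 0%E ->
    exists2 S, S \in Ts & facet_cone F S j X.
  move=> h0; have [/hasP[S ST /hit]|/hasPn h1] := boolP (has (fun S => ((EFin \o g) \_ (facet_cone F S j)) X != 0%E) Ts).
    by exists S.
  by move: h0; rewrite big1_seq ?eqxx// => S /andP[_ ST]; apply/eqP; rewrite -[_ == _]negbK h1.
move=> F1 F2 F1M F2M /ex[S1 S1T C1] /ex[S2 S2T C2].
have [MF1 _] := fT F1 F1M; have [MF2 _] := fT F2 F2M.
by have [] := facet_cone_inj MF1 MF2 (TsP S1T).1 (TsP S2T).1 C1 C2.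
Qed.

Lemma trace_inequality :
  (\sum_(F <- enum_set (faces_of M T)) (face_size M F)%:E *
     \int[lebesgue_rV R n]_(z in chart M F @^-1` F) (Psi m `|peval v (chart M F z)|)%:E <=
   (trace_cst n k rho m)%:E *
     \int[lebesgue_rV R n.+1]_(X in T) (Psi m `|peval v X|)%:E)%E.
Proof.
have fT F : F \in enum_set (faces_of M T) -> faces_of M T F.
  by rewrite mem_enum_set ?inE//; exact: (finite_faces_of hM).
have rc : 0 <= rho ^- 2 * c by rewrite mulr_ge0// invr_ge0 sqr_ge0.
have mE : measurable_fun setT (EFin \o g) by apply/measurable_EFinP.
have mgC F S j : faces M F -> measurable_fun setT ((EFin \o g) \_ (facet_cone F S j)).
  move=> MF; apply/(measurable_restrictT _ (measurable_facet_cone S j MF)).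
  exact: measurable_funTS.
have gC0 F S j X : (0 <= ((EFin \o g) \_ (facet_cone F S j)) X)%E.
  by rewrite patchE; case: ifP => // _; rewrite lee_fin.
have I0 F S j : (0 <= \int[lebesgue_rV R n.+1]_(X in facet_cone F S j) (g X)%:E)%E.
  by apply: integral_ge0 => X _; rewrite lee_fin.
have IA0 F S j : (0 <= \int[lebesgue_rV R n]_(z in facet_part F S j) (g (chart M F z))%:E)%E.
  by apply: integral_ge0 => X _; rewrite lee_fin.
have mT := measurable_element hM MT.
apply: (@le_trans _ _ ((rho ^- 2 * c)%:E * \sum_(F <- enum_set (faces_of M T))
    \sum_(S <- Ts) \sum_(j < n.+2)
      \int[lebesgue_rV R n.+1]_(X in facet_cone F S j) (g X)%:E)%E).
  rewrite ge0_sume_distrr; last by move=> F _; do 2 (apply: sume_ge0 => ? _).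
  rewrite big_seq [leRHS]big_seq; apply: lee_sum => F FM; have FT := fT F FM.
  have [F0|/set0P[x Fx]] := eqVneq F set0.
    rewrite {2 3}F0 preimage_set0 integral_set0 mule0 mule_ge0 ?lee_fin//.
    by do 2 (apply: sume_ge0 => ? _).
  have hF0 := face_size_gt0 MT FT Fx.
  apply: (@le_trans _ _ ((face_size M F)%:E * \sum_(S <- Ts) \sum_(j < n.+2)
     \int[lebesgue_rV R n]_(z in facet_part F S j) (g (chart M F z))%:E)%E).
    apply: lee_wpmul2l; first by rewrite lee_fin ltW.
    exact: face_integral_le.
  rewrite !ge0_sume_distrr; last 2 first.
  - by move=> S _; apply: sume_ge0.
  - by move=> S _; apply: sume_ge0.
  rewrite big_seq [leRHS]big_seq; apply: lee_sum => S /TsP[SS ST].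
  rewrite !ge0_sume_distrr//; apply: lee_sum => j _; exact: facet_bound.
rewrite (EFinM _ n.+2%:R) -muleA; apply: lee_wpmul2l; first by rewrite lee_fin.
have -> : (\sum_(F <- enum_set (faces_of M T)) \sum_(S <- Ts) \sum_(j < n.+2)
      \int[lebesgue_rV R n.+1]_(X in facet_cone F S j) (g X)%:E =
    \int[lebesgue_rV R n.+1]_X \sum_(F <- enum_set (faces_of M T)) \sum_(S <- Ts)
      \sum_(j < n.+2) ((EFin \o g) \_ (facet_cone F S j)) X)%E.
  rewrite ge0_integral_sum_seq; last 2 first.
  - move=> F /fT[MF _]; apply: emeasurable_sum => S; apply: emeasurable_sum => j.
    exact: mgC.
  - by move=> F X _; do 2 (apply: sume_ge0 => ? _).
  apply: eq_big_seq => F /fT[MF _]; rewrite ge0_integral_sum_seq; last 2 first.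
  - by move=> S _; apply: emeasurable_sum => j; exact: mgC.
  - by move=> S X _; apply: sume_ge0.
  apply: eq_bigr => S _; rewrite ge0_integral_sum//; last by move=> j; exact: mgC.
  by apply: eq_bigr => j _; rewrite [LHS]integral_mkcond.
have mgT : measurable_fun setT ((EFin \o g) \_ T).
  by apply/(measurable_restrictT _ mT); exact: measurable_funTS.
have gT0 X : (0 <= ((EFin \o g) \_ T) X)%E.
  by rewrite patchE; case: ifP => // _; rewrite lee_fin.
rewrite [X in (_ <= _ * X)%E]integral_mkcond -/(EFin \o g) -ge0_integralZl_EFin//.
apply: ge0_le_integral => //.
- by move=> X _; do 3 (apply: sume_ge0 => ? _).
- apply: emeasurable_sum_seq => F /fT[MF _]; apply: emeasurable_sum => S.
  by apply: emeasurable_sum => j; exact: mgC.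
- exact: emeasurable_funM.
Qed.

End trace_inequality.

(** * The discrete norm *)

Section energy.
Context {R : realType} {n : nat}.
Implicit Types (M : mesh R n.+1) (v : dofs R n.+1) (p : R).

(** The p-th power of the discrete norm, with integrals in place of norms. *)
Definition energy M p v : \bar R :=
  (\sum_(T <- enum_set (elements M))
    (\int[lebesgue_rV R n.+1]_(x in T) (grad_norm (vT v T) x `^ p)%:E +
     \sum_(F <- enum_set (faces_of M T)) (face_size M F `^ (1 - p))%:E *
       \int[lebesgue_rV R n]_(z in chart M F @^-1` F) (`|jump M v T F z| `^ p)%:E))%E.

Lemma Lpnorm_powR (d : nat) p (A : set 'rV[R]_d) (f : 'rV[R]_d -> R) : p != 0 ->
  (Lpnorm p A f `^ p = \int[lebesgue_rV R d]_(x in A) (`|f x| `^ p)%:E)%E.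
Proof.
move=> p0; rewrite /Lpnorm (poweR_Lnorm _ _ p0) [RHS]integral_mkcond.
apply: eq_integral => x _; rewrite /= !patchE; case: ifP => // _.
by rewrite normr0 powR0.
Qed.

Lemma grad_norm_ge0 (d : nat) (w : mpoly.mpoly d R) x : 0 <= grad_norm w x.
Proof. exact: sqrtr_ge0. Qed.

Lemma norm_1phE Omega h M p v : is_mesh Omega h M -> p != 0 ->
  norm_1ph M p v = (energy M p v `^ p^-1)%E.
Proof.
move=> hM p0; rewrite /norm_1ph /energy fsbig_finite; last exact: finite_elements hM.
rewrite -/(enum_set _); congr (_ `^ _)%E; apply: eq_bigr => T _; rewrite Lpnorm_powR//.
have -> : (\int[lebesgue_rV R n.+1]_(x in T) (`|grad_norm (vT v T) x| `^ p)%:E =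
    \int[lebesgue_rV R n.+1]_(x in T) (grad_norm (vT v T) x `^ p)%:E)%E.
  by apply: eq_integral => x _; rewrite (ger0_norm (grad_norm_ge0 _ _)).
rewrite fsbig_finite; last exact: finite_faces_of hM _.
rewrite -/(enum_set _); apply: (f_equal (fun e : \bar R => (_ + e)%E)).
by apply: eq_bigr => F _; rewrite /face_Lpnorm (@Lpnorm_powR n _ _ _ p0).
Qed.

Lemma measurable_grad_norm (w : mpoly.mpoly n.+1 R) : measurable_fun setT (grad_norm w).
Proof.
rewrite /grad_norm /enorm /dot.
apply: (@measurableT_comp _ _ _ _ _ _ (@Num.sqrt R)).
  by apply: continuous_measurable_fun; exact: sqrt_continuous.
apply: measurable_sum => i; under eq_fun do rewrite mxE.
by apply: measurable_funM; exact: measurable_peval.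
Qed.

Lemma mderiv_le_grad (w : mpoly.mpoly n.+1 R) i x :
  `|peval (mpoly.mderiv i w) x| <= grad_norm w x.
Proof.
rewrite -sqrtr_sqr /grad_norm /enorm ler_sqrt; last exact: dot_ge0.
rewrite /dot (bigD1 i)//= mxE expr2 lerDl.
by apply: sumr_ge0 => j _; rewrite -expr2 sqr_ge0.
Qed.

Lemma measurable_jump M v T F : measurable_fun setT (jump M v T F).
Proof.
apply: measurable_funB; first exact: (@measurable_peval R n).
by apply: (measurableT_comp (measurable_peval _)); exact: measurable_chart.
Qed.

(** A box replaces the domain in the estimates, because elements are known to lie in its closure
    only. *)
Lemma closure_box (Omega : set 'rV[R]_n.+1) : bounded_set Omega ->
  exists D, [/\ measurable D, closure Omega `<=` D & (lebesgue_rV R n.+1 D < +oo)%E].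
Proof.
move=> bO; have [B B0 OB] := bounded_coord bO.
pose D := [set x : 'rV[R]_n.+1 | forall i, `[- B, B]%classic (x ord0 i)].
have cD : closed D.
  apply: closed_forall => i.
  by apply: (@preimage_closed _ _ (fun z : 'rV[R]_n.+1 => z ord0 i) `[- B, B]%classic); [move=> z _; exact: coord_continuous|exact: interval_closed].
exists D; split; first exact: closed_measurable_rV.
  rewrite [X in _ `<=` X](closure_id _).1//; apply: closureS => x Ox i /=.
  by rewrite in_itv/= -ler_norml; exact: OB.
rewrite (lebesgue_rV_box (fun=> measurable_itv _)) lebesgue_measure_itv/= lte_fin gtrN// -EFinB.
by rewrite prodEFin ltey.
Qed.

End energy.

(** * The variation bounded by the energy *)

Section main_estimate.
Context {R : realType} {n : nat}.
Variables (Omega : set 'rV[R]_n.+1) (M : mesh R n.+1) (Ss : set (set 'rV[R]_n.+1)).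
Variables (av : set 'rV[R]_n.+1 -> 'I_n.+2 -> 'rV[R]_n.+1).
Variables (bf : set 'rV[R]_n.+1 -> 'I_n.+2 -> 'rV[R]_n.+1 * R).
Variables (ff : set 'rV[R]_n.+1 -> 'rV[R]_n.+1 * R).
Variable Ls : seq ('rV[R]_n.+1 * R).
Variables h rho : R.
Hypothesis hM : is_mesh Omega h M.
Hypothesis hS : simplicial_submesh Omega M Ss.
Hypothesis sf : submesh_forms M Ss av bf ff Ls.
Hypothesis bO : bounded_set Omega.
Hypothesis rho0 : 0 < rho.
Hypothesis hR : regular_submesh rho M Ss.
Hypothesis hFs : face_size_ok rho M.
Implicit Types (x y : 'rV[R]_n.+1) (z : 'rV[R]_n) (S T F : set 'rV[R]_n.+1).
Variables (D : set 'rV[R]_n.+1) (k : nat) (p a s : R).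
Hypotheses (mD : measurable D) (OD : closure Omega `<=` D).
Hypotheses (p1 : 1 <= p) (a1 : 1 <= a) (s1 : 1 <= s).
Hypothesis sn : (0 < n)%N -> s = n.+1%:R / n%:R.
Variables (eps C : R).
Hypotheses (eps0 : 0 < eps) (C0 : 0 <= C).
Hypothesis young : forall u b h, 0 <= u -> 0 <= b -> 0 < h ->
  a * u `^ (a - 1) * b <= eps * h * (1 + u `^ (a * s)) + C * h `^ (1 - p) * b `^ p.
Variable v : dofs R n.+1.
Hypothesis hv : Uh0 Omega M k v.

Let m : R := a * s.
Let m0 : 0 <= m.
Proof. by rewrite mulr_ge0// (le_trans ler01). Qed.

(* The absolute value keeps this nonnegative for sets [F] that are not faces. *)
Let KTF T F z : R := 2 * (eps * `|face_size M F| * Psi m `|peval (vT v T) (chart M F z)| +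
  C * face_size M F `^ (1 - p) * `|jump M v T F z| `^ p).

(** Inside an element Young's inequality is used with [h = 1]; on a face, in [KTF], with [h] the
    size of the face. *)
Let ET T x : R := eps * Psi m `|peval (vT v T) x| + C * grad_norm (vT v T) x `^ p.

Let E x : \bar R :=
  (\sum_(T <- enum_set (elements M)) ((EFin \o ET T) \_ T) x)%E.

Let KTF0 T F z : 0 <= KTF T F z.
Proof. by rewrite mulr_ge0// addr_ge0// !mulr_ge0// ?Psi_ge0 ?powR_ge0// ltW. Qed.

Let ET0 T x : 0 <= ET T x.
Proof. by rewrite addr_ge0// mulr_ge0// ?Psi_ge0 ?powR_ge0// ltW. Qed.

Let measurable_PsiT T : measurable_fun setT (fun x => Psi m `|peval (vT v T) x|).
Proof.
apply: (measurableT_comp (measurable_Psi m)); apply: measurableT_comp => //.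
exact: measurable_peval.
Qed.

Let measurable_PsiF T F : measurable_fun setT (fun z => Psi m `|peval (vT v T) (chart M F z)|).
Proof. exact: (measurableT_comp (measurable_PsiT T) (measurable_chart M F)). Qed.

Let measurable_jumpF T F : measurable_fun setT (fun z => `|jump M v T F z| `^ p).
Proof.
apply: (measurableT_comp (measurable_powR p)); apply: measurableT_comp => //.
exact: measurable_jump.
Qed.

Let measurable_gradT T : measurable_fun setT (fun x => grad_norm (vT v T) x `^ p).
Proof. by apply: (measurableT_comp (measurable_powR p)); exact: measurable_grad_norm. Qed.

Let measurable_KTF T F : measurable_fun setT (KTF T F).
Proof. by apply: measurable_funM => //; apply: measurable_funD; apply: measurable_funM. Qed.

Let measurable_ET T : measurable_fun setT (ET T).
Proof. by apply: measurable_funD; apply: measurable_funM. Qed.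

Let TP T : T \in enum_set (elements M) -> elements M T.
Proof. by rewrite mem_enum_set ?inE//; exact: (finite_elements hM). Qed.

Let TI T : elements M T -> T \in enum_set (elements M).
Proof. by move=> MT; rewrite mem_enum_set ?inE//; exact: (finite_elements hM). Qed.

Let FP T F : F \in enum_set (faces_of M T) -> faces_of M T F.
Proof. by rewrite mem_enum_set ?inE//; exact: (finite_faces_of hM). Qed.

Let measurable_ETT T : elements M T -> measurable_fun setT ((EFin \o ET T) \_ T).
Proof.
move=> MT; apply/(measurable_restrictT _ (measurable_element hM MT)).
by apply: measurable_funTS; exact/measurable_EFinP.
Qed.

Let ETT0 T x : (0 <= ((EFin \o ET T) \_ T) x)%E.
Proof. by rewrite patchE; case: ifP => // _; rewrite lee_fin. Qed.

Let measurable_E : measurable_fun setT E.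
Proof. by apply: emeasurable_sum_seq => T /TP MT; exact: measurable_ETT. Qed.

Let E0 x : (0 <= E x)%E.
Proof. by apply: sume_ge0 => T _. Qed.

Let E_bound i T x : elements M T -> T x ->
  ((a * `|peval (vT v T) x| `^ (a - 1) * `|peval (mpoly.mderiv i (vT v T)) x|)%:E <= E x)%E.
Proof.
move=> MT Tx; rewrite /E (bigD1_seq T)//=; [|exact: TI|exact: enum_set_uniq].
apply: (@le_trans _ _ (ET T x)%:E); last first.
  by rewrite patchE mem_set//= leeDl// sume_ge0.
rewrite lee_fin; apply: le_trans (young (normr_ge0 _) (normr_ge0 _) ltr01) _.
rewrite powR1 !mulr1 lerD2l ler_wpM2l//.
apply: ge0_ler_powR; rewrite ?nnegrE ?grad_norm_ge0//; last exact: mderiv_le_grad.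
by rewrite (le_trans ler01).
Qed.

Let hF0 T F z : elements M T -> faces_of M T F -> F (chart M F z) -> 0 < face_size M F.
Proof. move=> MT FT; exact: (face_size_gt0 hM hS sf hFs MT FT). Qed.

(** The jump between two elements is the difference of their jumps to the face unknown. [spow_dist]
    leaves four products of a power and a jump; after Young's inequality each term occurs twice,
    whence the factor 2 in [KTF]. *)
Let interface_bound F T1 T2 z : elements M T1 -> elements M T2 -> T1 <> T2 ->
  faces_of M T1 F -> faces_of M T2 F -> F (chart M F z) ->
  `|spow a (peval (vT v T1) (chart M F z)) - spow a (peval (vT v T2) (chart M F z))|
    <= KTF T1 F z + KTF T2 F z.
Proof.
move=> MT1 MT2 T12 FT1 FT2 Fz; have h0 := hF0 MT1 FT1 Fz.
rewrite /KTF (gtr0_norm h0).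
have := young (normr_ge0 (peval (vT v T1) (chart M F z))) (normr_ge0 (jump M v T1 F z)) h0.
have := young (normr_ge0 (peval (vT v T1) (chart M F z))) (normr_ge0 (jump M v T2 F z)) h0.
have := young (normr_ge0 (peval (vT v T2) (chart M F z))) (normr_ge0 (jump M v T1 F z)) h0.
have := young (normr_ge0 (peval (vT v T2) (chart M F z))) (normr_ge0 (jump M v T2 F z)) h0.
have jE : peval (vT v T1) (chart M F z) - peval (vT v T2) (chart M F z) =
  jump M v T2 F z - jump M v T1 F z by rewrite /jump; ring.
have sd := spow_dist (peval (vT v T1) (chart M F z)) (peval (vT v T2) (chart M F z)) a1.
have nj : `|peval (vT v T1) (chart M F z) - peval (vT v T2) (chart M F z)| <=
   `|jump M v T1 F z| + `|jump M v T2 F z|.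
  by rewrite jE [leRHS]addrC ler_normB.
move=> y22 y21 y12 y11; apply: (le_trans sd).
apply: le_trans (ler_wpM2l _ nj) _.
  by apply: mulr_ge0; [exact: le_trans a1|rewrite addr_ge0 ?powR_ge0].
rewrite -/m -!/(Psi m _) in y11 y12 y21 y22 *.
move: y11 y12 y21 y22; set x1 := _ `^ (a - 1); set x2 := _ `^ (a - 1).
set j1 := `|jump M v T1 F z|; set j2 := `|jump M v T2 F z|.
set P1 := Psi _ _; set P2 := Psi _ _; set q1 := _ `^ p; set q2 := _ `^ p.
lra.
Qed.

(** The face unknown vanishes, so the jump is the trace itself up to sign, and
    [|u|^a <= a |u|^(a-1) |u|] as [1 <= a]. *)
Let boundary_bound F T z : elements M T -> faces_of M T F ->
  boundary_face Omega M F -> F (chart M F z) ->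
  `|spow a (peval (vT v T) (chart M F z))| <= KTF T F z.
Proof.
move=> MT FT bF Fz; have h0 := hF0 MT FT Fz.
rewrite /KTF (gtr0_norm h0); have [_ /(_ F FT.1 bF) vF0] := hv.
have := young (normr_ge0 (peval (vT v T) (chart M F z))) (normr_ge0 (jump M v T F z)) h0.
have -> : jump M v T F z = - peval (vT v T) (chart M F z).
  by rewrite /jump vF0 /peval mpoly.meval0 sub0r.
set u := peval (vT v T) (chart M F z); rewrite normrN -/(Psi m _) => y.
rewrite /spow normrM [X in _ * X]ger0_norm ?powR_ge0//.
have t1 : 0 <= eps * face_size M F * Psi m `|u|.
  by rewrite !mulr_ge0 ?Psi_ge0// ltW.
have t2 : 0 <= C * face_size M F `^ (1 - p) * `|u| `^ p by rewrite !mulr_ge0 ?powR_ge0.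
have t3 : 0 <= `|u| `^ (a - 1) * `|u| by rewrite mulr_ge0 ?powR_ge0.
have t4 : `|u| `^ (a - 1) * `|u| <= a * (`|u| `^ (a - 1) * `|u|) by rewrite ler_peMl.
lra.
Qed.

Let trace : R := trace_cst n k rho m.

Let trace_ge0 : 0 <= trace.
Proof. exact: trace_cst_ge0. Qed.

Let PsiV : \bar R := (\sum_(T <- enum_set (elements M))
  \int[lebesgue_rV R n.+1]_(x in T) (Psi m `|peval (vT v T) x|)%:E)%E.

Let PsiT0 T : (0 <= \int[lebesgue_rV R n.+1]_(x in T) (Psi m `|peval (vT v T) x|)%:E)%E.
Proof. by apply: integral_ge0 => x _; rewrite lee_fin Psi_ge0. Qed.

Let measurable_Psi_vh : measurable_fun setT (fun x => (Psi m `|vh M v x|)%:E).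
Proof.
apply/measurable_EFinP; apply: (measurableT_comp (measurable_Psi m)).
by apply: measurableT_comp => //; exact: (measurable_vh hM).
Qed.

Let PsiV_le : (PsiV <= \int[lebesgue_rV R n.+1]_(x in D) (Psi m `|vh M v x|)%:E)%E.
Proof.
pose f T := (fun x => (Psi m `|peval (vT v T) x|)%:E) \_ T.
have mf T : elements M T -> measurable_fun setT (f T).
  move=> MT; apply/(measurable_restrictT _ (measurable_element hM MT)).
  by apply: measurable_funTS; exact/measurable_EFinP.
have f0 T x : (0 <= f T x)%E.
  by rewrite /f patchE; case: ifP => // _; rewrite lee_fin Psi_ge0.
have -> : PsiV = (\int[lebesgue_rV R n.+1]_x \sum_(T <- enum_set (elements M)) f T x)%E.
  rewrite ge0_integral_sum_seq//; last by move=> T /TP MT; exact: mf.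
  by apply: eq_bigr => T _; rewrite [LHS]integral_mkcond.
rewrite [leRHS]integral_mkcond; apply: ge0_le_integral => //.
- by move=> x _; apply: sume_ge0.
- by apply: emeasurable_sum_seq => T /TP MT; exact: mf.
- by apply/(measurable_restrictT _ mD); exact: measurable_funTS.
move=> x _; apply: sum_at_most_one.
- exact: enum_set_uniq.
- by rewrite patchE; case: ifP => // _; rewrite lee_fin Psi_ge0.
- move=> T /TP MT; rewrite /f [leLHS]patchE; case: ifPn; last first.
    by move=> _; rewrite patchE; case: ifP => // _; rewrite lee_fin Psi_ge0.
  rewrite inE => Tx; rewrite patchE mem_set.
    by rewrite (vhE hM) (vpolyE hM v MT Tx).
  by apply: OD; exact: (closure_Omega_element hM MT).
move=> T1 T2 /TP MT1 /TP MT2; rewrite /f !patchE.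
case: ifPn; rewrite ?eqxx// inE => T1x _; case: ifPn; rewrite ?eqxx// inE => T2x _.
exact: (element_inj hM MT1 MT2 T1x T2x).
Qed.

Let gradI T : \bar R := (\int[lebesgue_rV R n.+1]_(x in T) (grad_norm (vT v T) x `^ p)%:E)%E.

Let jumpI T F : \bar R :=
  (\int[lebesgue_rV R n]_(z in chart M F @^-1` F) (`|jump M v T F z| `^ p)%:E)%E.

Let traceI T F : \bar R := (\int[lebesgue_rV R n]_(z in chart M F @^-1` F)
  (Psi m `|peval (vT v T) (chart M F z)|)%:E)%E.

Let gradI0 T : (0 <= gradI T)%E.
Proof. by apply: integral_ge0 => x _; rewrite lee_fin powR_ge0. Qed.

Let jumpI0 T F : (0 <= jumpI T F)%E.
Proof. by apply: integral_ge0 => x _; rewrite lee_fin powR_ge0. Qed.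

Let traceI0 T F : (0 <= traceI T F)%E.
Proof. by apply: integral_ge0 => x _; rewrite lee_fin Psi_ge0. Qed.

Let integral_E : (\int[lebesgue_rV R n.+1]_x E x =
  eps%:E * PsiV + C%:E * \sum_(T <- enum_set (elements M)) gradI T)%E.
Proof.
rewrite /E ge0_integral_sum_seq//; last by move=> T /TP MT; exact: measurable_ETT.
rewrite ge0_sume_distrr// ge0_sume_distrr// -big_split/=.
apply: eq_big_seq => T /TP MT; rewrite -[LHS]integral_mkcond.
have mT := measurable_element hM MT.
rewrite /ET; under eq_integral do rewrite /= EFinD !EFinM.
have e0 := ltW eps0.
have PM : measurable_fun T (fun x => (Psi m `|peval (vT v T) x|)%:E).
  by apply: measurable_funTS; exact/measurable_EFinP.
have GM : measurable_fun T (fun x => (grad_norm (vT v T) x `^ p)%:E).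
  by apply: measurable_funTS; exact/measurable_EFinP.
have P0 x : T x -> (0 <= (Psi m `|peval (vT v T) x|)%:E)%E by rewrite lee_fin Psi_ge0.
have G0 x : T x -> (0 <= (grad_norm (vT v T) x `^ p)%:E)%E by rewrite lee_fin powR_ge0.
rewrite ge0_integralD//; first last.
- exact: emeasurable_funM.
- by move=> x Tx; rewrite mule_ge0// ?G0// lee_fin.
- exact: emeasurable_funM.
- by move=> x Tx; rewrite mule_ge0// ?P0// lee_fin.
by rewrite !ge0_integralZl_EFin.
Qed.

Let integral_KTF T F : faces_of M T F ->
  (\int[lebesgue_rV R n]_(z in chart M F @^-1` F) (KTF T F z)%:E =
   (2 * eps * `|face_size M F|)%:E * traceI T F +
   (2 * C * face_size M F `^ (1 - p))%:E * jumpI T F)%E.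
Proof.
move=> FT; have mF := measurable_chart_preimage hM FT.1.
have KE z : KTF T F z = 2 * eps * `|face_size M F| * Psi m `|peval (vT v T) (chart M F z)| +
    2 * C * face_size M F `^ (1 - p) * `|jump M v T F z| `^ p.
  by rewrite /KTF; ring.
have c1 : 0 <= 2 * eps * `|face_size M F| by rewrite !mulr_ge0// ltW.
have c2 : 0 <= 2 * C * face_size M F `^ (1 - p) by rewrite !mulr_ge0// powR_ge0.
under eq_integral do rewrite KE EFinD !(EFinM (_ * _ * _)).
pose A := chart M F @^-1` F.
have PM : measurable_fun A (fun z => (Psi m `|peval (vT v T) (chart M F z)|)%:E).
  by apply: measurable_funTS; exact/measurable_EFinP.
have JM : measurable_fun A (fun z => (`|jump M v T F z| `^ p)%:E).
  by apply: measurable_funTS; exact/measurable_EFinP.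
have P0 z : A z -> (0 <= (Psi m `|peval (vT v T) (chart M F z)|)%:E)%E.
  by rewrite lee_fin Psi_ge0.
have J0 z : A z -> (0 <= (`|jump M v T F z| `^ p)%:E)%E by rewrite lee_fin powR_ge0.
rewrite ge0_integralD//; first last.
- exact: emeasurable_funM.
- by move=> x Tx; rewrite mule_ge0// ?J0// lee_fin.
- exact: emeasurable_funM.
- by move=> x Tx; rewrite mule_ge0// ?P0// lee_fin.
by rewrite !ge0_integralZl_EFin.
Qed.

Let face_sum_le T : elements M T ->
  (\sum_(F <- enum_set (faces_of M T)) \int[lebesgue_rV R n]_(z in chart M F @^-1` F) (KTF T F z)%:E <=
   (2 * eps * trace)%:E * \int[lebesgue_rV R n.+1]_(x in T) (Psi m `|peval (vT v T) x|)%:E +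
   (2 * C)%:E * \sum_(F <- enum_set (faces_of M T)) (face_size M F `^ (1 - p))%:E * jumpI T F)%E.
Proof.
move=> MT; have e2 : 0 <= 2 * eps by rewrite mulr_ge0// ltW.
have C2 : 0 <= 2 * C by rewrite mulr_ge0.
have -> : (\sum_(F <- enum_set (faces_of M T))
      \int[lebesgue_rV R n]_(z in chart M F @^-1` F) (KTF T F z)%:E =
    (2 * eps)%:E * \sum_(F <- enum_set (faces_of M T)) (face_size M F)%:E * traceI T F +
    (2 * C)%:E * \sum_(F <- enum_set (faces_of M T)) (face_size M F `^ (1 - p))%:E * jumpI T F)%E.
  have hT F : faces_of M T F ->
      (`|face_size M F|%:E * traceI T F = (face_size M F)%:E * traceI T F)%E.
    move=> FT; have [N|/set0P[z Fz]] := eqVneq (chart M F @^-1` F) set0.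
      by rewrite /traceI N integral_set0 !mule0.
    by rewrite (gtr0_norm (hF0 MT FT Fz)).
  rewrite (eq_big_seq (fun F => (2 * eps)%:E * ((face_size M F)%:E * traceI T F) +
     (2 * C)%:E * ((face_size M F `^ (1 - p))%:E * jumpI T F))%E); last first.
    move=> F /FP FT; rewrite integral_KTF// -(hT F FT).
    by rewrite [(2 * eps * _)%:E]EFinM [(2 * C * _)%:E]EFinM -!muleA.
  rewrite big_split/=; congr (_ + _)%E; last first.
    by rewrite ge0_sume_distrr// => F _; rewrite mule_ge0// lee_fin powR_ge0.
  rewrite big_seq [in RHS]big_seq ge0_sume_distrr// => F /FP FT.
  by rewrite -hT// mule_ge0// lee_fin.
apply: leeD => //; rewrite (EFinM (2 * eps)) -muleA; apply: lee_wpmul2l; first by rewrite lee_fin.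
exact: (trace_inequality hM hS sf rho0 hR hFs MT (hv.1.1 T MT) m0).
Qed.

(** The face integrals of [Psi] become volume integrals by [trace_inequality]; the factor [n!] is
    that of the projections of the faces, the factor 2 that of [KTF]. *)
Let tv_bound_le : (tv_bound M E KTF <=
  (eps * (1 + n`!%:R * (2 * trace)))%:E * PsiV +
  (C * (1 + n`!%:R * 2))%:E * energy M p v)%E.
Proof.
rewrite /tv_bound integral_E.
pose gradS := (\sum_(T <- enum_set (elements M)) gradI T)%E.
pose jumpS := (\sum_(T <- enum_set (elements M)) \sum_(F <- enum_set (faces_of M T))
  (face_size M F `^ (1 - p))%:E * jumpI T F)%E.
have g0 : (0 <= gradS)%E by apply: sume_ge0.
have j0T T : (0 <= \sum_(F <- enum_set (faces_of M T)) (face_size M F `^ (1 - p))%:E * jumpI T F)%E.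
  by apply: sume_ge0 => F _; rewrite mule_ge0// lee_fin powR_ge0.
have j0 : (0 <= jumpS)%E by apply: sume_ge0.
have P0 : (0 <= PsiV)%E by apply: sume_ge0.
have enE : energy M p v = (gradS + jumpS)%E by rewrite /energy big_split.
have eps_ge0 := ltW eps0.
have e2 : 0 <= 2 * eps * trace by rewrite mulr_ge0// mulr_ge0.
have C2 : 0 <= 2 * C by rewrite mulr_ge0.
have e3 : 0 <= eps * (n`!%:R * (2 * trace)).
  by rewrite mulr_ge0// mulr_ge0// mulr_ge0.
have C3 : 0 <= C * (n`!%:R * 2) by rewrite !mulr_ge0.
have S1 : (\sum_(T <- enum_set (elements M)) \sum_(F <- enum_set (faces_of M T))
    \int[lebesgue_rV R n]_(z in chart M F @^-1` F) (KTF T F z)%:E <=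
    (2 * eps * trace)%:E * PsiV + (2 * C)%:E * jumpS)%E.
  rewrite !ge0_sume_distrr// -big_split/= big_seq [leRHS]big_seq.
  by apply: lee_sum => T /TP MT; exact: face_sum_le.
apply: (@le_trans _ _ (eps%:E * PsiV + C%:E * gradS + n`!%:R%:E *
    ((2 * eps * trace)%:E * PsiV + (2 * C)%:E * jumpS))%E).
  by apply: leeD => //; apply: lee_wpmul2l.
rewrite enE [X in (_ + X <= _)%E]ge0_muleDr ?mule_ge0 ?lee_fin//.
rewrite !(muleA n`!%:R%:E) -!(EFinM n`!%:R).
have -> : n`!%:R * (2 * eps * trace) = eps * (n`!%:R * (2 * trace)) by ring.
have -> : n`!%:R * (2 * C) = C * (n`!%:R * 2) by ring.
move: e3 C3; move: (n`!%:R * (2 * trace)) (n`!%:R * 2) => X Y e3 C3.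
have split2 (b c : R) (Z : \bar R) : 0 <= b -> 0 <= b * c ->
    ((b * (1 + c))%:E * Z = b%:E * Z + (b * c)%:E * Z)%E.
  by move=> b0 bc0; rewrite mulrDr mulr1 EFinD ge0_muleDl ?lee_fin.
rewrite (split2 eps X)// (split2 C Y)// !(ge0_muleDr _ g0 j0) addeACA.
apply: leeD => //; apply: leeD; first by rewrite leeDl// mule_ge0 ?lee_fin.
by rewrite leeDr// mule_ge0 ?lee_fin.
Qed.

Lemma main_estimate :
  (\int[lebesgue_rV R n.+1]_(x in D) (`|vh M v x| `^ m)%:E <=
   (1 + lebesgue_rV R n.+1 D) *
   ((eps * (1 + n`!%:R * (2 * trace_cst n k rho (a * s))))%:E *
      \int[lebesgue_rV R n.+1]_(x in D) (Psi m `|vh M v x|)%:E +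
    (C * (1 + n`!%:R * 2))%:E * energy M p v) `^ s)%E.
Proof.
apply: (le_trans (discrete_sobolev hM hS sf bO a1 measurable_E E0 E_bound KTF0
  measurable_KTF interface_bound boundary_bound s1 sn mD)).
apply: lee_wpmul2l; first by rewrite adde_ge0.
apply: le_poweR; first exact: le_trans s1.
  rewrite /tv_bound adde_ge0 ?mule_ge0 ?lee_fin//; first exact: integral_ge0.
  apply: sume_ge0 => T _; apply: sume_ge0 => F _; apply: integral_ge0 => z _.
  by rewrite lee_fin.
apply: (le_trans tv_bound_le); apply: leeD => //; apply: lee_wpmul2l; last exact: PsiV_le.
have eps_ge0 := ltW eps0.
by rewrite lee_fin mulr_ge0// addr_ge0// mulr_ge0// mulr_ge0.
Qed.

End main_estimate.

(** * Homogeneity and boundedness of the discrete function *)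

Section scaling.
Context {R : realType} {n : nat}.
Variables (Omega : set 'rV[R]_n.+1) (M : mesh R n.+1) (h : R).
Hypothesis hM : is_mesh Omega h M.

Definition scale_dofs (c : R) (v : dofs R n.+1) : dofs R n.+1 :=
  Dofs (fun T => c *: vT v T) (fun F => c *: vF v F).

Lemma peval_scale (d : nat) (c : R) (w : mpoly.mpoly d R) x :
  peval (c *: w) x = c * peval w x.
Proof. by rewrite /peval mpoly.mevalZ. Qed.

Lemma degree_le_scale (d k : nat) (c : R) (w : mpoly.mpoly d R) :
  degree_le k w -> degree_le k (c *: w).
Proof. by move=> wk; apply: leq_trans wk; exact: mpoly.mmeasureZ_le. Qed.

Lemma Uh0_scale (k : nat) (c : R) v : Uh0 Omega M k v -> Uh0 Omega M k (scale_dofs c v).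
Proof.
move=> [[hT hF] h0]; split; first split.
- by move=> T MT; exact/degree_le_scale/hT.
- by move=> F MF; exact/degree_le_scale/hF.
- by move=> F MF bF; rewrite /= h0// scaler0.
Qed.

Lemma vh_scale (c : R) v x : vh M (scale_dofs c v) x = c * vh M v x.
Proof.
rewrite /vh !(fsbig_finite _ _ (finite_elements hM)) mulr_sumr.
apply: eq_bigr => T _; rewrite !patchE; case: ifP => _; last by rewrite mulr0.
exact: peval_scale.
Qed.

Lemma grad_norm_scale (d : nat) (c : R) (w : mpoly.mpoly d R) x : 0 <= c ->
  grad_norm (c *: w) x = c * grad_norm w x.
Proof.
move=> c0; rewrite /grad_norm.
have -> : \row_i peval (mpoly.mderiv i (c *: w)) x = c *: \row_i peval (mpoly.mderiv i w) x.
  by apply/rowP => i; rewrite !mxE mpoly.mderivZ peval_scale.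
by rewrite enormZ ger0_norm.
Qed.

Lemma jump_scale (c : R) v T F z :
  jump M (scale_dofs c v) T F z = c * jump M v T F z.
Proof. by rewrite /jump /= !peval_scale mulrBr. Qed.

Lemma energy_ge0 (p : R) v : (0 <= energy M p v)%E.
Proof.
apply: sume_ge0 => T _; apply: adde_ge0.
  by apply: integral_ge0 => x _; rewrite lee_fin powR_ge0.
apply: sume_ge0 => F _; rewrite mule_ge0 ?lee_fin ?powR_ge0//.
by apply: integral_ge0 => x _; rewrite lee_fin powR_ge0.
Qed.

Lemma energy_scale (p c : R) v : 0 <= c ->
  (energy M p (scale_dofs c v) = (c `^ p)%:E * energy M p v)%E.
Proof.
move=> c0; rewrite /energy.
have cp : 0 <= c `^ p by exact: powR_ge0.
have J0 T F : (0 <= (face_size M F `^ (1 - p))%:E *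
    \int[lebesgue_rV R n]_(z in chart M F @^-1` F) (`|jump M v T F z| `^ p)%:E)%E.
  rewrite mule_ge0 ?lee_fin ?powR_ge0//.
  by apply: integral_ge0 => x _; rewrite lee_fin powR_ge0.
have G0 T : (0 <= \int[lebesgue_rV R n.+1]_(x in T) (grad_norm (vT v T) x `^ p)%:E)%E.
  by apply: integral_ge0 => x _; rewrite lee_fin powR_ge0.
rewrite ge0_sume_distrr; last first.
  by move=> T _; rewrite adde_ge0// sume_ge0.
apply: eq_big_seq => T; rewrite mem_enum_set ?inE; last exact: finite_elements hM.
move=> MT; rewrite ge0_muleDr//; last exact: sume_ge0.
apply: (f_equal2 (fun e1 e2 : \bar R => (e1 + e2)%E)).
  rewrite -ge0_integralZl_EFin//.
  - by apply: eq_integral => x _; rewrite /= grad_norm_scale// powRM ?grad_norm_ge0.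
  - exact: (measurable_element hM).
  - by move=> x _; rewrite lee_fin powR_ge0.
  - apply: measurable_funTS; apply/measurable_EFinP.
    by apply: (measurableT_comp (measurable_powR p)); exact: measurable_grad_norm.
rewrite ge0_sume_distrr//; apply: eq_big_seq => F; rewrite mem_enum_set ?inE; last exact: (finite_faces_of hM).
move=> [MF _]; rewrite muleCA; apply: (f_equal (fun e : \bar R => (_ * e)%E)).
rewrite -ge0_integralZl_EFin//.
- by apply: eq_integral => z _; rewrite jump_scale normrM (ger0_norm c0) powRM.
- exact: (measurable_chart_preimage hM).
- apply: measurable_funTS; apply/measurable_EFinP.
  apply: (measurableT_comp (measurable_powR p)); apply: measurableT_comp => //.
  exact: measurable_jump.
Qed.

(** Boundedness makes the integral of [|v_h|^m] finite, without which it could not be scaled to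
    1. *)
Lemma vh_bounded v : exists2 B : R, 0 <= B & forall x, `|vh M v x| <= B.
Proof.
suff [B B0 HB] : exists2 B : R, 0 <= B & forall T x, T \in enum_set (elements M) ->
    T x -> `|peval (vT v T) x| <= B.
  exists B => // x; rewrite (vhE hM).
  have [[T [MT Tx]]|hx] := pselect (exists T, elements M T /\ T x).
    rewrite (vpolyE hM v MT Tx); apply: HB => //.
    by rewrite mem_enum_set ?inE//; exact: (finite_elements hM).
  rewrite vpoly0 => [|T MT Tx]; last by apply: hx; exists T.
  by rewrite /peval mpoly.meval0 normr0.
have : forall T, T \in enum_set (elements M) -> bounded_set T.
  move=> T; rewrite mem_enum_set ?inE; last exact: (finite_elements hM).
  exact: (element_bounded hM).
elim: (enum_set _) => [|T s IHs] bs; first by exists 0.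
have [T' T's|B B0 HB] := IHs; first by apply: bs; rewrite inE T's orbT.
have [b b0 Tb] := bounded_coord (bs T (mem_head _ _)).
have [B' B'0 HB'] := peval_bounded (vT v T) (ltW b0).
exists (B + B'); first exact: addr_ge0.
move=> T' x; rewrite inE => /orP[/eqP ->|T's] T'x.
  by rewrite (le_trans (HB' x _)) ?lerDr// => i; exact: Tb.
by rewrite (le_trans (HB _ _ T's T'x)) ?lerDl.
Qed.

End scaling.

Section forms.
Context {R : realType} {n : nat}.
Variables (Omega : set 'rV[R]_n.+1) (M : mesh R n.+1) (Ss : set (set 'rV[R]_n.+1)) (h : R).
Hypothesis hM : is_mesh Omega h M.
Hypothesis hS : simplicial_submesh Omega M Ss.

Lemma submesh_forms_exist : exists av bf ff Ls, submesh_forms M Ss av bf ff Ls.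
Proof.
have [ab abP] : {ab : set 'rV[R]_n.+1 -> ('I_n.+2 -> 'rV[R]_n.+1) * ('I_n.+2 -> 'rV[R]_n.+1 * R) &
    forall S, Ss S -> is_simplex (ab S).1 S /\ is_bary (ab S).1 (ab S).2}.
  apply: (@boolp.choice _ _ (fun S ab => Ss S -> is_simplex ab.1 S /\ is_bary ab.1 ab.2)) => S.
  have [SS|nS] := pselect (Ss S); last by exists (fun=> 0, fun=> (0, 0)).
  case: hS => -[_ /(_ S SS)[a aS] _ _ _] _ _ _.
  by have [b ab] := bary_exists aS.1; exists (a, b).
have [ff ffP] : {ff : set 'rV[R]_n.+1 -> 'rV[R]_n.+1 * R & forall F, faces M F ->
    (ff F).1 != 0 /\ range (chart M F) = [set x | aev (ff F) x = 0]}.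
  apply: (@boolp.choice _ _ (fun F l => faces M F ->
    l.1 != 0 /\ range (chart M F) = [set x | aev l x = 0])) => F.
  have [MF|nF] := pselect (faces M F); last by exists (0, 0).
  case: hM => _ _ _ [_ /(_ F MF)[[[nu [c [nu0 HE]]] _] _ _ _ _] _ _] _.
  exists (nu, - c) => _; split => //; rewrite HE; apply/seteqP; split => x /=.
    by rewrite /aev/= => ->; rewrite subrr.
  by rewrite /aev/= => /eqP; rewrite subr_eq0 => /eqP.
pose Ls := [seq (ab S0).2 j | S0 <- enum_set Ss, j <- enum 'I_n.+2] ++
  [seq ff F | F <- enum_set (faces M)].
have fS : finite_set Ss by case: hS => -[].
have fF : finite_set (faces M) by case: hM => _ _ _ [].
exists (fun S => (ab S).1), (fun S => (ab S).2), ff, Ls; split.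
- by move=> S /abP[].
- by move=> S /abP[].
- by move=> F /ffP[].
- move=> S0 j SS; rewrite mem_cat; apply/orP; left; apply/allpairsP; exists (S0, j).
  by rewrite mem_enum mem_enum_set// inE.
- by move=> F MF; rewrite mem_cat map_f ?orbT// mem_enum_set ?inE.
move=> l; rewrite mem_cat => /orP[/allpairsP[[S j] /= [SS _ ->]]|/mapP[F FM ->]].
  move: SS; rewrite mem_enum_set ?inE// => /abP[_ [_ _ bd]].
  (* The form is 1 at its own vertex and 0 at a second one, [i], so it is not constant. *)
  apply/eqP => l0; pose i := if j == ord0 then ord_max else ord0 : 'I_n.+2.
  have ij : j != i by rewrite /i; case: ifPn => // /eqP ->.
  have := bd j j; have := bd j i; rewrite eqxx (negbTE ij) /aev l0 ![dot 0 _]dotC !dot0r.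
  by move=> -> /eqP; rewrite eq_sym oner_eq0.
by move: FM; rewrite mem_enum_set ?inE// => /ffP[].
Qed.

End forms.

(** * Normalisation and the bound for one mesh *)

Section final_bound.
Context {R : realType} {n : nat}.
Variables (Omega : set 'rV[R]_n.+1) (M : mesh R n.+1) (Ss : set (set 'rV[R]_n.+1)) (h rho : R).
Hypothesis hM : is_mesh Omega h M.
Hypothesis hS : simplicial_submesh Omega M Ss.
Hypothesis bO : bounded_set Omega.
Hypothesis oO : open Omega.
Hypothesis rho0 : 0 < rho.
Hypothesis hR : regular_submesh rho M Ss.
Hypothesis hFs : face_size_ok rho M.
Variables (D : set 'rV[R]_n.+1) (k : nat) (p q a s : R).
Hypotheses (mD : measurable D) (OD : closure Omega `<=` D).
Hypothesis Dfin : (lebesgue_rV R n.+1 D < +oo)%E.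
Hypotheses (p1 : 1 <= p) (q1 : 1 <= q) (a1 : 1 <= a) (s1 : 1 <= s).
Hypothesis sn : (0 < n)%N -> s = n.+1%:R / n%:R.
Hypothesis qm : q <= a * s.
Variables (eps C : R).
Hypotheses (eps0 : 0 < eps) (C0 : 0 <= C).
Hypothesis young : forall u b h, 0 <= u -> 0 <= b -> 0 < h ->
  a * u `^ (a - 1) * b <= eps * h * (1 + u `^ (a * s)) + C * h `^ (1 - p) * b `^ p.

Let V : R := fine (lebesgue_rV R n.+1 D).
Let VE : lebesgue_rV R n.+1 D = V%:E.
Proof. by rewrite fineK// ge0_fin_numE. Qed.

Let V0 : 0 <= V.
Proof. by rewrite fine_ge0. Qed.

Let integral_cstD (r : R) : (\int[lebesgue_rV R n.+1]_(x in D) r%:E = (r * V)%:E)%E.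
Proof. by rewrite integral_cst// EFinM -VE. Qed.

(** The solution of [(1 + V) delta^s = 1]: a base below it brings the right-hand side of
    [main_estimate] under 1. *)
Let delta : R := (1 + V) `^ (- s^-1).
Let C3 : R := 1 + n`!%:R * (2 * trace_cst n k rho (a * s)).
Let C4 : R := C * (1 + n`!%:R * 2).
Hypothesis eps_small : eps * C3 * (V + 1) <= delta / 2.

(** Energy below this value keeps [C4 * energy] under [delta / 2]; the added 1 guards against
    [C4 = 0]. *)
Definition energy_cst : R := delta / (2 * (C4 + 1)).

Let C40 : 0 <= C4.
Proof. by rewrite mulr_ge0// addr_ge0// mulr_ge0. Qed.

Let delta0 : 0 < delta.
Proof. by rewrite powR_gt0// ltr_wpDr. Qed.

Lemma energy_cst_gt0 : 0 < energy_cst.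
Proof. by rewrite divr_gt0// mulr_gt0// ltr_wpDl. Qed.

Let m : R := a * s.
Let m_gt0 : 0 < m.
Proof. by rewrite mulr_gt0// (lt_le_trans ltr01). Qed.

Let I v : \bar R := (\int[lebesgue_rV R n.+1]_(x in D) (`|vh M v x| `^ m)%:E)%E.

Let measurable_vhr v (r : R) : measurable_fun setT (fun x => (`|vh M v x| `^ r)%:E).
Proof.
apply/measurable_EFinP; apply: (measurableT_comp (measurable_powR r)).
by apply: measurableT_comp => //; exact: (measurable_vh hM).
Qed.

Let I_ge0 v : (0 <= I v)%E.
Proof. by apply: integral_ge0 => x _; rewrite lee_fin powR_ge0. Qed.

Let Psi_I v : (\int[lebesgue_rV R n.+1]_(x in D) (Psi m `|vh M v x|)%:E = V%:E + I v)%E.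
Proof.
rewrite /Psi; under eq_integral do rewrite EFinD.
rewrite ge0_integralD//; last by apply: measurable_funTS; exact: measurable_vhr.
by rewrite integral_cstD mul1r.
Qed.

(** Otherwise the energy term, together with the [eps] term that is at most [delta / 2], would stay
    below [delta], and [main_estimate] would give [1 < 1]. *)
Let normalized v : Uh0 Omega M k v -> I v = 1%E -> (energy_cst%:E <= energy M p v)%E.
Proof.
move=> hv I1; have [av [bf [ff [Ls sf]]]] := submesh_forms_exist hM hS.
have := main_estimate hM hS sf bO rho0 hR hFs mD OD p1 a1 s1 sn eps0 C0 young hv.
rewrite -/m -/(I v) -/C3 -/C4 Psi_I I1 VE.
have := energy_ge0 M p v; case: (energy M p v) => [B|_|//]; last by rewrite leey.
rewrite lee_fin => B0.
rewrite [X in (_ <= X)%E -> _](_ : _ =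
  ((1 + V) * (eps * C3 * (V + 1) + C4 * B) `^ s)%:E)// !lee_fin => H.
rewrite leNgt; apply/negP => Bc.
have X0 : 0 <= eps * C3 * (V + 1) + C4 * B.
  rewrite addr_ge0//; last exact: mulr_ge0.
  rewrite mulr_ge0// ?addr_ge0//; apply: mulr_ge0; first exact: ltW.
  by rewrite addr_ge0// mulr_ge0// mulr_ge0// trace_cst_ge0.
have Xd : eps * C3 * (V + 1) + C4 * B < delta.
  have : C4 * B <= (C4 + 1) * B by rewrite ler_wpM2r// lerDl.
  have : (C4 + 1) * B < delta / 2.
    rewrite mulrC -ltr_pdivlMr ?ltr_wpDl//.
    by apply: lt_le_trans Bc _; rewrite /energy_cst invfM mulrA.
  move: eps_small; move: (eps * C3 * (V + 1)) (C4 * B) ((C4 + 1) * B) => x y z.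
  lra.
have s0 : 0 < s by apply: lt_le_trans s1.
have : (eps * C3 * (V + 1) + C4 * B) `^ s < delta `^ s.
  by rewrite gt0_ltr_powR// nnegrE// ltW.
rewrite /delta -powRrM mulNr mulVf ?gt_eqF// powR_inv1 ?addr_ge0// => Hs.
have : (1 + V) * (eps * C3 * (V + 1) + C4 * B) `^ s < 1.
  by rewrite mulrC -ltr_pdivlMr ?mul1r// ltr_wpDr.
by rewrite ltNge H.
Qed.

Let I_fin v : (I v < +oo)%E.
Proof.
have [B B0 HB] := vh_bounded hM v.
apply: (@le_lt_trans _ _ (\int[lebesgue_rV R n.+1]_(x in D) (B `^ m)%:E)%E).
  apply: ge0_le_integral => //.
  - by apply: measurable_funTS; exact: measurable_vhr.
  - by move=> x _; rewrite lee_fin; apply: ge0_ler_powR; rewrite ?nnegrE// ltW.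
by rewrite integral_cstD ltry.
Qed.

Let J v : \bar R := (\int[lebesgue_rV R n.+1]_(x in Omega) (`|vh M v x| `^ q)%:E)%E.

Let q0 : 0 < q.
Proof. exact: lt_le_trans q1. Qed.

Let p0 : 0 < p.
Proof. exact: lt_le_trans p1. Qed.

Let mO : measurable Omega.
Proof. exact: open_measurable_rV. Qed.

Let J_le v : (J v <= \int[lebesgue_rV R n.+1]_(x in D) (`|vh M v x| `^ q)%:E)%E.
Proof.
apply: ge0_subset_integral => //.
- by apply: measurable_funTS; exact: measurable_vhr.
- exact: subset_trans (@subset_closure _ _) OD.
Qed.

Let J_ge0 v : (0 <= J v)%E.
Proof. by apply: integral_ge0 => x _; rewrite lee_fin powR_ge0. Qed.

(** [|v_h|^q] is the power [q / m] of [|v_h|^m], which vanishes almost everywhere. *)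
Let J_I0 v : I v = 0%E -> J v = 0%E.
Proof.
move=> I0; apply/eqP; rewrite eq_le J_ge0 andbT; apply: (le_trans (J_le v)).
pose f := (fun x => (`|vh M v x| `^ m)%:E) \_ D.
have mf : measurable_fun setT f.
  by apply/(measurable_restrictT _ mD); apply: measurable_funTS; exact: measurable_vhr.
have f0 x : (0 <= f x)%E by rewrite /f patchE; case: ifP => // _; rewrite lee_fin powR_ge0.
have fI : (\int[lebesgue_rV R n.+1]_x f x = 0)%E by rewrite -I0 /I [RHS]integral_mkcond.
have := @integral0_ae0 _ _ _ (lebesgue_rV R n.+1) f (cst 1%E) (q / m) 1
  (divr_gt0 q0 m_gt0) mf f0 (measurable_cst _) (fun=> lee01) fI.
move=> <-; rewrite le_eqVlt; apply/orP; left; apply/eqP.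
rewrite [LHS]integral_mkcond; apply: eq_integral => x _.
rewrite /f !patchE poweR1r mule1; case: ifP => _.
  by rewrite poweR_EFin -powRrM mulrCA divff ?mulr1// gt_eqF.
by rewrite poweR0r// gt_eqF// divr_gt0.
Qed.

(** Rescale by [lam] so that the integral of [|v_h|^m] becomes 1. Then the norm of order [q] is at
    most [(V + 1)^(1/q)], while the discrete norm is at least [energy_cst^(1/p)]; both are
    homogeneous of degree 1, so [lam] cancels from the quotient. *)
Lemma Lq_bound v : Uh0 Omega M k v ->
  (Lpnorm q Omega (vh M v) <=
   ((V + 1) `^ q^-1 * energy_cst `^ (- p^-1))%:E * norm_1ph M p v)%E.
Proof.
move=> hv; rewrite (norm_1phE v hM) ?gt_eqF//.
have LE : (Lpnorm q Omega (vh M v) = J v `^ q^-1)%E.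
  rewrite /J -Lpnorm_powR ?gt_eqF// -poweRrM divff ?gt_eqF// poweRe1//.
  exact: Lnorm_ge0.
have c0 := energy_cst_gt0.
have K0 : 0 < (V + 1) `^ q^-1 * energy_cst `^ (- p^-1).
  by rewrite mulr_gt0 ?powR_gt0// ltr_wpDl.
rewrite LE; have := energy_ge0 M p v; case EB : (energy M p v) => [B| |]//; last first.
  move=> _.
  by rewrite poweRyr ?gt0_muley ?leey// ?lte_fin// invr_neq0 ?gt_eqF.
rewrite lee_fin => B0.
have [I0|I0] := eqVneq (I v) 0%E.
  rewrite J_I0// poweR0r ?invr_neq0 ?gt_eqF//.
  by rewrite mule_ge0 ?poweR_ge0// lee_fin ltW.
have [r r0 IE] : exists2 r : R, 0 < r & I v = r%:E.
  exists (fine (I v)); last by rewrite fineK// (ge0_fin_numE (I_ge0 v)) I_fin.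
  by rewrite fine_gt0// lt0e I0 I_ge0/= I_fin.
pose lam := r `^ (- m^-1); have lam0 : 0 < lam by rewrite powR_gt0.
have lamm : lam `^ m = r^-1 by rewrite /lam -powRrM mulNr mulVf ?gt_eqF// powR_inv1// ltW.
have Iscale : I (scale_dofs lam v) = 1%E.
  rewrite /I; under eq_integral do rewrite (vh_scale hM) normrM (gtr0_norm lam0) powRM ?(ltW lam0)// EFinM.
  rewrite ge0_integralZl_EFin ?powR_ge0//.
  - by rewrite -/(I v) IE -EFinM lamm mulVf ?gt_eqF.
  - by apply: measurable_funTS; exact: measurable_vhr.
have := normalized (Uh0_scale lam hv) Iscale.
rewrite (energy_scale hM _ _ (ltW lam0)) EB -EFinM lee_fin => cB.
(* Since [q <= m], [|u|^q] is at most [Psi m |u|], and for the rescaled function [Psi] has integral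
   [V + 1]. *)
have JV : ((lam `^ q)%:E * J v <= (V + 1)%:E)%E.
  apply: (@le_trans _ _ ((lam `^ q)%:E * \int[lebesgue_rV R n.+1]_(x in D) (`|vh M v x| `^ q)%:E)%E).
    by apply: lee_wpmul2l; rewrite ?lee_fin ?powR_ge0//; exact: J_le.
  have -> : (V + 1)%:E = (\int[lebesgue_rV R n.+1]_(x in D) (Psi m `|vh M (scale_dofs lam v) x|)%:E)%E.
    by rewrite Psi_I Iscale.
  have mq : measurable_fun D (fun x => (`|vh M v x| `^ q)%:E).
    by apply: measurable_funTS; exact: measurable_vhr.
  have -> : ((lam `^ q)%:E * \int[lebesgue_rV R n.+1]_(x in D) (`|vh M v x| `^ q)%:E =
      \int[lebesgue_rV R n.+1]_(x in D) ((lam `^ q)%:E * (`|vh M v x| `^ q)%:E))%E.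
    by rewrite ge0_integralZl_EFin// ?powR_ge0// => x _; rewrite lee_fin powR_ge0.
  apply: ge0_le_integral => //.
  - by move=> x _; rewrite mule_ge0// lee_fin powR_ge0.
  - by apply: emeasurable_funM => //; apply: measurable_funTS; exact: measurable_vhr.
  - apply: measurable_funTS; apply/measurable_EFinP; apply: (measurableT_comp (measurable_Psi m)).
    by apply: measurableT_comp => //; exact: (measurable_vh hM).
  - move=> x _; rewrite (vh_scale hM) normrM (gtr0_norm lam0) -EFinM -powRM ?(ltW lam0)// lee_fin.
    apply: powR_le1D => //; last exact: ltW.
    by apply: mulr_ge0 => //; exact: ltW.
have [j j0 JE] : exists2 j : R, 0 <= j & J v = j%:E.
  have Jfin : (J v < +oo)%E.
    rewrite ltNge leye_eq; apply/negP => /eqP Jy; move: JV; rewrite Jy.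
    by rewrite gt0_muley ?lte_fin ?powR_gt0.
  by exists (fine (J v)); [rewrite fine_ge0|rewrite fineK// (ge0_fin_numE (J_ge0 v))].
move: JV; rewrite JE -EFinM lee_fin => jV.
rewrite !poweR_EFin -EFinM lee_fin.
have h1 : lam * j `^ q^-1 <= (V + 1) `^ q^-1.
  have -> : lam * j `^ q^-1 = (lam `^ q * j) `^ q^-1.
    by rewrite powRM ?powR_ge0// -powRrM divff ?gt_eqF// powRr1// ltW.
  by apply: ge0_ler_powR; rewrite ?nnegrE ?invr_ge0 ?(ltW q0)// ?mulr_ge0 ?powR_ge0// addr_ge0.
have h2 : energy_cst `^ p^-1 <= lam * B `^ p^-1.
  have -> : lam * B `^ p^-1 = (lam `^ p * B) `^ p^-1.
    by rewrite powRM ?powR_ge0// -powRrM divff ?gt_eqF// powRr1// ltW.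
  apply: ge0_ler_powR; rewrite ?nnegrE ?invr_ge0 ?(ltW p0)//; try exact: ltW.
  by apply: mulr_ge0 => //; exact: powR_ge0.
have h3 : 1 <= energy_cst `^ (- p^-1) * (lam * B `^ p^-1).
  have e0 : 0 < energy_cst `^ p^-1 by rewrite powR_gt0.
  by rewrite powRN ler_pdivlMl// mulr1.
have j'0 : 0 <= j `^ q^-1 by exact: powR_ge0.
have V'0 : 0 <= (V + 1) `^ q^-1 by exact: powR_ge0.
rewrite -(ler_pM2l lam0); apply: (le_trans h1).
rewrite [leRHS](_ : _ = (V + 1) `^ q^-1 * (energy_cst `^ (- p^-1) * (lam * B `^ p^-1))); last by ring.
by rewrite ler_peMr.
Qed.

End final_bound.

(** Every constant is fixed before a mesh is introduced: the box [D] from the domain, [a] and [s]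
    from [d], [p] and [q], then [eps] from these with [rho] and [k], and [C] of Young's inequality
    from [eps]. *)
Theorem proposition5p4 (R : realType) (d : nat) (hd : (1 <= d)%N)
    (Omega : set 'rV[R]_d) (hOmega : polyhedral Omega)
    (rho : R) (hrho : 0 < rho) (k : nat) (p q : R)
    (hp : 1 <= p) (hq : 1 <= q)
    (hpq : p < d%:R -> q <= sobolev_exponent d p) :
  exists2 C : R, 0 < C &
    forall (Hs : set R) (Ms : R -> mesh R d),
      mesh_sizes Hs -> admissible Omega rho Hs Ms ->
      forall h, Hs h ->
        forall v : dofs R d, Uh0 Omega (Ms h) k v ->
          (Lpnorm q Omega (vh (Ms h) v) <= C%:E * norm_1ph (Ms h) p v)%E.
Proof.
case: d hd Omega hOmega hpq => [//|n] _ Omega [oO _ bO _ _] hpq.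
have [a [s [a1 s1 sn qm [pa am]]]] := sobolev_exponents hp hq hpq.
have [D [mD OD Dfin]] := closure_box bO.
pose V := fine (lebesgue_rV R n.+1 D).
have V0 : 0 <= V by rewrite fine_ge0.
pose C3 : R := 1 + n`!%:R * (2 * trace_cst n k rho (a * s)).
have C30 : 0 < C3.
  by rewrite ltr_wpDr// mulr_ge0// mulr_ge0// trace_cst_ge0.
pose delta := (1 + V) `^ (- s^-1).
have delta0 : 0 < delta by rewrite powR_gt0// ltr_wpDr.
have V1 : 0 < V + 1 by rewrite ltr_wpDl.
(* With the integral of [|v_h|^m] equal to 1, the [eps] term takes exactly half of the threshold
   [delta]. *)
pose eps := delta / 2 / (C3 * (V + 1)).
have eps0 : 0 < eps by rewrite divr_gt0 ?mulr_gt0// divr_gt0.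
have m0 : 0 <= a * s by rewrite mulr_ge0// (le_trans ler01).
have [C C0 young] := sobolev_young a1 hp m0 pa am eps0.
have es : eps * C3 * (V + 1) <= delta / 2.
  by rewrite /eps -mulrA divfK// gt_eqF// mulr_gt0.
have ec0 : 0 < energy_cst D s C by exact: energy_cst_gt0.
exists ((V + 1) `^ q^-1 * energy_cst D s C `^ (- p^-1)).
  by rewrite mulr_gt0 ?powR_gt0.
move=> Hs Ms _ adm h Hh v hv; have [hM hFs [Ss hS hR]] := adm h Hh.
exact: (Lq_bound hM hS bO oO hrho hR hFs mD OD Dfin hp hq a1 s1 sn qm eps0 C0 young es hv).
Qed.
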